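(* Let $0<\beta<1$ and let $\tau_0>0$. Let $\tilde u$ and the $\sigma$-field $\mathscr{F}_{\tau_0}$ be as defined in the context. The following statements hold. (i) There exists a positive, finite, $\mathscr{F}_{\tau_0}$-measurable random variable $\Lambda$ such that $$\limsup_{h\to 0+}\frac{|\tilde u(\tau_0,\Lambda+h)-\tilde u(\tau_0,\Lambda)|}{\sqrt{h^{2-\beta}\log\log(1/h)}}=\infty\quad\text{a.s.}$$ (ii) If $\Lambda$ is any positive, finite, $\mathscr{F}_{\tau_0}$-measurable random variable, then on an event of probability $1$ we have, simultaneously for all $\tau>\tau_0$, $$\limsup_{h\to 0+}\frac{|\tilde u(\tau_0,\Lambda+h)-\tilde u(\tau_0,\Lambda)|}{\sqrt{h^{2-\beta}\log\log(1/h)}}=\infty\iff\limsup_{h\to 0+}\frac{|\tilde u(\tau,\Lambda+h)-\tilde u(\tau,\Lambda)|}{\sqrt{h^{2-\beta}\log\log(1/h)}}=\infty.$$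
   Context: Fix $0<\beta<1$ and a complete probability space $(\Omega,\mathscr{F},\mathbb{P})$. Let $W$ be a mean zero Gaussian noise, white in time and colored in space: $\{W(\varphi)\}$ is a mean zero Gaussian process indexed by $\varphi\in C_c^\infty(\mathbb{R}_+\times\mathbb{R})$ with $\mathbb{E}[W(\varphi)W(\psi)]=\int_{\mathbb{R}_+}ds\int_{\mathbb{R}}dy\int_{\mathbb{R}}dy'\,\varphi(s,y)|y-y'|^{-\beta}\psi(s,y')$, extended by $L^2(\mathbb{P})$-limits to bounded Borel sets $A\subset\mathbb{R}_+\times\mathbb{R}$ (writing $W(A)$ for the value at $\mathbf{1}_A$), so that $\{W(A)\}$ is a mean zero Gaussian family with $$\mathbb{E}[W(A)W(B)]=\int_{\mathbb{R}_+}ds\int_{\mathbb{R}}dy\int_{\mathbb{R}}dy'\,\mathbf{1}_A(s,y)|y-y'|^{-\beta}\mathbf{1}_B(s,y').$$ For $t\ge 0$, $x\in\mathbb{R}$, let $\Delta(t,x)=\{(s,y)\in\mathbb{R}_+\times\mathbb{R}:0\le s\le t,\ |x-y|\le t-s\}$ and $u(t,x)=\frac12 W(\Delta(t,x))$. This is the mild solution of $\partial_t^2u-\partial_x^2u=\dot W$ with zero initial data $u(0,x)=\partial_tu(0,x)=0$. The random field $u$ is taken to be its continuous version. For $\tau\ge0$, $\lambda\ge0$ put $$\tilde u(\tau,\lambda)=u\Big(\frac{\tau+\lambda}{\sqrt2},\frac{-\tau+\lambda}{\sqrt2}\Big).$$ For $\tau_0>0$ let $\Pi(\tau_0)=\{(s,y):0\le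 s<\tau_0/\sqrt2,\ y\in\mathbb{R}\}$, and let $\mathscr{F}_{\tau_0}$ be the $\sigma$-field generated by $\{W(B\cap\Pi(\tau_0)):B\text{ a bounded Borel subset of }\mathbb{R}^2\}$ and the $\mathbb{P}$-null sets. *)

(* Defs.v *)
From mathcomp Require Import all_boot all_order all_algebra.
From mathcomp Require Import all_classical all_reals all_analysis.
Import Order.TTheory GRing.Theory Num.Theory numFieldNormedType.Exports.

Set Implicit Arguments.
Unset Strict Implicit.
Unset Printing Implicit Defensive.

Local Open Scope classical_set_scope.
Local Open Scope ring_scope.

(* [normal_prob m 0] of the library is the uniform law on [0, 1], not the point
   mass at m; a degenerate Gaussian variable has to be treated separately. *)
Definition gaussian_law (R : realType) (m s : R) (B : set R) : \bar R :=
  if s == 0 then \d_m B else normal_prob m s B.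

Definition gaussian_rv d (Omega : measurableType d) (R : realType)
    (P : probability Omega R) (X : Omega -> R) : Prop :=
  exists m s : R, forall B : set R, measurable B ->
    pushforward P X B = gaussian_law m s B.

Definition gaussian_family d (Omega : measurableType d) (R : realType)
    (P : probability Omega R) (I : Type) (D : set I) (X : I -> {RV P >-> R}) :
    Prop :=
  forall (n : nat) (i : 'I_n -> I) (c : 'I_n -> R), (forall k, D (i k)) ->
    gaussian_rv P (fun w => \sum_(k < n) c k * X (i k) w).

(* A point (s, y) of R * R has time coordinate s and space coordinate y. *)

Definition bounded_borel (R : realType) : set (set (R * R)) :=
  [set A : set (R * R) | measurable A /\ bounded_set A].

Definition half_plane (R : realType) : set (R * R) := [set p | 0 <= p.1].

Definition noise_index (R : realType) : set (set (R * R)) :=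
  [set A | bounded_borel A /\ A `<=` @half_plane R].

(* The library sets 0 `^ (- beta) = 0, which only affects the null diagonal
   y = y'. *)
Definition noise_cov (R : realType) (beta : R) (A B : set (R * R)) : \bar R :=
  (\int[@lebesgue_measure R]_(s in `[0%R, +oo[)
    \int[@lebesgue_measure R]_y \int[@lebesgue_measure R]_y'
      (\1_A (s, y) * `|y - y'| `^ (- beta) * \1_B (s, y'))%:E)%E.

(* W A is only meaningful when A is a bounded Borel subset of the half-plane. *)
Definition colored_noise d (Omega : measurableType d) (R : realType)
    (P : probability Omega R) (beta : R) (W : set (R * R) -> {RV P >-> R}) :
    Prop :=
  [/\ gaussian_family (@noise_index R) W,
      forall A, noise_index A -> ('E_P[W A] = 0)%E
    & forall A B, noise_index A -> noise_index B ->
        ('E_P[(W A \* W B)%R] = noise_cov beta A B)%E].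

Definition light_cone (R : realType) (t x : R) : set (R * R) :=
  [set p | 0 <= p.1 <= t /\ `|x - p.2| <= t - p.1].

(* u is a version of the mild solution (1/2) W(light_cone t x) of the wave
   equation, with almost surely continuous paths on the half-plane. *)
Definition continuous_solution d (Omega : measurableType d) (R : realType)
    (P : probability Omega R) (W : set (R * R) -> {RV P >-> R})
    (u : R -> R -> {RV P >-> R}) : Prop :=
  (forall t x, 0 <= t ->
    {ae P, forall w, u t x w = 2^-1 * W (light_cone t x) w}) /\
  {ae P, forall w, {within @half_plane R, continuous (fun p => u p.1 p.2 w)}}.

Definition rotate (T : Type) (R : realType) (u : R -> R -> T) (tau lam : R) : T :=
  u ((tau + lam) / Num.sqrt 2) ((- tau + lam) / Num.sqrt 2).

Definition strip (R : realType) (tau0 : R) : set (R * R) :=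
  [set p | 0 <= p.1 < tau0 / Num.sqrt 2].

Definition past_events d (Omega : measurableType d) (R : realType)
    (P : probability Omega R) (W : set (R * R) -> {RV P >-> R}) (tau0 : R) :
    set (set Omega) :=
  [set E | exists B C, [/\ bounded_borel B, measurable C
                         & E = W (B `&` strip tau0) @^-1` C]]
  `|` P.-negligible.

Definition past_measurable d (Omega : measurableType d) (R : realType)
    (P : probability Omega R) (W : set (R * R) -> {RV P >-> R}) (tau0 : R)
    (Lambda : Omega -> R) : Prop :=
  measurable_fun [set: g_sigma_algebraType (past_events W tau0)]
    (Lambda : g_sigma_algebraType (past_events W tau0) -> R).

Definition lil_limsup (R : realType) (beta : R) (f : R -> R) (x : R) : \bar R :=
  limf_esup (fun h =>
    (`|f (x + h) - f x| / Num.sqrt (h `^ (2 - beta) * ln (ln (1 / h))))%:E) 0^'+.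

(* Main.v *)
Require Import Defs.
From mathcomp Require Import all_boot all_order all_algebra.
From mathcomp Require Import all_classical all_reals all_analysis.
From mathcomp Require Import measurable_realfun ring lra.
Import Order.TTheory GRing.Theory Num.Theory numFieldNormedType.Exports.
Import HBNNSimple.

(* In characteristic coordinates [q = s - y], [p = s + y], an increment of
   [rotate u tau] in [lam] is half the noise of a band in [p] cut at
   [q <= r2 * tau]. The difference of the increments at [tau] and at [tau0] is
   the noise of a box that lies above the strip, hence is independent of the past;
   at a point chosen from the past it therefore obeys the law of the iterated
   logarithm of a deterministic point (chaining over dyadic windows and
   Borel-Cantelli), and it cannot create or destroy a singularity: this is (ii).
   For (i), the part of the band inside the strip, at many well separated points,
   is a nearly uncorrelated Gaussian family, so by a second moment argument one of
   its members exceeds any multiple of the gauge with high probability. Choosing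
   such a member at each of a sequence of rapidly decreasing scales yields nested
   intervals, whose common point is the singularity; the part of the band above the
   strip is harmless by independence. *)

Set Implicit Arguments.
Unset Strict Implicit.
Unset Printing Implicit Defensive.

Local Open Scope classical_set_scope.
Local Open Scope ring_scope.

(** * Gaussian variables *)

(** Every estimate has to survive a random choice of the point. A choice made from the past is
    encoded by an index in [nat]: independence then gives the selected set the tail bound of a fixed
    one. Where the choice depends on the very noise being estimated, a union over all its possible
    values is taken instead, and the scale is refined until the union is affordable. Gaussian laws
    enter only through exponential moments and expectations of cosines. Uncorrelated combinations
    are proved independent by factorizing cosines, then trigonometric polynomials, then indicators
    of half-spaces, and finally by a pi-system argument. In (ii) one null set must serve all [tau],
    so the chaining runs over [tau] and over the increment together. In (i) increments of length
    [4 ^- m] are examined on a grid of step [2 ^- m]: with the step the square root of the length,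
    correlations decay exponentially in [m], while a threshold at the gauge costs only a power of
    [m]. What remains is to pass from a grid point to the limit point, and this dictates how short
    the next interval must be. *)

Section density.
Context d (T : measurableType d) (R : realType).
Variables (mu nu : {measure set T -> \bar R}) (p : T -> R).
Hypotheses (mp : measurable_fun setT p) (p0 : forall x, 0 <= p x).
Hypothesis nuE : forall B, measurable B -> nu B = (\int[mu]_(x in B) (p x)%:E)%E.

Let ge0_integral_density_nnsfun (h : {nnsfun T >-> R}) :
  (\int[nu]_x (h x)%:E = \int[mu]_x (h x * p x)%:E)%E.
Proof.
under eq_integral do rewrite fimfunE -fsumEFin//.
rewrite ge0_integral_fsum//; last 2 first.
  - by move=> r; exact/measurable_EFinP/measurableT_comp.
  - by move=> n x _; rewrite EFinM nnfun_muleindic_ge0.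
under [RHS]eq_integral.
  move=> x _.
  rewrite EFinM fimfunE -fsumEFin// ge0_mule_fsuml; last first.
    by move=> r; rewrite EFinM nnfun_muleindic_ge0.
  over.
rewrite [RHS]ge0_integral_fsum//; last 2 first.
  - move=> r; apply: emeasurable_funM; last exact/measurable_EFinP.
    exact/measurable_EFinP/measurableT_comp.
  - move=> n x _; apply: mule_ge0; last by rewrite lee_fin.
    by rewrite EFinM nnfun_muleindic_ge0.
apply: eq_fsbigr => r rh.
rewrite integralZl_indic_nnsfun//= integral_indic// setIT.
have r0 : 0 <= r by move: rh; rewrite inE => -[x _ <-].
under [RHS]eq_integral do rewrite EFinM -muleA.
have mB : measurable (h @^-1` [set r]) by exact: measurable_funPTI.
rewrite ge0_integralZl//; last 2 first.
  - by apply: emeasurable_funM; exact/measurable_EFinP.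
  - by move=> x _; rewrite mule_ge0 ?lee_fin.
congr (_ * _)%E; rewrite nuE//.
rewrite integral_mkcond; apply: eq_integral => x _.
by rewrite patchE indicE; case: ifPn => _; rewrite ?mul1e ?mul0e.
Qed.

Lemma ge0_integral_density (f : T -> \bar R) : measurable_fun setT f ->
  (forall x, 0 <= f x)%E -> (\int[nu]_x f x = \int[mu]_x (f x * (p x)%:E))%E.
Proof.
move=> mf f0; pose h := nnsfun_approx measurableT mf.
transitivity (limn (fun n => \int[nu]_x (h n x)%:E)%E).
  rewrite -monotone_convergence//=.
  - apply: eq_integral => ? /[!inE] xD; apply/esym/cvg_lim => //=.
    exact: cvg_nnsfun_approx.
  - by move=> n; exact/measurable_EFinP/measurable_funTS.
  - by move=> n ? _; rewrite lee_fin.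
  - by move=> ? _ ? ? mn; rewrite lee_fin; exact/lefP/nd_nnsfun_approx.
transitivity (limn (fun n => \int[mu]_x ((h n x)%:E * (p x)%:E))%E).
  by apply: congr_lim; apply/funext => n; rewrite ge0_integral_density_nnsfun.
rewrite -monotone_convergence//=.
- apply: eq_integral => x _; apply/cvg_lim => //=.
  by apply: cvgeZr => //; exact: cvg_nnsfun_approx.
- by move=> n; apply: emeasurable_funM; exact/measurable_EFinP.
- by move=> n x _; rewrite mule_ge0 ?lee_fin.
- by move=> x _ a b ab; rewrite lee_wpmul2r ?lee_fin//; exact/lefP/nd_nnsfun_approx.
Qed.

Lemma integrable_density (f : T -> R) : measurable_fun setT f ->
  nu.-integrable setT (EFin \o f) <->
  mu.-integrable setT (fun x => (f x * p x)%:E).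
Proof.
move=> mf.
have h : (\int[nu]_x `|(f x)%:E| = \int[mu]_x `|(f x * p x)%:E|)%E.
  rewrite ge0_integral_density//; last first.
    by apply: measurableT_comp => //; exact/measurable_EFinP.
  by apply: eq_integral => x _ /=; rewrite normrM (ger0_norm (p0 x)) EFinM.
split=> /integrableP[_ ifin]; apply/integrableP; split.
- by apply/measurable_EFinP; exact: measurable_funM.
- by rewrite -h.
- exact/measurable_EFinP.
- by rewrite /= h.
Qed.

Lemma Rintegral_density (f : T -> R) : measurable_fun setT f ->
  mu.-integrable setT (fun x => (f x * p x)%:E) ->
  \int[nu]_x f x = \int[mu]_x (f x * p x).
Proof.
move=> mf ifp; congr fine.
rewrite integralE [RHS]integralE; congr (_ - _)%E.
- rewrite ge0_integral_density//; last first.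
    by apply: measurable_funepos; exact/measurable_EFinP.
  apply: eq_integral => x _; by rewrite !funeposE /= muleC maxe_pMr ?lee_fin// mule0 EFinM muleC.
- rewrite ge0_integral_density//; last first.
    by apply: measurable_funeneg; exact/measurable_EFinP.
  apply: eq_integral => x _; by rewrite !funenegE /= muleC maxe_pMr ?lee_fin// mule0 -EFinM mulrN mulrC.
Qed.

End density.

Lemma is_derive_expR_sqr (R : realType) (k m c x : R) :
  is_derive x (1:R) (fun x : R => k * expR ((x - m) ^+ 2 * c))
    ((2 * (x - m) * c) * (k * expR ((x - m) ^+ 2 * c))).
Proof.
have h1 : is_derive x (1:R) (fun x : R => x - m) 1.
  have := @is_deriveB _ _ _ id (cst m) x 1 1 0 _ _; rewrite subr0; apply.
have h2 : is_derive x (1:R) (fun x : R => (x - m) ^+ 2 * c) (2 * (x - m) * c).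
  apply: (is_derive_eq (is_deriveM (is_deriveX 2 h1) (is_derive_cst c x (1:R)))).
  by rewrite scaler0 add0r /GRing.scale /= !mulr1 mulrC expr1.
have h3 := @is_derive1_comp R expR (fun x => (x - m) ^+ 2 * c) x _ _ (is_derive_expR _) h2.
apply: (is_derive_eq (is_deriveM (is_derive_cst k x (1:R)) h3)).
by rewrite scaler0 addr0 /GRing.scale /=; ring.
Qed.

Lemma integrable_mulrl d (T : measurableType d) (R : realType)
    (mu : {measure set T -> \bar R}) (D : set T) (k : R) (f : T -> R) :
  measurable D -> mu.-integrable D (EFin \o f) ->
  mu.-integrable D (EFin \o (fun x => k * f x)).
Proof.
move=> mD fi; rewrite (_ : _ \o _ = (fun x => k%:E * (f x)%:E)%E); last first.
  by apply/funext => x /=; rewrite EFinM.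
exact: integrableZl.
Qed.

Lemma integrable_addr d (T : measurableType d) (R : realType)
    (mu : {measure set T -> \bar R}) (D : set T) (f g : T -> R) :
  measurable D -> mu.-integrable D (EFin \o f) -> mu.-integrable D (EFin \o g) ->
  mu.-integrable D (EFin \o (fun x => f x + g x)).
Proof.
move=> mD fi gi; rewrite (_ : _ \o _ = ((EFin \o f) \+ (EFin \o g))%E).
  exact: integrableD.
by apply/funext => x /=; rewrite EFinD.
Qed.

Lemma integrable_subr d (T : measurableType d) (R : realType)
    (mu : {measure set T -> \bar R}) (D : set T) (f g : T -> R) :
  measurable D -> mu.-integrable D (EFin \o f) -> mu.-integrable D (EFin \o g) ->
  mu.-integrable D (EFin \o (fun x => f x - g x)).
Proof.
move=> mD fi gi; rewrite (_ : _ \o _ = ((EFin \o f) \- (EFin \o g))%E).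
  exact: integrableB.
by apply/funext => x /=; rewrite EFinB.
Qed.

(** The fundamental theorem is applied on growing symmetric intervals: the bound [K / n.+1%:R] kills
    the boundary terms, and dominated convergence handles the integral. *)
Lemma integral_derive_eq0 (R : realType) (F h : R -> R) (m K : R) :
  (forall x, is_derive x (1 : R) F (h x)) -> continuous h ->
  (@lebesgue_measure R).-integrable setT (EFin \o h) ->
  (forall n : nat, `|F (m + n.+1%:R) - F (m - n.+1%:R)| <= K / n.+1%:R) ->
  \int[lebesgue_measure]_x h x = 0.
Proof.
move=> Fh ch ih FK.
pose I (n : nat) : set R := `[m - n.+1%:R, m + n.+1%:R]%classic.
have lt n : m - n.+1%:R < m + n.+1%:R.
  by rewrite ltrD2l (@lt_trans _ _ 0)// ?oppr_lt0 ltr0n.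
have dF x : derivable F x 1 by have [] := Fh x.
have cF x : {for x, continuous F} by exact/differentiable_continuous/derivable1_diffP/dF.
have FTC n : (\int[lebesgue_measure]_(x in I n) (h x)%:E =
    (F (m + n.+1%:R))%:E - (F (m - n.+1%:R))%:E)%E.
  apply: continuous_FTC2 => //.
  - exact: continuous_subspaceT.
  - split => //.
    + by apply: cvg_at_right_filter; exact: cF.
    + by apply: cvg_at_left_filter; exact: cF.
  - by move=> x _; rewrite derive1E; have [] := Fh x.
have cv : (\int[lebesgue_measure]_(x in I n) (h x)%:E @[n --> \oo] -->
           \int[lebesgue_measure]_x (h x)%:E)%E.
  have -> : (fun n => \int[lebesgue_measure]_(x in I n) (h x)%:E)%E =
      (fun n => \int[lebesgue_measure]_x ((EFin \o h) \_ (I n)) x)%E.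
    by apply/funext => n; rewrite integral_mkcond.
  apply: (@dominated_cvg _ _ _ (@lebesgue_measure R) setT measurableT (fun n => (EFin \o h) \_ (I n)) (EFin \o h) (abse \o (EFin \o h))) => //.
  - move=> n; apply: (iffLR (measurable_restrictT (EFin \o h) _)).
      exact: measurable_itv.
    by apply: measurable_funTS; exact: (measurable_int lebesgue_measure).
  - move=> x _; apply: cvg_near_cst.
    have [n xn] : exists n : nat, `|x - m| < n%:R.
      by exists (Num.bound `|x - m|); exact: archi_boundP.
    exists n => // k /= nk; rewrite patchE ifT// inE /I/= in_itv/=.
    have : `|x - m| <= k.+1%:R.
      by rewrite (le_trans (ltW xn))// ler_nat (leq_trans nk).
    by rewrite ler_norml => /andP[? ?]; apply/andP; split; lra.
  - exact: integrable_abse.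
  - move=> n x _; rewrite patchE; case: ifPn => // _.
    by rewrite (_ : point = 0%E)// abse0; exact: abse_ge0.
have cv0 : ((F (m + n.+1%:R))%:E - (F (m - n.+1%:R))%:E @[n --> \oo] --> 0%:E)%E.
  apply: cvg_EFin; first exact: nearW.
  apply/norm_cvg0P.
  apply: (@squeeze_cvgr _ _ _ _ (cst 0) (fun n : nat => K / n.+1%:R)).
  - by apply: nearW => n; rewrite /= normr_ge0 FK.
  - exact: cvg_cst.
  - rewrite -(mulr0 K); apply: cvgMr; exact: cvg_harmonic.
rewrite /Rintegral.
have -> : (\int[lebesgue_measure]_x (h x)%:E)%E = 0%:E.
  apply: (cvg_unique _ cv) => //.
  have -> : (fun n => \int[lebesgue_measure]_(x in I n) (h x)%:E)%E =
      (fun n => (F (m + n.+1%:R))%:E - (F (m - n.+1%:R))%:E)%E by exact/funext.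
  exact: cv0.
by [].
Qed.

Section normal_moments.
Context (R : realType) (m s : R).
Hypothesis s0 : s != 0.
Notation mu := (@lebesgue_measure R).
Notation N := (normal_prob m s).

Let normal_probE (B : set R) : measurable B ->
  N B = (\int[mu]_(x in B) (normal_pdf m s x)%:E)%E.
Proof. by []. Qed.

(** Completing the square: an exponential tilt moves the mean by [t * s ^+ 2], so exponential
    moments reduce to the total mass of another normal density. *)
Lemma normal_pdf_expR t x : expR (t * x) * normal_pdf m s x =
  expR (t * m + t ^+ 2 * s ^+ 2 / 2) * normal_pdf (m + t * s ^+ 2) s x.
Proof.
rewrite !normal_pdfE// /normal_fun !mulrA ![expR _ * normal_peak s]mulrC -!mulrA.
congr (_ * _); rewrite -!expRD; congr expR.
rewrite -mulr_natr; field; exact: s0.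
Qed.

Lemma integral_normal_prob_expR t :
  (\int[N]_x (expR (t * x))%:E = (expR (t * m + t ^+ 2 * s ^+ 2 / 2))%:E)%E.
Proof.
rewrite (@ge0_integral_density _ _ _ mu N _ (measurable_normal_pdf m s) _ normal_probE)//.
- under eq_integral do rewrite -EFinM normal_pdf_expR EFinM.
  rewrite integralZl//; first by rewrite integral_normal_pdf mule1.
  exact: integrable_normal_pdf.
- exact: normal_pdf_ge0.
- apply/measurable_EFinP; apply: measurableT_comp => //.
Qed.

Lemma integrable_normal_prob (f : R -> R) C : measurable_fun setT f ->
  (forall x, `|f x| <= C * expR `|x|) -> N.-integrable setT (EFin \o f).
Proof.
move=> mf fC.
have iexp t : N.-integrable setT (fun x => (expR (t * x))%:E).
  apply/integrableP; split.
    apply/measurable_EFinP; apply: measurableT_comp => //.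
  under eq_integral do rewrite /= ger0_norm ?expR_ge0//.
  by rewrite integral_normal_prob_expR ltry.
have iC : N.-integrable setT
    (fun x => `|C|%:E * ((expR (1 * x))%:E + (expR (- 1 * x))%:E))%E.
  by apply: integrableZl => //; apply: integrableD.
apply: le_integrable iC => //; first exact/measurable_EFinP.
move=> x _ /=; rewrite lee_fin mul1r mulN1r.
apply: (le_trans (fC x)); rewrite normrM normr_id.
apply: (@le_trans _ _ (`|C| * expR `|x|)).
  by rewrite ler_wpM2r ?expR_ge0// ler_norm.
rewrite ler_wpM2l// ger0_norm ?addr_ge0 ?expR_ge0//.
case: (leP 0 x) => x0.
  by rewrite ger0_norm// lerDl expR_ge0.
by rewrite ltr0_norm// lerDr expR_ge0.
Qed.

Lemma is_derive_normal_pdf (x : R) : is_derive x (1 : R) (normal_pdf m s)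
  (- (x - m) / s ^+ 2 * normal_pdf m s x).
Proof.
have -> : normal_pdf m s = fun x : R =>
    normal_peak s * expR ((x - m) ^+ 2 * - (s ^+ 2 *+ 2)^-1).
  by apply/funext => y; rewrite normal_pdfE// /normal_fun mulNr mulrN.
apply: (is_derive_eq (is_derive_expR_sqr (normal_peak s) m (- (s ^+ 2 *+ 2)^-1) x)).
congr (_ * _); rewrite -mulr_natr; field; exact: s0.
Qed.

(** Quadratic decay, read off from [expR_ge1Dx], is enough for Stein's identity, where the density
    multiplies a function of linear growth. *)
Lemma normal_pdf_le (x : R) : x != m ->
  normal_pdf m s x <= normal_peak s * (s ^+ 2 *+ 2) / (x - m) ^+ 2.
Proof.
move=> xm; rewrite normal_pdfE// -mulrA ler_wpM2l ?normal_peak_ge0//.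
rewrite /normal_fun mulNr expRN -[leRHS]invf_div.
have y0 : 0 < (x - m) ^+ 2 / (s ^+ 2 *+ 2).
  by rewrite divr_gt0 ?mulrn_wgt0// exprn_even_gt0//= subr_eq0.
rewrite lef_pV2 ?posrE ?expR_gt0//.
by rewrite (le_trans _ (expR_ge1Dx _))// lerDr.
Qed.

Let expR_ge_sqr (r : R) : 0 <= r -> (1 + r) ^+ 2 <= 4 * expR r.
Proof.
move=> r0.
have h : 1 + r / 2 <= expR (r / 2) by exact: expR_ge1Dx.
have -> : expR r = expR (r / 2) ^+ 2.
  by rewrite -expRM_natl; congr expR; field.
have : (1 + r / 2) ^+ 2 <= expR (r / 2) ^+ 2.
  by rewrite ler_pXn2r// ?nnegrE ?expR_ge0// addr_ge0// divr_ge0.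
by nra.
Qed.

Lemma integrable_normal_prob_sqr (f : R -> R) C : measurable_fun setT f ->
  (forall x, `|f x| <= C * (1 + `|x - m|) ^+ 2) -> N.-integrable setT (EFin \o f).
Proof.
move=> mf fC; apply: (@integrable_normal_prob _ (`|C| * (4 * expR `|m|))) => // x.
apply: (le_trans (fC x)).
apply: (@le_trans _ _ (`|C| * (1 + `|x - m|) ^+ 2)).
  by rewrite ler_wpM2r ?sqr_ge0// ler_norm.
rewrite -mulrA ler_wpM2l//.
apply: (le_trans (expR_ge_sqr (normr_ge0 _))).
rewrite -mulrA ler_wpM2l// -expRD ler_expR.
by rewrite addrC -[in leRHS](normrN m) ler_normD.
Qed.

(** Integration by parts against the density. Mean, variance and cosine transform are all obtained
    from this identity. *)
Lemma stein (f f' : R -> R) C : (forall x : R, is_derive x (1 : R) f (f' x)) ->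
  continuous f' -> (forall x, `|f x| <= C * (1 + `|x - m|)) ->
  (forall x, `|f' x| <= C) ->
  \int[N]_x ((x - m) * f x) = s ^+ 2 * \int[N]_x f' x.
Proof.
move=> ff' cf' fC f'C.
have C0 : 0 <= C by apply: le_trans (f'C 0).
have cf : continuous f.
  move=> x; apply/differentiable_continuous/derivable1_diffP.
  by have [] := ff' x.
have mf : measurable_fun setT f by exact: continuous_measurable_fun.
have mf' : measurable_fun setT f' by exact: continuous_measurable_fun.
have mxm : measurable_fun setT (fun x : R => x - m) by exact: measurable_funB.
have s20 : s ^+ 2 != 0 by rewrite expf_neq0.
have i1 : N.-integrable setT (EFin \o f').
  apply: (@integrable_normal_prob_sqr _ C) => // x; apply: (le_trans (f'C x)).
  by rewrite ler_peMr// expr_ge1// lerDl.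
have i2 : N.-integrable setT (EFin \o (fun x => (x - m) * f x)).
  apply: (@integrable_normal_prob_sqr _ C) => //; first exact: measurable_funM.
  move=> x; rewrite normrM.
  apply: (@le_trans _ _ (`|x - m| * (C * (1 + `|x - m|)))).
    by rewrite ler_wpM2l.
  rewrite mulrCA ler_wpM2l// expr2 ler_wpM2r ?addr_ge0// lerDr//.
(* [g] times the density is the derivative of [f] times the density, so its integral vanishes. *)
pose g x := f' x - s ^- 2 * ((x - m) * f x).
have mg : measurable_fun setT g.
  by apply: measurable_funB => //; apply: measurable_funM => //; exact: measurable_funM.
have i3 : N.-integrable setT (EFin \o (fun x => s ^- 2 * ((x - m) * f x))).
  exact: integrable_mulrl.
have ig : N.-integrable setT (EFin \o g) by exact: integrable_subr.
have igp : mu.-integrable setT (fun x => (g x * normal_pdf m s x)%:E).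
  apply: (iffLR (@integrable_density _ _ _ mu N _ (measurable_normal_pdf m s) _ normal_probE _ mg)) => //.
  exact: normal_pdf_ge0.
have g0 : \int[N]_x g x = 0.
  rewrite (@Rintegral_density _ _ _ mu N _ (measurable_normal_pdf m s) _ normal_probE)//.
    apply: (@integral_derive_eq0 _ (fun x => f x * normal_pdf m s x) _ m
      (8 * C * normal_peak s * s ^+ 2)) => //.
    - move=> x; apply: is_derive_eq.
        exact: is_deriveM (ff' x) (is_derive_normal_pdf x).
      by rewrite /GRing.scale /= /g; ring.
    - move=> x; apply: cvgM; last exact: continuous_normal_pdf.
      apply: cvgB; first exact: cf'.
      apply: cvgM; first exact: cvg_cst.
      apply: cvgM; last exact: cf.
      by apply: cvgB; [exact: cvg_id|exact: cvg_cst].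
    - move=> n.
      have n0 : 0 < n.+1%:R :> R by rewrite ltr0n.
      have n1 : 1 <= n.+1%:R :> R by rewrite ler1n.
      have b x : `|x - m| = n.+1%:R ->
          `|f x * normal_pdf m s x| <= 4 * C * normal_peak s * s ^+ 2 / n.+1%:R.
        move=> xn; rewrite normrM (ger0_norm (normal_pdf_ge0 _ _ _)).
        have xm : x != m by rewrite -subr_eq0 -normr_eq0 xn gt_eqF.
        have := normal_pdf_le xm; rewrite -[X in _ / X]real_normK ?num_real// xn => h1.
        have h2 := fC x; rewrite xn in h2.
        apply: (le_trans (ler_pM _ _ h2 h1)) => //; first exact: normal_pdf_ge0.
        have -> : 4 * C * normal_peak s * s ^+ 2 / n.+1%:R =
            (C * (n.+1%:R + n.+1%:R)) * (normal_peak s * (s ^+ 2 *+ 2) / n.+1%:R ^+ 2).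
          by rewrite -(mulr_natr (s ^+ 2)); field; rewrite gt_eqF.
        apply: ler_wpM2r.
          by rewrite divr_ge0 ?sqr_ge0// mulr_ge0 ?normal_peak_ge0// mulrn_wge0// sqr_ge0.
        by rewrite ler_wpM2l// lerD2r.
      apply: (le_trans (ler_normB _ _)).
      have -> : 8 * C * normal_peak s * s ^+ 2 / n.+1%:R =
          4 * C * normal_peak s * s ^+ 2 / n.+1%:R + 4 * C * normal_peak s * s ^+ 2 / n.+1%:R.
        by field; rewrite gt_eqF.
      by apply: lerD; apply: b; rewrite addrC addKr ?normrN ger0_norm// ltW.
  exact: normal_pdf_ge0.
move: g0; rewrite /g RintegralB// RintegralZl// => /eqP; rewrite subr_eq0 => /eqP ->.
by rewrite mulrA mulfV// mul1r.
Qed.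

Lemma normal_mean : \int[N]_x (x - m) = 0.
Proof.
have := @stein (cst 1) (cst 0) 1.
under eq_Rintegral do rewrite /cst mulr1.
move=> ->; rewrite ?Rintegral_cst// ?mul0r ?mulr0//.
- exact: cst_continuous.
- by move=> x; rewrite normr1 mul1r lerDl.
- by move=> x; rewrite normr0.
Qed.

Lemma fine_normal_prob_setT : fine (N setT) = 1.
Proof. by rewrite probability_setT. Qed.

Lemma normal_variance : \int[N]_x ((x - m) ^+ 2) = s ^+ 2.
Proof.
have : \int[N]_x ((x - m) * (x - m)) = s ^+ 2 * \int[N]_x (cst 1 x).
  apply: (@stein (fun x => x - m) (cst 1) 1).
  - by move=> x; apply: is_derive_eq; rewrite subr0.
  - exact: cst_continuous.
  - by move=> x; rewrite mul1r lerDr.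
  - by move=> x; rewrite normr1.
under eq_Rintegral do rewrite -expr2.
move=> ->; rewrite Rintegral_cst// mul1r -[RHS]mulr1; congr (_ * _).
exact: fine_normal_prob_setT.
Qed.

(** As a function of [t] the integral solves a linear differential equation: differentiate under the
    integral, then apply Stein's identity to the sine. Multiplied by the inverse Gaussian factor it
    is constant, equal to its value at 0. The phase [c] does the work of complex exponentials. *)
Lemma normal_cos (t c : R) :
  \int[N]_x cos (t * (x - m) + c) = expR (- (t ^+ 2 * s ^+ 2 / 2)) * cos c.
Proof.
pose g (t : R) := \int[N]_x cos (t * (x - m) + c).
have mlin (a : R) : measurable_fun setT (fun x : R => a * (x - m) + c).
  by apply: measurable_funD => //; apply: measurable_funM => //; exact: measurable_funB.
have dlin (a b y : R) : is_derive y (1 : R) (fun y : R => a * (y - b) + c) a.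
  have h1 : is_derive y (1:R) (fun x : R => x - b) 1.
    have := @is_deriveB _ _ _ id (cst b) y 1 1 0 _ _; rewrite subr0; apply.
  apply: is_derive_eq.
  by rewrite /GRing.scale /= !mulr1 ?addr0 ?mulr0 ?addr0.
have dcos (a b y : R) : is_derive y (1 : R) (fun y : R => cos (a * (y - b) + c))
    (- sin (a * (y - b) + c) * a).
  exact: (@is_derive1_comp R cos (fun y => a * (y - b) + c) y _ _ (is_derive_cos _) (dlin a b y)).
have dsin (a b y : R) : is_derive y (1 : R) (fun y : R => sin (a * (y - b) + c))
    (cos (a * (y - b) + c) * a).
  exact: (@is_derive1_comp R sin (fun y => a * (y - b) + c) y _ _ (is_derive_sin _) (dlin a b y)).
have dcos' (x y : R) : is_derive y (1 : R) (fun y : R => cos (y * (x - m) + c))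
    (- sin (y * (x - m) + c) * (x - m)).
  have -> : (fun y : R => cos (y * (x - m) + c)) = (fun y : R => cos ((x - m) * (y - 0) + c)).
    by apply/funext => z; rewrite subr0 mulrC.
  by apply: (is_derive_eq (dcos _ _ _)); rewrite subr0 (mulrC _ y).
have mcos (a : R) : measurable_fun setT (fun x : R => cos (a * (x - m) + c)).
  by apply: measurableT_comp => //; exact: continuous_measurable_fun (@continuous_cos R).
have msin (a : R) : measurable_fun setT (fun x : R => sin (a * (x - m) + c)).
  by apply: measurableT_comp => //; exact: continuous_measurable_fun (@continuous_sin R).
have icos (a : R) : N.-integrable setT (EFin \o (fun x : R => cos (a * (x - m) + c))).
  apply: (@integrable_normal_prob_sqr _ 1) => // x.
  by rewrite mul1r (le_trans (cos_max _))// expr_ge1// lerDl.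
have st (a : R) : \int[N]_x ((x - m) * sin (a * (x - m) + c)) = s ^+ 2 * (a * g a).
  rewrite (@stein _ (fun x => cos (a * (x - m) + c) * a) (1 + `|a|)).
  - by under eq_Rintegral do rewrite mulrC; rewrite RintegralZl.
  - move=> x; apply: cvgM; last exact: cvg_cst.
    apply/differentiable_continuous/derivable1_diffP.
    by have [] := dcos a m x.
  - move=> x; rewrite (le_trans (sin_max _))//.
    by rewrite -[leLHS]mul1r ler_pM// lerDl.
  - by move=> x; rewrite normrM (@le_trans _ _ (1 * `|a|))// ?ler_wpM2r ?cos_max// mul1r lerDr.
have dg (a : R) : is_derive a (1 : R) g (- (s ^+ 2 * (a * g a))).
  pose f (y x : R) := cos (y * (x - m) + c).
  pose G (x : R) := `|x - m|.
  have iG : N.-integrable setT (EFin \o G).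
    apply: (@integrable_normal_prob_sqr _ 1).
      by apply: measurableT_comp => //; exact: measurable_funB.
    move=> x; rewrite normr_id mul1r expr2.
    rewrite (@le_trans _ _ (1 + `|x - m|))// ?lerDr// ler_peMr// ?lerDl//.
  have d1 (y x : R) : (partial1of2 f) y x = - sin (y * (x - m) + c) * (x - m).
    by rewrite partial1of2E; have [_ ] := dcos' x y.
  have ub (x y : R) : `]a - 1, a + 1[%classic x -> setT y -> `|(partial1of2 f) x y| <= G y.
    by move=> _ _; rewrite d1 normrM normrN ler_piMl// sin_max.
  have Ia : `]a - 1, a + 1[%classic a by rewrite /= in_itv/= ltrBlDr ltrDl ltr01.
  have der (x y : R) : `]a - 1, a + 1[%classic x -> setT y -> derivable (f ^~ y) x 1.
    by move=> _ _; have [] := dcos' y x.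
  have h := @differentiation_under_integral _ _ _ N f setT measurableT a (a - 1) (a + 1) Ia
    (fun x _ => icos x) der G (fun y => normr_ge0 _) iG ub.
  have h' := @derivable_under_integral _ _ _ N f setT measurableT a (a - 1) (a + 1) Ia
    (fun x _ => icos x) der G (fun y => normr_ge0 _) iG ub.
  apply: DeriveDef => //; rewrite -derive1E h -st.
  under eq_Rintegral do rewrite d1 mulNr mulrC -mulN1r.
  rewrite RintegralZl ?mulN1r//.
  apply: (@integrable_normal_prob_sqr _ 1).
    by apply: measurable_funM => //; exact: measurable_funB.
  move=> x; rewrite normrM mul1r expr2 ler_pM ?lerDr//.
  by rewrite (le_trans (sin_max _))// lerDl.
pose k (a : R) := g a * expR ((a - 0) ^+ 2 * (s ^+ 2 / 2)).
have dk (a : R) : is_derive a (1 : R) k 0.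
  have h := @is_derive_expR_sqr R 1 0 (s ^+ 2 / 2) a.
  have -> : k = (fun a => g a * (1 * expR ((a - 0) ^+ 2 * (s ^+ 2 / 2)))).
    by apply/funext => b; rewrite mul1r.
  apply: (is_derive_eq (is_deriveM (dg a) h)).
  by rewrite /GRing.scale /=; field.
have := is_derive_0_is_cst t 0 dk.
rewrite /k !subr0 expr0n/= mul0r expR0 mulr1.
have -> : g 0 = cos c.
  rewrite /g; under eq_Rintegral do rewrite mul0r add0r.
  rewrite Rintegral_cst// -[RHS]mulr1; congr (_ * _).
  exact: fine_normal_prob_setT.
by move=> <-; rewrite mulrCA -expRD mulrA addNr expR0 mulr1.
Qed.

End normal_moments.

Section gaussian_rv_lemmas.
Context d (Omega : measurableType d) (R : realType) (P : probability Omega R).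
Variable X : Omega -> R.
Hypothesis mX : measurable_fun setT X.

(* [normal_prob] lives on the display of [measurableTypeR R], not on the default
   one of [R]; both have the same measurable sets. *)
Let TR := measurableTypeR R.

Section law.
Variable nu : {measure set TR -> \bar R}.
Hypothesis lawX : forall B : set R, measurable B -> pushforward P X B = nu B.
Variable f : R -> R.
Hypothesis mf : measurable_fun setT f.

Let X' : Omega -> TR := X.
Let mX' : measurable_fun setT X'. Proof. exact: mX. Qed.
Let f' : TR -> R := f.
Let mf' : measurable_fun setT f'. Proof. exact: mf. Qed.

Lemma integrable_law :
  P.-integrable setT (fun w => (f (X w))%:E) <-> nu.-integrable setT (EFin \o (f : TR -> R)).
Proof.
have h : (\int[P]_w `|(f (X w))%:E| = \int[nu]_x `|(f' x)%:E|)%E.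
  rewrite [RHS](eq_measure_integral (pushforward P X')); last first.
    by move=> A mA _; rewrite -lawX.
  rewrite ge0_integral_pushforward//.
  by apply: measurableT_comp => //; exact/measurable_EFinP.
split=> /integrableP[_ hi]; apply/integrableP; split.
- by apply/measurable_EFinP; exact: mf'.
- by rewrite /= -h.
- by apply/measurable_EFinP; exact: measurableT_comp.
- by rewrite h.
Qed.

Lemma Rintegral_law : nu.-integrable setT (EFin \o (f : TR -> R)) ->
  \int[P]_w f (X w) = \int[nu]_x f x.
Proof.
move=> fi; congr fine.
rewrite [RHS](eq_measure_integral (pushforward P X')); last first.
  by move=> A mA _; rewrite -lawX.
rewrite integral_pushforward//; first by apply/measurable_EFinP; exact: mf'.
exact/integrable_law.
Qed.

End law.

Let dir (a : R) : {measure set TR -> \bar R} := @dirac _ TR a R.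

Lemma integrable_dirac (a : R) (f : R -> R) : measurable_fun setT f ->
  (dir a).-integrable setT (EFin \o (f : TR -> R)).
Proof.
move=> mf; have mf' : measurable_fun setT (f : TR -> R) by exact: mf.
apply/integrableP; split; first exact/measurable_EFinP.
rewrite integral_dirac//= ?diracT ?mul1e ?ltry//.
by apply/measurable_EFinP; exact: measurableT_comp.
Qed.

Lemma Rintegral_dirac (a : R) (f : R -> R) : measurable_fun setT f ->
  \int[dir a]_x f x = f a.
Proof.
move=> mf; have mf' : measurable_fun setT (f : TR -> R) by exact: mf.
rewrite /Rintegral integral_dirac//= ?diracT ?mul1r//.
  by rewrite indicT mul1r.
exact/measurable_EFinP.
Qed.

Hypothesis gX : gaussian_rv P X.

Lemma gaussian_integrable (f : R -> R) C : measurable_fun setT f ->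
  (forall x, `|f x| <= C * expR `|x|) ->
  P.-integrable setT (fun w => (f (X w))%:E).
Proof.
move=> mf fC; have [m [s]] := gX; rewrite /gaussian_law.
have [s0|s0] := eqVneq s 0 => law.
  exact: (iffRL (@integrable_law (dir m) law f mf) (integrable_dirac _ mf)).
apply: (iffRL (@integrable_law (normal_prob m s) law f mf)).
exact: (@integrable_normal_prob _ _ _ s0 f C).
Qed.

Hypothesis X0 : \int[P]_w X w = 0.

Let mexp2 : measurable_fun setT (fun x : R => x ^+ 2).
Proof. exact: (@measurable_funX _ _ _ setT id 2 (@measurable_id _ _ _)). Qed.

(** The parameters of the law are only known to exist. A zero mean forces [m = 0], and [s ^+ 2] is
    then the variance; the degenerate law is computed apart. *)
Let centered : exists s, (forall B, measurable B ->
  pushforward P X B = gaussian_law 0 s B) /\ \int[P]_w (X w ^+ 2) = s ^+ 2.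
Proof.
have [m [s]] := gX; rewrite /gaussian_law.
have [s0|s0] := eqVneq s 0 => law.
  have m0 : m = 0.
    have /= := @Rintegral_law (dir m) law id (@measurable_id _ _ _)
      (integrable_dirac _ (@measurable_id _ _ _)).
    by rewrite X0 Rintegral_dirac.
  exists 0; split; first by rewrite eqxx -m0.
  have := @Rintegral_law (dir m) law (fun x => x ^+ 2).
  rewrite Rintegral_dirac// m0 => -> //; exact: integrable_dirac.
have i1 : (normal_prob m s).-integrable setT (EFin \o id).
  apply: (@integrable_normal_prob _ _ _ s0 _ 1) => // x.
  by rewrite mul1r (le_trans _ (expR_ge1Dx _))// lerDr.
have i2 : (normal_prob m s).-integrable setT (EFin \o (fun _ : R => m)).
  apply: (@integrable_normal_prob_sqr _ _ _ s0 _ `|m|) => // x.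
  by rewrite ler_peMr// expr_ge1// lerDl.
have m0 : m = 0.
  have e : \int[normal_prob m s]_x x = 0.
    by rewrite -X0; apply/esym; exact: (@Rintegral_law (normal_prob m s) law id (@measurable_id _ _ _) i1).
  have := normal_mean m s0; rewrite RintegralB// Rintegral_cst// e sub0r.
  move=> /eqP; rewrite oppr_eq0 mulf_eq0 => /orP[/eqP//|].
  by rewrite (_ : fine _ = 1) ?oner_eq0//; exact: fine_normal_prob_setT.
exists s; split; first by rewrite (negbTE s0) -m0.
rewrite -(normal_variance m s0) m0.
under [RHS]eq_Rintegral do rewrite subr0.
apply: (@Rintegral_law (normal_prob 0 s) _ (fun x => x ^+ 2)).
- by rewrite -m0.
- exact: mexp2.
- apply: (@integrable_normal_prob_sqr _ _ _ s0 _ 1) => //.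
  move=> x; rewrite mul1r subr0 normrX ler_pXn2r ?nnegrE ?addr_ge0// lerDr//.
Qed.

Lemma gaussian_expR t :
  \int[P]_w expR (t * X w) = expR (t ^+ 2 / 2 * \int[P]_w (X w ^+ 2)).
Proof.
have [s [+ ->]] := centered; rewrite /gaussian_law.
have mf : measurable_fun setT (fun x : R => expR (t * x)).
  by apply: measurableT_comp => //; exact: measurable_funM.
have [s0|s0] := eqVneq s 0 => law.
  rewrite (@Rintegral_law (dir 0) law (fun x => expR (t * x)))//.
    by rewrite Rintegral_dirac// mulr0 s0 expr0n/= mulr0.
  exact: integrable_dirac.
rewrite (@Rintegral_law (normal_prob 0 s) law (fun x => expR (t * x)))//.
  rewrite /Rintegral integral_normal_prob_expR//= mulr0 add0r.
  by congr expR; rewrite mulrAC.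
apply/integrableP; split; first exact/measurable_EFinP.
under eq_integral do rewrite /= ger0_norm ?expR_ge0//.
by rewrite integral_normal_prob_expR// ltry.
Qed.

Lemma gaussian_integrable_expR t : P.-integrable setT (fun w => (expR (t * X w))%:E).
Proof.
have [s [+ _]] := centered; rewrite /gaussian_law.
have mf : measurable_fun setT (fun x : R => expR (t * x)).
  by apply: measurableT_comp => //; exact: measurable_funM.
have [s0|s0] := eqVneq s 0 => law.
  exact: (iffRL (@integrable_law (dir 0) law _ mf) (integrable_dirac _ mf)).
apply: (iffRL (@integrable_law (normal_prob 0 s) law _ mf)).
apply/integrableP; split; first exact/measurable_EFinP.
under eq_integral do rewrite /= ger0_norm ?expR_ge0//.
by rewrite integral_normal_prob_expR// ltry.
Qed.

Lemma gaussian_cos c :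
  \int[P]_w cos (X w + c) = expR (- (\int[P]_w (X w ^+ 2) / 2)) * cos c.
Proof.
have [s [+ ->]] := centered; rewrite /gaussian_law.
have mf : measurable_fun setT (fun x : R => cos (x + c)).
  apply: measurableT_comp; first exact: continuous_measurable_fun (@continuous_cos R).
  exact: measurable_funD.
have [s0|s0] := eqVneq s 0 => law.
  rewrite (@Rintegral_law (dir 0) law (fun x => cos (x + c)))//.
    by rewrite Rintegral_dirac// add0r s0 expr0n/= mul0r oppr0 expR0 mul1r.
  exact: integrable_dirac.
rewrite (@Rintegral_law (normal_prob 0 s) law (fun x => cos (x + c)))//.
  have := normal_cos 0 s0 1 c; rewrite expr1n mul1r => <-.
  by apply: eq_Rintegral => x _; rewrite mul1r subr0.
apply: (@integrable_normal_prob_sqr _ _ _ s0 _ 1) => // x.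
by rewrite mul1r (le_trans (cos_max _))// expr_ge1// lerDl.
Qed.

(** Chernoff's bound at its optimal parameter [t = a / v]. *)
Let gaussian_tail_half (Y : {RV P >-> R}) t a v : 0 < t ->
  \int[P]_w expR (t * Y w) <= expR (t ^+ 2 / 2 * v) ->
  P.-integrable setT (fun w => (expR (t * Y w))%:E) -> t * v = a ->
  0 < v ->
  (P [set w | (a <= Y w)%R] <= (expR (- (a ^+ 2 / (v *+ 2))))%:E)%E.
Proof.
move=> t0 hY iY ta v0.
apply: (le_trans (chernoff Y a t0)).
rewrite /mmt_gen_fun expectation_def /=.
have -> : (fun w => (expR (Y w * t))%:E) = (fun w => (expR (t * Y w))%:E).
  by apply/funext => w; rewrite mulrC.
rewrite -(fineK (integrable_fin_num measurableT iY)) -EFinM lee_fin.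
apply: (@le_trans _ _ (expR (t ^+ 2 / 2 * v) * expR (- (t * a)))).
  by rewrite ler_wpM2r ?expR_ge0.
rewrite -expRD ler_expR -ta -(mulr_natr v) le_eqVlt; apply/orP; left; apply/eqP.
by field; rewrite gt_eqF.
Qed.

Lemma gaussian_tail v a : \int[P]_w (X w ^+ 2) <= v -> 0 < v -> 0 <= a ->
  (P [set w | (a <= `|X w|)%R] <= (2 * expR (- (a ^+ 2 / (v *+ 2))))%:E)%E.
Proof.
move=> Xv v0 a0.
have mNX : measurable_fun setT (fun w => - X w) by exact: measurableT_comp.
pose Y : {RV P >-> R} := mfun_Sub (mem_set mX).
pose Z : {RV P >-> R} := mfun_Sub (mem_set mNX).
have mS (V : {RV P >-> R}) : measurable [set w | (a <= V w)%R].
  have -> : [set w | (a <= V w)%R] = V @^-1` `[a, +oo[%classic.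
    by apply/seteqP; split => w /=; rewrite in_itv/= andbT.
  exact: measurable_funPTI.
have -> : [set w | (a <= `|X w|)%R] = [set w | (a <= Y w)%R] `|` [set w | (a <= Z w)%R].
  apply/seteqP; split => w /=; rewrite ler_normr.
    by move=> /orP[]; [left|right].
  by case=> ->; rewrite ?orbT.
(* For [a = 0] the Chernoff parameter would vanish, but the claimed bound is then 2. *)
move: a0; rewrite le_eqVlt => /predU1P[a0|a0].
  apply: (le_trans (probability_le1 P (measurableU _ _ (mS Y) (mS Z)))).
  by rewrite -a0 expr0n/= mul0r oppr0 expR0 mulr1 lee_fin ler1n.
pose t := a / v.
have t0 : 0 < t by rewrite divr_gt0.
have ta : t * v = a by rewrite divfK// gt_eqF.
have hexp (r : R) : r ^+ 2 = t ^+ 2 ->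
    \int[P]_w expR (r * X w) <= expR (t ^+ 2 / 2 * v).
  move=> rt; rewrite gaussian_expR rt ler_expR ler_wpM2l//.
  by rewrite divr_ge0// sqr_ge0.
have hY := gaussian_tail_half (Y := Y) t0 (hexp t erefl)
  (gaussian_integrable_expR t) ta v0.
have ZE : (fun w => expR (t * Z w)) = (fun w => expR (- t * X w)).
  by apply/funext => w; rewrite /= mulrN mulNr.
have hZ : (P [set w | (a <= Z w)%R] <= (expR (- (a ^+ 2 / (v *+ 2))))%:E)%E.
  apply: (gaussian_tail_half (Y := Z) t0 _ _ ta v0).
    by rewrite ZE; apply: hexp; rewrite sqrrN.
  have := gaussian_integrable_expR (- t); rewrite (_ : (fun w => _) = EFin \o (fun w => expR (t * Z w)))//.
  by rewrite ZE.
apply: (le_trans (measureU2 _ _ _)) => //.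
have -> : 2 * expR (- (a ^+ 2 / (v *+ 2))) = expR (- (a ^+ 2 / (v *+ 2))) + expR (- (a ^+ 2 / (v *+ 2))).
  by rewrite mulr2n mulrDl !mul1r.
by rewrite EFinD; apply: leeD.
Qed.

End gaussian_rv_lemmas.

(** * Independence of the noise on disjoint time slabs *)

Lemma mulr_cos (R : realType) (x y : R) :
  cos x * cos y = 2^-1 * cos (x + y) + 2^-1 * cos (x - y).
Proof. by rewrite cosB cosD; field. Qed.

Section noise.
Context (R : realType) (d : measure_display) (Omega : measurableType d)
  (P : probability Omega R) (beta : R) (W : set (R * R) -> {RV P >-> R}).
Hypothesis W_noise : colored_noise beta W.

Notation Ex f := (\int[P]_w f w).
Local Notation integrableP f := (P.-integrable setT (EFin \o f)).

Lemma gaussian_noise A : noise_index A -> gaussian_rv P (W A).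
Proof.
move=> nA; have [/(_ 1%N (fun=> A) (fun=> 1) (fun=> nA)) [m [s h]] _ _] := W_noise.
rewrite (_ : W A = (fun w => \sum_(k < 1) 1 * W A w) :> (Omega -> R)).
  by exists m, s.
by apply/funext => w; rewrite big_ord1 mul1r.
Qed.

Lemma mean_noise A : noise_index A -> \int[P]_w W A w = 0.
Proof.
by move=> nA; have [_ /(_ A nA) + _] := W_noise; rewrite unlock /Rintegral => ->.
Qed.

Lemma cov_noise A B : noise_index A -> noise_index B ->
  \int[P]_w (W A w * W B w) = fine (noise_cov beta A B).
Proof.
by move=> nA nB; have [_ _ /(_ A B nA nB)] := W_noise; rewrite unlock /Rintegral => ->.
Qed.

Let mW A : measurable_fun setT (W A).
Proof. exact: measurable_funPT. Qed.

(** An inductive span of the noise: sets are added one at a time, so closure properties and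
    covariances are obtained by induction. The class [D] serves to separate past from future. *)
Inductive linear_comb (D : set (set (R * R))) : (Omega -> R) -> Prop :=
| linear_comb0 : linear_comb D (fun=> 0)
| linear_combS c A f : D A -> linear_comb D f ->
    linear_comb D (fun w => c * W A w + f w).

Lemma linear_combD D f g : linear_comb D f -> linear_comb D g ->
  linear_comb D (fun w => f w + g w).
Proof.
move=> Df Dg; elim: Df => [|c A h DA Dh ih].
  by under eq_fun do rewrite add0r.
by under eq_fun do rewrite -addrA; exact: linear_combS.
Qed.

Lemma linear_combZ D k f : linear_comb D f -> linear_comb D (fun w => k * f w).
Proof.
elim=> [|c A h DA Dh ih]; first by under eq_fun do rewrite mulr0; exact: linear_comb0.
by under eq_fun do rewrite mulrDr mulrA; exact: linear_combS.
Qed.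

Lemma linear_comb1 (D : set (set (R * R))) A : D A -> linear_comb D (W A).
Proof.
move=> DA; rewrite (_ : W A = (fun w => 1 * W A w + 0) :> (Omega -> R)).
  by apply: linear_combS => //; exact: linear_comb0.
by apply/funext => w; rewrite mul1r addr0.
Qed.

Lemma linear_comb_sub D D' f : D `<=` D' -> linear_comb D f -> linear_comb D' f.
Proof.
move=> DD'; elim=> [|c A h DA Dh ih]; first exact: linear_comb0.
by apply: linear_combS => //; exact: DD'.
Qed.

Lemma measurable_linear_comb D f : linear_comb D f -> measurable_fun setT f.
Proof.
elim=> // c A h DA Dh ih; apply: measurable_funD => //.
exact: measurable_funM.
Qed.

Section comb.
Variable D : set (set (R * R)).
Hypothesis Dn : D `<=` @noise_index R.

Lemma gaussian_linear_comb f : linear_comb D f -> gaussian_rv P f.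
Proof.
move=> Df.
have [n [i [c [Di ->]]]] : exists (n : nat) (i : 'I_n -> set (R * R)) (c : 'I_n -> R),
    (forall k, noise_index (i k)) /\ f = (fun w => \sum_(k < n) c k * W (i k) w).
  elim: Df => [|c A h DA Dh [n [i [e [Di ->]]]]].
    exists 0%N, (fun=> set0), (fun=> 0); split; first by case.
    by apply/funext => w; rewrite big_ord0.
  exists n.+1, (fun k => oapp i A (unlift ord0 k)), (fun k => oapp e c (unlift ord0 k)).
  split; first by move=> k; case: unliftP => [j|] _ /=; [exact: Di|exact: Dn].
  apply/funext => w; rewrite big_ord_recl unlift_none /=; congr (_ + _).
  by apply: eq_bigr => k _; rewrite liftK.
by have [+ _ _] := W_noise; apply.
Qed.

Lemma integrable_sqr_linear_comb f : linear_comb D f ->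
  integrableP (fun w => f w ^+ 2).
Proof.
move=> Df; apply: (@gaussian_integrable _ _ _ P f _ _ (fun x => x ^+ 2) 4).
- exact: measurable_linear_comb Df.
- exact: gaussian_linear_comb.
- exact: (@measurable_funX _ _ _ setT id 2 (@measurable_id _ _ _)).
- move=> x; rewrite normrX.
  (* Squaring this inequality yields the constant 4 above. *)
  have h : 1 + `|x| / 2 <= expR (`|x| / 2) by exact: expR_ge1Dx.
  have -> : expR `|x| = expR (`|x| / 2) ^+ 2.
    by rewrite -expRM_natl; congr expR; field.
  have : (1 + `|x| / 2) ^+ 2 <= expR (`|x| / 2) ^+ 2.
    by rewrite ler_pXn2r// ?nnegrE ?expR_ge0// addr_ge0// divr_ge0.
  have := normr_ge0 x.
  by nra.
Qed.

Lemma integrable_mul_linear_comb f g : linear_comb D f -> linear_comb D g ->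
  integrableP (fun w => f w * g w).
Proof.
move=> Df Dg.
have mf := measurable_linear_comb Df.
have mg := measurable_linear_comb Dg.
have := integrable_addr measurableT (integrable_sqr_linear_comb Df)
  (integrable_sqr_linear_comb Dg).
apply: le_integrable => //.
  by apply/measurable_EFinP; exact: measurable_funM.
move=> w _; rewrite lee_fin [leRHS]ger0_norm ?addr_ge0 ?sqr_ge0//.
rewrite ler_norml; have := sqr_ge0 (f w + g w); have := sqr_ge0 (f w - g w).
have := sqr_ge0 (f w); have := sqr_ge0 (g w).
by move=> *; apply/andP; split; nra.
Qed.

Lemma integrable_linear_comb f : linear_comb D f -> integrableP f.
Proof.
move=> Df; apply: (@gaussian_integrable _ _ _ P f _ _ id 1) => //.
- exact: measurable_linear_comb Df.
- exact: gaussian_linear_comb.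
- by move=> x; rewrite mul1r (le_trans _ (expR_ge1Dx _))// lerDr.
Qed.

Lemma mean_linear_comb f : linear_comb D f -> Ex f = 0.
Proof.
elim=> [|c A h DA Dh ih]; first by rewrite Rintegral_cst// mul0r.
rewrite RintegralD//; last 2 first.
  exact: integrable_mulrl (integrable_linear_comb (linear_comb1 DA)).
  exact: integrable_linear_comb.
rewrite ih RintegralZl//; last exact: integrable_linear_comb (linear_comb1 DA).
by rewrite mean_noise ?mulr0 ?addr0//; exact: Dn.
Qed.

Lemma cos_linear_comb f c : linear_comb D f ->
  Ex (fun w => cos (f w + c)) = expR (- (Ex (fun w => f w ^+ 2) / 2)) * cos c.
Proof.
move=> Df; apply: gaussian_cos.
- exact: measurable_linear_comb Df.
- exact: gaussian_linear_comb.
- exact: mean_linear_comb.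
Qed.

(** Phases make sines available and turn products of cosines into sums of cosines, so these
    functions form an algebra; being bounded, they are integrable with no moment estimate. *)
Inductive trig_poly : (Omega -> R) -> Prop :=
| trig_poly0 : trig_poly (fun=> 0)
| trig_polyS a c f T : linear_comb D f -> trig_poly T ->
    trig_poly (fun w => a * cos (f w + c) + T w).

Lemma trig_polyD S T : trig_poly S -> trig_poly T -> trig_poly (fun w => S w + T w).
Proof.
move=> pS pT; elim: pS => [|a c f S' Df pS' ih].
  by under eq_fun do rewrite add0r.
by under eq_fun do rewrite -addrA; exact: trig_polyS.
Qed.

Lemma trig_polyZ k T : trig_poly T -> trig_poly (fun w => k * T w).
Proof.
elim=> [|a c f T' Df pT ih]; first by under eq_fun do rewrite mulr0; exact: trig_poly0.
by under eq_fun do rewrite mulrDr mulrA; exact: trig_polyS.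
Qed.

Lemma trig_poly_cos a c f : linear_comb D f -> trig_poly (fun w => a * cos (f w + c)).
Proof.
move=> Df; rewrite (_ : (fun w => _) = (fun w => a * cos (f w + c) + (fun=> 0) w)).
  by apply: trig_polyS => //; exact: trig_poly0.
by apply/funext => w; rewrite addr0.
Qed.

Lemma trig_poly_cst k : trig_poly (fun=> k).
Proof.
rewrite (_ : (fun=> k) = (fun w : Omega => k * cos ((fun=> 0) w + 0))).
  by apply: trig_poly_cos; exact: linear_comb0.
by apply/funext => w; rewrite addr0 cos0 mulr1.
Qed.

Lemma trig_polyM S T : trig_poly S -> trig_poly T -> trig_poly (fun w => S w * T w).
Proof.
move=> pS pT; elim: pS => [|a c f S' Df pS' ih].
  by under eq_fun do rewrite mul0r; exact: trig_poly0.
under eq_fun do rewrite mulrDl; apply: trig_polyD => //.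
elim: pT => [|b e g T' Dg pT' ih'].
  by under eq_fun do rewrite mulr0; exact: trig_poly0.
under eq_fun do rewrite mulrDr; apply: trig_polyD => //.
rewrite (_ : (fun w => _) = (fun w =>
    a * b / 2 * cos ((f w + g w) + (c + e)) +
    (a * b / 2) * cos ((f w + -1 * g w) + (c - e)))).
  apply: trig_polyD; apply: trig_poly_cos; apply: linear_combD => //.
  exact: linear_combZ.
apply/funext => w.
have -> : f w + g w + (c + e) = (f w + c) + (g w + e) by ring.
have -> : f w + -1 * g w + (c - e) = (f w + c) - (g w + e) by ring.
by rewrite mulrACA mulr_cos; ring.
Qed.

Lemma trig_polyX T n : trig_poly T -> trig_poly (fun w => T w ^+ n).
Proof.
move=> pT; elim: n => [|n ih].
  by under eq_fun do rewrite expr0; exact: trig_poly_cst.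
by under eq_fun do rewrite exprS; exact: trig_polyM.
Qed.

Lemma trig_poly_prod (I : Type) (r : seq I) (T : I -> Omega -> R) :
  (forall i, trig_poly (T i)) -> trig_poly (fun w => \prod_(i <- r) T i w).
Proof.
move=> pT; elim: r => [|i r ih].
  by under eq_fun do rewrite big_nil; exact: trig_poly_cst.
by under eq_fun do rewrite big_cons; exact: trig_polyM.
Qed.

Lemma measurable_trig_poly T : trig_poly T -> measurable_fun setT T.
Proof.
elim=> // a c f T' Df pT ih; apply: measurable_funD => //.
apply: measurable_funM => //; apply: measurableT_comp.
  exact: continuous_measurable_fun (@continuous_cos R).
by apply: measurable_funD => //; exact: measurable_linear_comb Df.
Qed.

Lemma trig_poly_bounded T : trig_poly T -> exists M, forall w, `|T w| <= M.
Proof.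
elim=> [|a c f T' Df pT [M hM]]; first by exists 0 => w; rewrite normr0.
exists (`|a| + M) => w; rewrite (le_trans (ler_normD _ _))// lerD//.
by rewrite normrM ler_piMr// cos_max.
Qed.

End comb.

Lemma bounded_integrable (f : Omega -> R) M : measurable_fun setT f ->
  (forall w, `|f w| <= M) -> integrableP f.
Proof.
move=> mf fM; apply: (@le_integrable _ _ _ P _ measurableT _ (EFin \o cst M)).
- exact/measurable_EFinP.
- by move=> w _ /=; rewrite lee_fin (le_trans (fM w))// ler_norm.
- exact: finite_measure_integrable_cst.
Qed.

Section independence.
Variables (D1 D2 : set (set (R * R))).
Hypotheses (D1n : D1 `<=` @noise_index R) (D2n : D2 `<=` @noise_index R).
Hypothesis orth : forall A B, D1 A -> D2 B -> noise_cov beta A B = 0%E.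

Let D := D1 `|` D2.
Let Dn : D `<=` @noise_index R. Proof. by move=> A [/D1n|/D2n]. Qed.

Lemma linear_comb_orth f g : linear_comb D1 f -> linear_comb D2 g ->
  Ex (fun w => f w * g w) = 0.
Proof.
move=> Df Dg; elim: Df => [|c A f' DA Df' ih].
  by under eq_Rintegral do rewrite mul0r; rewrite Rintegral_cst// mul0r.
have DA' : linear_comb D (W A) by apply: linear_comb1; left.
have s1 := linear_comb_sub (@subsetUl _ D1 D2).
have s2 := linear_comb_sub (@subsetUr _ D1 D2).
under eq_Rintegral do rewrite mulrDl -mulrA.
rewrite RintegralD//; last 2 first.
  by apply: integrable_mulrl => //; apply: (integrable_mul_linear_comb Dn); [|exact: s2].
  by apply: (integrable_mul_linear_comb Dn); [exact: s1|exact: s2].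
rewrite ih addr0 RintegralZl//; last first.
  by apply: (integrable_mul_linear_comb Dn); [|exact: s2].
apply/eqP; rewrite mulf_eq0; apply/orP; right; apply/eqP.
elim: Dg {ih} => [|e B g' DB Dg' ih].
  by under eq_Rintegral do rewrite mulr0; rewrite Rintegral_cst// mul0r.
have DB' : linear_comb D (W B) by apply: linear_comb1; right.
under eq_Rintegral do rewrite mulrDr mulrCA.
rewrite RintegralD//; last 2 first.
  by apply: integrable_mulrl => //; exact: (integrable_mul_linear_comb Dn).
  by apply: (integrable_mul_linear_comb Dn) => //; exact: s2.
rewrite ih addr0 RintegralZl//; last exact: (integrable_mul_linear_comb Dn).
by rewrite cov_noise ?orth ?mulr0//; [exact: D1n|exact: D2n].
Qed.

Let uncorr (F S : Omega -> R) := Ex (fun w => F w * S w) = Ex F * Ex S.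

(** By the product-to-sum formula only [f + g] and [f - g] matter. Orthogonality gives both the same
    variance, the sum of the two, so the Gaussian cosine formula factors; a double induction extends
    this bilinearly. *)
Lemma trig_poly_uncorr T S : trig_poly D1 T -> trig_poly D2 S -> uncorr T S.
Proof.
have s1 := linear_comb_sub (@subsetUl _ D1 D2).
have s2 := linear_comb_sub (@subsetUr _ D1 D2).
have icos f c : linear_comb D f -> integrableP (fun w => cos (f w + c)).
  move=> Df; apply: (@bounded_integrable _ 1) => [|w]; last exact: cos_max.
  apply: measurableT_comp; first exact: continuous_measurable_fun (@continuous_cos R).
  by apply: measurable_funD => //; exact: measurable_linear_comb Df.
have base f g c e : linear_comb D1 f -> linear_comb D2 g ->
    uncorr (fun w => cos (f w + c)) (fun w => cos (g w + e)).
  move=> Df Dg; rewrite /uncorr.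
  have Df' := s1 _ Df; have Dg' := s2 _ Dg.
  have vD k : k ^+ 2 = 1 -> Ex (fun w => (f w + k * g w) ^+ 2) =
      Ex (fun w => f w ^+ 2) + Ex (fun w => g w ^+ 2).
    move=> k1.
    have -> : (fun w => (f w + k * g w) ^+ 2) =
        (fun w => f w ^+ 2 + (g w ^+ 2 + (2 * k) * (f w * g w))).
      apply/funext => w; have -> : g w ^+ 2 = k ^+ 2 * g w ^+ 2 by rewrite k1 mul1r.
      by ring.
    have ifg := integrable_mul_linear_comb Dn Df' Dg'.
    have iff := integrable_sqr_linear_comb Dn Df'.
    have igg := integrable_sqr_linear_comb Dn Dg'.
    rewrite RintegralD//; last by apply: integrable_addr => //; exact: integrable_mulrl.
    rewrite RintegralD//; last exact: integrable_mulrl.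
    by rewrite RintegralZl// linear_comb_orth// mulr0 addr0.
  have Dp : linear_comb D (fun w => f w + 1 * g w).
    by apply: linear_combD => //; exact: linear_combZ.
  have Dm : linear_comb D (fun w => f w + -1 * g w).
    by apply: linear_combD => //; exact: linear_combZ.
  have -> : (fun w => cos (f w + c) * cos (g w + e)) = (fun w =>
      2^-1 * cos ((f w + 1 * g w) + (c + e)) + 2^-1 * cos ((f w + -1 * g w) + (c - e))).
    apply/funext => w.
    have -> : f w + 1 * g w + (c + e) = (f w + c) + (g w + e) by ring.
    have -> : f w + -1 * g w + (c - e) = (f w + c) - (g w + e) by ring.
    exact: mulr_cos.
  rewrite RintegralD//; last 2 first.
    by apply: integrable_mulrl => //; exact: (icos (fun w => f w + 1 * g w)).
    by apply: integrable_mulrl => //; exact: (icos (fun w => f w + -1 * g w)).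
  rewrite !RintegralZl//; last 2 first.
    exact: (icos (fun w => f w + -1 * g w)).
    exact: (icos (fun w => f w + 1 * g w)).
  rewrite (@cos_linear_comb D Dn (fun w => f w + 1 * g w))//.
  rewrite (@cos_linear_comb D Dn (fun w => f w + -1 * g w))//.
  rewrite (@cos_linear_comb D Dn f)// (@cos_linear_comb D Dn g)//.
  rewrite !vD ?sqrrN ?expr1n//.
  by rewrite mulrDl opprD expRD cosD cosB; field.
move=> pT pS; elim: pT => [|a c f T' Df pT ih].
  rewrite /uncorr; under eq_Rintegral do rewrite mul0r.
  by rewrite Rintegral_cst// !mul0r.
have mS := measurable_trig_poly pS; have [M SM] := trig_poly_bounded pS.
have mT := measurable_trig_poly pT; have [M' TM] := trig_poly_bounded pT.
have icf := icos _ c (s1 _ Df).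
have mcf : measurable_fun setT (fun w => cos (f w + c)).
  by apply/measurable_EFinP; exact: measurable_int icf.
have icS : integrableP (fun w => cos (f w + c) * S w).
  apply: (@bounded_integrable _ M); first exact: measurable_funM.
  by move=> w; rewrite normrM (le_trans _ (SM w))// ler_piMl// cos_max.
have iTS : integrableP (fun w => T' w * S w).
  apply: (@bounded_integrable _ (M' * M)); first exact: measurable_funM.
  by move=> w; rewrite normrM ler_pM.
have iT : integrableP T' by exact: bounded_integrable TM.
rewrite /uncorr; under eq_Rintegral do rewrite mulrDl -mulrA.
rewrite RintegralD ?RintegralZl//; last exact: integrable_mulrl.
rewrite [in RHS]RintegralD ?RintegralZl//; last exact: integrable_mulrl.
rewrite ih mulrDl -mulrA; congr (a * _ + _).
elim: pS {ih mS SM icS iTS} => [|b e g S' Dg pS ih].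
  under eq_Rintegral do rewrite mulr0.
  by rewrite Rintegral_cst// !mul0r mulr0.
have icg := icos _ e (s2 _ Dg).
have mcg : measurable_fun setT (fun w => cos (g w + e)).
  by apply/measurable_EFinP; exact: measurable_int icg.
have mS := measurable_trig_poly pS; have [M2 SM] := trig_poly_bounded pS.
have i1 : integrableP (fun w => cos (f w + c) * cos (g w + e)).
  apply: (@bounded_integrable _ 1); first exact: measurable_funM.
  by move=> w; rewrite normrM mulr_ile1 ?cos_max.
have i2 : integrableP (fun w => cos (f w + c) * S' w).
  apply: (@bounded_integrable _ M2); first exact: measurable_funM.
  by move=> w; rewrite normrM (le_trans _ (SM w))// ler_piMl// cos_max.
have iS : integrableP S' by exact: bounded_integrable SM.
under eq_Rintegral do rewrite mulrDr mulrCA.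
rewrite RintegralD ?RintegralZl//; last exact: integrable_mulrl.
rewrite [in RHS]RintegralD ?RintegralZl//; last exact: integrable_mulrl.
by rewrite ih base// mulrDr mulrCA.
Qed.

End independence.

End noise.

(** * Indicators of half-spaces as limits of trigonometric polynomials *)

Lemma cvg_mulrn_expr (R : realType) (z : R) : 0 <= z < 1 ->
  n%:R * z ^+ n @[n --> \oo] --> (0 : R).
Proof.
(* With [q] the square root of [z], the sequence is [n * q ^+ n], bounded by a geometric sum, times
   [q ^+ n]. *)
move=> /andP[z0 z1]; pose q := Num.sqrt z.
have q0 : 0 <= q by exact: sqrtr_ge0.
have q1 : q < 1 by rewrite -sqrtr1 ltr_sqrt.
have zq : z = q ^+ 2 by rewrite sqr_sqrtr.
have bnd n : n%:R * q ^+ n <= (1 - q)^-1.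
  rewrite -[leRHS]mul1r ler_pdivlMr ?subr_gt0//.
  have h : n%:R * q ^+ n <= \sum_(i < n) q ^+ i.
    rewrite mulr_natl -[X in _ *+ X](card_ord n) -sumr_const; apply: ler_sum => i _.
    by apply: ler_wiXn2l => //; [exact: ltW|exact: ltnW].
  apply: (@le_trans _ _ ((\sum_(i < n) q ^+ i) * (1 - q))).
    by rewrite ler_wpM2r// subr_ge0 ltW.
  have -> : (\sum_(i < n) q ^+ i) * (1 - q) = 1 - q ^+ n.
    by rewrite mulrC -opprB mulNr -subrX1 opprB.
  by rewrite lerBlDr lerDl exprn_ge0.
apply: (@squeeze_cvgr _ _ _ _ (cst 0) (fun n => (1 - q)^-1 * q ^+ n)).
- apply: nearW => n; rewrite mulr_ge0 ?exprn_ge0//= zq -exprM mul2n -addnn exprD.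
  by rewrite mulrA ler_wpM2r ?exprn_ge0.
- exact: cvg_cst.
- by apply: cvg_geometric; rewrite ger0_norm.
Qed.

(* Polynomials in [y] approximating the indicator of [y < 1/2] boundedly on
   [0, 1]; the exponent grows fast enough to kill the value at [y = 1/2]. *)
Definition cutoff (R : realType) (n : nat) (y : R) : R := (1 - y ^+ n) ^+ (n * 2 ^ n).

Section cutoff.
Variables (R : realType) (y : R).
Hypothesis y01 : 0 <= y <= 1.

Let yn01 n : 0 <= y ^+ n <= 1.
Proof. by case/andP: y01 => ? ?; rewrite exprn_ge0//= exprn_ile1. Qed.

Lemma cutoff_itv n : 0 <= cutoff n y <= 1.
Proof.
have /andP[? ?] := yn01 n.
by rewrite exprn_ge0 ?subr_ge0//= exprn_ile1 ?subr_ge0// lerBlDr lerDl.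
Qed.

Let bernoulli (x : R) n : 0 <= x <= 1 -> 1 - n%:R * x <= (1 - x) ^+ n.
Proof.
move=> /andP[x0 x1]; elim: n => [|n ih]; first by rewrite mul0r subr0 expr0.
rewrite exprS.
have : (1 - x) * (1 - n%:R * x) <= (1 - x) * (1 - x) ^+ n.
  by rewrite ler_wpM2l// subr_ge0.
apply: le_trans; rewrite -natr1.
have : 0 <= n%:R * x * x by rewrite !mulr_ge0.
by nra.
Qed.

(** Below 1/2, Bernoulli's inequality bounds the value from below by [1 - n * (2 * y) ^+ n]. From
    1/2 on, the value is at most the exponential of [- n * (2 * y) ^+ n], hence of [- n]. *)
Lemma cvg_cutoff : cutoff n y @[n --> \oo] --> ((y < 2^-1)%R%:R : R).
Proof.
have [yh|yh] := ltP y 2^-1.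
  have z01 : 0 <= 2 * y < 1.
    by case/andP: y01 => y0 _; rewrite mulr_ge0//= mulrC -ltr_pdivlMr// mul1r.
  apply: (@squeeze_cvgr _ _ _ _ (fun n : nat => 1 - n%:R * (2 * y) ^+ n) (cst 1)).
  - apply: nearW => n; have /andP[_ ->] := cutoff_itv n; rewrite andbT.
    apply: le_trans (bernoulli _ (yn01 n)).
    by rewrite exprMn natrM natrX mulrA.
  - rewrite -[X in _ --> X]subr0; apply: cvgB; first exact: cvg_cst.
    exact: cvg_mulrn_expr.
  - exact: cvg_cst.
apply: (@squeeze_cvgr _ _ _ _ (cst 0) (fun n : nat => 1 * expR (-1) ^+ n)).
- apply: nearW => n; have /andP[-> _] := cutoff_itv n; rewrite mul1r /=.
  have /andP[p0 p1] := yn01 n.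
  apply: (@le_trans _ _ (expR (- y ^+ n) ^+ (n * 2 ^ n))).
    apply: lerXn2r; rewrite ?nnegrE ?subr_ge0 ?expR_ge0//.
    by rewrite (le_trans _ (expR_ge1Dx _)).
  rewrite -!expRM_natl ler_expR mulrN1 mulrN lerN2.
  rewrite natrM natrX -mulrA ler_peMr// -exprMn.
  apply: exprn_ege1; rewrite -ler_pdivrMl// mulr1//.
- exact: cvg_cst.
- apply: cvg_geometric; rewrite ger0_norm ?expR_ge0//.
Qed.

End cutoff.

Lemma cvg_prod_seq (R : realType) (I : Type) (l : seq I) (f : I -> nat -> R) (a : I -> R) :
  (forall i, f i n @[n --> \oo] --> a i) ->
  \prod_(i <- l) f i n @[n --> \oo] --> \prod_(i <- l) a i.
Proof.
move=> fa; elim: l => [|i l ih].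
  by rewrite big_nil; under eq_fun do rewrite big_nil; exact: cvg_cst.
by rewrite big_cons; under eq_fun do rewrite big_cons; apply: cvgM.
Qed.

(** The sine of a small multiple of [x] has the sign of [x]: this is how a bounded periodic function
    detects a half-line. *)
Lemma near_sin_gt0 (R : realType) (x : R) :
  \forall k \near \oo, (0 < sin (x / k.+1%:R)) = (0 < x).
Proof.
near=> k.
have xk : `|x| < k.+1%:R.
  have : `|x| <= k%:R by near: k; exact: nbhs_infty_ger.
  by move=> h; rewrite (le_lt_trans h)// ltr_nat.
have k0 : 0 < k.+1%:R :> R by [].
have lt1 : `|x / k.+1%:R| < pi.
  rewrite normrM normfV (ger0_norm (ltW k0)) ltr_pdivrMr//.
  rewrite (lt_le_trans xk)// ler_peMl// (le_trans _ (pi_ge2 R))// ler1n//.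
have [x0|x0] := ltP 0 x.
  rewrite sin_gt0_pi//; apply/andP; split; first by rewrite divr_gt0.
  by rewrite (le_lt_trans (ler_norm _) lt1).
apply/negbTE; rewrite -leNgt -oppr_ge0 -sinN sin_ge0_pi//.
rewrite oppr_ge0 mulr_le0_ge0 ?invr_ge0//=.
by rewrite (le_trans _ (ltW lt1))// -normrN ler_norm.
Unshelve. all: by end_near. Qed.

Lemma bounded_cvg_Rintegral d (T : measurableType d) (R : realType)
    (P : probability T R) (F_ : nat -> T -> R) (F : T -> R) (M : R) :
  (forall n, measurable_fun setT (F_ n)) -> (forall n w, `|F_ n w| <= M) ->
  (forall w, F_ n w @[n --> \oo] --> F w) ->
  \int[P]_w F_ n w @[n --> \oo] --> \int[P]_w F w.
Proof.
move=> mF FM cF.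
have mlim : measurable_fun setT F by exact: (measurable_fun_cvg mF (fun x _ => cF x)).
have lM w : `|F w| <= M.
  have cn : `|F_ n w| @[n --> \oo] --> `|F w| by apply: cvg_norm; exact: cF.
  rewrite -(cvg_lim (@Rhausdorff R) cn); apply: limr_le.
    by apply/cvg_ex; exists `|F w|.
  by apply: nearW => n; exact: FM.
have iF : P.-integrable setT (EFin \o F).
  apply: (@le_integrable _ _ _ P _ measurableT _ (EFin \o cst M)).
  - exact/measurable_EFinP.
  - by move=> w _ /=; rewrite lee_fin (le_trans (lM w))// ler_norm.
  - exact: finite_measure_integrable_cst.
apply: fine_cvg; rewrite fineK; last exact: integrable_fin_num.
apply: (@dominated_cvg _ _ _ P setT measurableT (fun n => EFin \o F_ n) _ (EFin \o cst M)) => //.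
- by move=> n; exact/measurable_EFinP.
- by move=> w _; apply: cvg_EFin; [exact: nearW|exact: cF].
- exact: finite_measure_integrable_cst.
- by move=> n w _; rewrite lee_fin FM.
Qed.

Section independence.
Context (R : realType) (d : measure_display) (Omega : measurableType d)
  (P : probability Omega R) (beta : R) (W : set (R * R) -> {RV P >-> R}).
Hypothesis W_noise : colored_noise beta W.
Variables (D1 D2 : set (set (R * R))).
Hypotheses (D1n : D1 `<=` @noise_index R) (D2n : D2 `<=` @noise_index R).
Hypothesis orth : forall A B, D1 A -> D2 B -> noise_cov beta A B = 0%E.

Notation comb D := {f : Omega -> R | linear_comb W D f}.

(** Finite intersections of open half-spaces, as lists: concatenation of lists is intersection,
    which makes them a pi-system. *)
Definition halfspaces D (l : seq (comb D * R)) : set Omega :=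
  [set w | all (fun p => p.2 < sval p.1 w) l].

Lemma measurable_halfspaces D (l : seq (comb D * R)) : measurable (halfspaces l).
Proof.
elim: l => [|p l ih]; first by rewrite (_ : halfspaces _ = setT)//; apply/seteqP; split.
rewrite (_ : halfspaces _ = (sval p.1) @^-1` `]p.2, +oo[%classic `&` halfspaces l).
  apply: measurableI => //; rewrite -[X in measurable X]setTI.
  by apply: (measurable_linear_comb (svalP p.1)).
apply/seteqP; split => w; rewrite /halfspaces/= in_itv/= andbT.
  by move=> /andP[].
by case=> -> ->.
Qed.

Let uncorr (F S : Omega -> R) :=
  \int[P]_w (F w * S w) = \int[P]_w F w * \int[P]_w S w.

Let uncorr_lim (F_ : nat -> Omega -> R) (F S : Omega -> R) M : measurable_fun setT S ->
  (forall w, `|S w| <= M) -> (forall n, measurable_fun setT (F_ n)) ->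
  (forall n w, `|F_ n w| <= 1) -> (forall w, F_ n w @[n --> \oo] --> F w) ->
  (forall n, uncorr (F_ n) S) -> uncorr F S.
Proof.
move=> mS SM mF F1 cF un.
have h1 := bounded_cvg_Rintegral mF F1 cF.
have h2 : \int[P]_w (F_ n w * S w) @[n --> \oo] --> \int[P]_w (F w * S w).
  apply: (@bounded_cvg_Rintegral _ _ _ _ _ _ M).
  - by move=> n; exact: measurable_funM.
  - by move=> n w; rewrite normrM (le_trans _ (SM w))// ler_piMl.
  - by move=> w; apply: cvgM => //; exact: cvg_cst.
have h3 : \int[P]_w (F_ n w * S w) @[n --> \oo] --> \int[P]_w F w * \int[P]_w S w.
  rewrite (_ : (fun n => _) = (fun n => \int[P]_w F_ n w * \int[P]_w S w)).
    by apply: cvgM => //; exact: cvg_cst.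
  by apply/funext => n; exact: un.
exact: (cvg_unique _ h2 h3).
Qed.

(** The indicator is reached by two successive bounded limits: [cutoff n] sharpens a threshold at
    fixed [k], then [k] tends to infinity. *)
Let halfspaces_lim D (l : seq (comb D * R)) (S : Omega -> R) M : D `<=` @noise_index R ->
  measurable_fun setT S -> (forall w, `|S w| <= M) ->
  (forall T, trig_poly W D T -> uncorr T S) -> uncorr \1_(halfspaces l) S.
Proof.
move=> Dn mS SM un.
(* [y k p w] stays in [0, 1] and is below 1/2 exactly when the sine of
   [(sval p.1 w - p.2) / k.+1%:R] is positive. *)
pose y (k : nat) (p : comb D * R) w : R :=
  2^-1 + (- 2^-1) * cos (k.+1%:R^-1 * sval p.1 w + (- (p.2 / k.+1%:R) - pi / 2)).
have yE k p w : y k p w = 2^-1 - 2^-1 * sin ((sval p.1 w - p.2) / k.+1%:R).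
  by rewrite /y addrA cosBpihalf mulNr; congr (_ - _ * sin _); ring.
have y01 k p w : 0 <= y k p w <= 1.
  have := sin_max ((sval p.1 w - p.2) / k.+1%:R); rewrite yE ler_norml.
  by move=> /andP[? ?]; apply/andP; split; lra.
have py k p : trig_poly W D (y k p).
  apply: trig_polyD; first exact: trig_poly_cst.
  by apply: trig_poly_cos; apply: linear_combZ; exact: svalP.
pose F k n w := \prod_(p <- l) cutoff n (y k p w).
have pF k n : trig_poly W D (F k n).
  apply: trig_poly_prod => p; apply: trig_polyX.
  rewrite (_ : (fun w => _) = (fun w => 1 + -1 * y k p w ^+ n)); last first.
    by apply/funext => w; rewrite mulN1r.
  apply: trig_polyD; first exact: trig_poly_cst.
  by apply: trig_polyZ; exact: trig_polyX.
pose G k w := \prod_(p <- l) ((y k p w < 2^-1)%R%:R : R).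
have F1 k n w : `|F k n w| <= 1.
  rewrite /F normr_prod; elim: (l) => [|p r ih]; first by rewrite big_nil.
  rewrite big_cons mulr_ile1 ?prodr_ge0//.
  by have /andP[? ?] := cutoff_itv (y01 k p w) n; rewrite ger0_norm.
have FG k w : F k n w @[n --> \oo] --> G k w.
  by apply: cvg_prod_seq => p; exact: cvg_cutoff.
have mG k : measurable_fun setT (G k).
  exact: (measurable_fun_cvg (fun n => measurable_trig_poly (pF k n)) (fun x _ => FG k x)).
have G1 k w : `|G k w| <= 1.
  rewrite /G normr_prod; elim: (l) => [|p r ih]; first by rewrite big_nil.
  by rewrite big_cons mulr_ile1 ?prodr_ge0//; case: (_ < _); rewrite ?normr0 ?normr1.
have uG k : uncorr (G k) S.
  apply: (uncorr_lim mS SM (fun n => measurable_trig_poly (pF k n)) (F1 k)) => //.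
  by move=> n; exact: un.
apply: (uncorr_lim mS SM mG G1) => // w.
have -> : \1_(halfspaces l) w = \prod_(p <- l) ((0 < sval p.1 w - p.2)%R%:R : R).
  rewrite indicE /halfspaces mem_setE; elim: (l) => [|p r ih]; first by rewrite big_nil.
  by rewrite big_cons -ih/= subr_gt0 -natrM mulnb.
apply: cvg_prod_seq => p; apply: cvg_near_cst.
apply: filterS (near_sin_gt0 (sval p.1 w - p.2)) => k <-.
by rewrite yE; congr (nat_of_bool _)%:R; apply/idP/idP => h; lra.
Qed.

Lemma independent_halfspaces (l1 : seq (comb D1 * R)) (l2 : seq (comb D2 * R)) :
  P (halfspaces l1 `&` halfspaces l2) = (P (halfspaces l1) * P (halfspaces l2))%E.
Proof.
have m1 := measurable_halfspaces l1; have m2 := measurable_halfspaces l2.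
have b (E : set Omega) w : `|\1_E w : R| <= 1.
  by rewrite indicE; case: (_ \in _); rewrite ?normr0 ?normr1.
(* One indicator is approximated at a time, against a fixed bounded factor: first on the side of
   [D1], then on that of [D2]. *)
have : uncorr \1_(halfspaces l1) \1_(halfspaces l2).
  apply: (@halfspaces_lim D1 l1 \1_(halfspaces l2) 1 D1n) => [||T pT].
  - exact: measurable_indic.
  - exact: b.
  rewrite /uncorr; under eq_Rintegral do rewrite mulrC; rewrite mulrC.
  have [M TM] := trig_poly_bounded pT.
  change (uncorr \1_(halfspaces l2) T).
  apply: (@halfspaces_lim D2 l2 T M D2n (measurable_trig_poly pT) TM) => S pS.
  rewrite /uncorr; under eq_Rintegral do rewrite mulrC; rewrite mulrC.
  exact: (trig_poly_uncorr W_noise D1n D2n orth).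
have e (E : set Omega) : measurable E -> (\int[P]_w (\1_E w : R))%:E = P E.
  move=> mE; rewrite /Rintegral integral_indic// setIT fineK//.
  exact: fin_num_measure.
rewrite /uncorr => h.
rewrite -(e _ m1) -(e _ m2) -EFinM -h -(e _ (measurableI _ _ m1 m2)).
by congr EFin; apply: eq_Rintegral => w _; rewrite indicI.
Qed.

End independence.

(** * Independence from the past sigma-field *)

Section past.
Context (R : realType) (d : measure_display) (Omega : measurableType d)
  (P : probability Omega R) (beta tau0 : R) (W : set (R * R) -> {RV P >-> R}).
Hypothesis P_complete : measure_is_complete P.
Hypothesis W_noise : colored_noise beta W.

Lemma measurable_strip : measurable (strip tau0).
Proof.
have -> : strip tau0 = (`[0, tau0 / Num.sqrt 2[%classic : set R) `*` setT.
  by apply/seteqP; split => p; rewrite /strip/= in_itv/=; [|case].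
exact: measurableX.
Qed.

Lemma strip_noise_index B : bounded_borel B -> noise_index (B `&` strip tau0).
Proof.
move=> [mB bB]; split; last by move=> p [_ /andP[]].
split; first exact: measurableI _ _ mB measurable_strip.
by move: bB; rewrite /bounded_set /bounded_near; apply: filterS => M h x [Bx _]; exact: h.
Qed.

(** The noise is white in time: both indicators are evaluated at the same [s]. *)
Lemma noise_cov_time_disjoint (A B : set (R * R)) :
  (forall s y y', A (s, y) -> B (s, y') -> False) -> noise_cov beta A B = 0%E.
Proof.
move=> AB; rewrite /noise_cov.
apply: integral0_eq => s _; apply: integral0_eq => y _; apply: integral0_eq => y' _.
rewrite !indicE; case: (boolP (_ \in A)) => [/set_mem As|_]; last by rewrite !mul0r.
case: (boolP (_ \in B)) => [/set_mem Bs|_]; last by rewrite !mulr0.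
by have := AB _ _ _ As Bs.
Qed.

Let past_sets := [set A | exists2 B, bounded_borel B & A = B `&` strip tau0].
Let past_comb := {f : Omega -> R | linear_comb W past_sets f}.

Let past_sets_noise : past_sets `<=` @noise_index R.
Proof. by move=> _ [B bB ->]; exact: strip_noise_index. Qed.

(** The null sets of [past_events] join the half-spaces in the generator, which stays stable under
    intersection. Completeness of [P] makes them measurable. *)
Let pi_past := [set E | exists l : seq (past_comb * R), E = halfspaces l]
  `|` P.-negligible.

Let measurable_pi_past : pi_past `<=` measurable.
Proof.
by move=> E [[l ->]|/P_complete//]; exact: measurable_halfspaces.
Qed.

Let pi_past_setI : setI_closed pi_past.
Proof.
move=> E F [[l1 ->]|nE] [[l2 ->]|nF].
- left; exists (l1 ++ l2); apply/seteqP; split => w; rewrite /halfspaces/= all_cat.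
    by case=> -> ->.
  by move=> /andP[].
- by right; apply: negligibleS nF; exact: subIsetr.
- by right; apply: negligibleS nE; exact: subIsetl.
- by right; apply: negligibleS nE; exact: subIsetl.
Qed.

Let past_events_pi_past : <<s past_events W tau0 >> `<=` <<s pi_past >>.
Proof.
apply: smallest_sub; first exact: smallest_sigma_algebra.
move=> E [[B [C [bB mC ->]]]|nE]; last by apply: sub_sigma_algebra; right.
pose f : g_sigma_algebraType pi_past -> R := W (B `&` strip tau0).
have mf : measurable_fun setT f.
  apply: (measurability _ (RGenOInfty.measurableE R)) => _ [_ [x ->] <-].
  rewrite setTI; apply: sub_sigma_algebra; left.
  have pB : past_sets (B `&` strip tau0) by exists B.
  exists [:: (exist _ (W (B `&` strip tau0) : Omega -> R) (linear_comb1 W pB), x)].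
  by apply/seteqP; split => w; rewrite /halfspaces/= in_itv/= !andbT.
by have := mf measurableT C mC; rewrite setTI.
Qed.

Lemma measurable_past E : <<s past_events W tau0 >> E -> measurable E.
Proof.
move=> /past_events_pi_past; apply; split; last exact: measurable_pi_past.
exact: sigma_algebra_measurable.
Qed.

(** For a half-space [F] of [W A], the finite measures [P (E F)] and [P E * P F], as functions of
    [E], agree on a generating pi-system. The event is the union of two half-spaces, disjoint
    because [0 <= a]. *)
Lemma past_independent A E (a : R) : noise_index A ->
  (forall p, A p -> tau0 / Num.sqrt 2 <= p.1) -> <<s past_events W tau0 >> E ->
  0 <= a -> P (E `&` [set w | a < `|W A w|]) = (P E * P [set w | (a < `|W A w|)%R])%E.
Proof.
move=> nA At /past_events_pi_past sE a0.
have orth B C : past_sets B -> [set A] C -> noise_cov beta B C = 0%E.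
  move=> [B' _ ->] ->; apply: noise_cov_time_disjoint => s y y' [_ /andP[_ h]] /At /=.
  by move=> /(lt_le_trans h); rewrite ltxx.
have An : [set A] `<=` @noise_index R by move=> _ ->.
have lA : linear_comb W [set A] (W A) by exact: linear_comb1.
pose lY : {f : Omega -> R | linear_comb W [set A] f} := exist _ (W A : Omega -> R) lA.
pose lZ : {f : Omega -> R | linear_comb W [set A] f} := exist _ _ (linear_combZ (-1) lA).
pose F1 := halfspaces [:: (lY, a)]; pose F2 := halfspaces [:: (lZ, a)].
have half (F : set Omega) (mF : measurable F) :
    (forall l : seq (past_comb * R), P (halfspaces l `&` F) = (P (halfspaces l) * P F)%E) ->
    P (E `&` F) = (P E * P F)%E.
  move=> hF; pose r : {nonneg R} := NngNum (fine_ge0 (measure_ge0 P F)).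
  have rE : r%:num%:E = P F by rewrite /= fineK// fin_num_measure.
  have h : forall E, <<s pi_past >> E -> mrestr P mF E = mscale r P E.
    apply: (@g_sigma_algebra_measure_unique _ _ _ pi_past measurable_pi_past (fun=> setT)).
    - by move=> _; left; exists [::]; apply/seteqP; split.
    - by rewrite bigcup_const//; exists 0%N.
    - exact: pi_past_setI.
    - move=> G [[l ->]|nG]; rewrite /= /mrestr /mscale /=.
        by rewrite hF muleC -rE.
      have mG := P_complete nG.
      have G0 : P G = 0%E by exact/negligibleP.
      rewrite G0 mule0; apply/eqP; rewrite eq_le measure_ge0 andbT -[leRHS]G0.
      by apply: le_measure; rewrite ?inE//; exact: measurableI.
    - by move=> k; rewrite /= /mrestr ltey_eq fin_num_measure//; exact: measurableI.
  by have := h E sE; rewrite /= /mrestr /mscale rE muleC.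
have ind (F : seq ({f : Omega -> R | linear_comb W [set A] f} * R)) (l : seq (past_comb * R)) :
    P (halfspaces l `&` halfspaces F) = (P (halfspaces l) * P (halfspaces F))%E.
  exact: (independent_halfspaces W_noise past_sets_noise An orth).
have m1 : measurable F1 by exact: measurable_halfspaces.
have m2 : measurable F2 by exact: measurable_halfspaces.
have mE : measurable E.
  by apply: sE; split; [exact: sigma_algebra_measurable|exact: measurable_pi_past].
have FU : [set w | a < `|W A w|] = F1 `|` F2.
  apply/seteqP; split => w; rewrite /F1 /F2 /halfspaces/= !andbT mulN1r ltr_normr.
    by move=> /orP[]; [left|right].
  by case=> ->; rewrite ?orbT.
have F12 : F1 `&` F2 = set0.
  apply/seteqP; split => w //; rewrite /F1 /F2 /halfspaces/= !andbT mulN1r.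
  by case=> h1 h2; lra.
rewrite FU setIUr measureU//; last 3 first.
- exact: measurableI.
- exact: measurableI.
- by rewrite setIACA F12 setI0.
rewrite measureU//.
by rewrite ge0_muleDr//; congr (_ + _)%E; apply: half => // l; exact: ind.
Qed.

End past.

(** * Covariance estimates *)

(** The integral of a nonnegative function is a supremum over the simple functions below it, hence
    monotone without any measurability. Covariance bounds can thus be stated for arbitrary sets. *)
Lemma ge0_le_integral_nomeas d (T : measurableType d) (R : realType)
    (mu : {measure set T -> \bar R}) (D : set T) (f g : T -> \bar R) :
  (forall x, D x -> (0 <= f x)%E) -> (forall x, D x -> (f x <= g x)%E) ->
  (\int[mu]_(x in D) f x <= \int[mu]_(x in D) g x)%E.
Proof.
move=> f0 fg; have g0 x : D x -> (0 <= g x)%E.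
  by move=> Dx; rewrite (le_trans (f0 _ Dx))// fg.
rewrite (ge0_integralE mu f0) (ge0_integralE mu g0).
apply: le_ereal_sup => _ /= [h hf <-]; exists h => // x; apply: le_trans (hf x) _.
by rewrite !patchE; case: ifP => // /set_mem; exact: fg.
Qed.

Section covariance.
Context (R : realType) (beta : R).
Notation TR := (measurableTypeR R).
Notation mu := (@lebesgue_measure R).
Implicit Types A B : set (R * R).

Let kernel A B (p : (TR * TR) * TR) : \bar R :=
  (\1_A p.1 * `|p.1.2 - p.2| `^ (- beta) * \1_B (p.1.1, p.2))%:E.

Let measurable_kernel A B : measurable A -> measurable B ->
  measurable_fun setT (kernel A B).
Proof.
move=> mA mB.
have mA' : measurable (A : set (TR * TR)) := mA.
have mB' : measurable (B : set (TR * TR)) := mB.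
apply/measurable_EFinP; apply: measurable_funM; first apply: measurable_funM.
- by apply: measurableT_comp => //; exact: measurable_indic.
- apply: (@measurableT_comp _ _ _ _ _ _ (fun x : R => x `^ (- beta))).
    exact: measurable_powR.
  apply: measurableT_comp => //; apply: measurable_funB.
    by apply: (measurableT_comp (f := snd) (g := fst)).
  exact: measurable_snd.
- have mpair : measurable_fun setT (fun p : (TR * TR) * TR => (p.1.1, p.2)).
    apply/measurable_fun_pairP; split; last exact: measurable_snd.
    by apply: (measurableT_comp (f := fst) (g := fst)).
  exact: (measurableT_comp (measurable_indic mB') mpair).
Qed.

Let kernel_ge0 A B p : (0 <= kernel A B p)%E.
Proof. by rewrite lee_fin !mulr_ge0// powR_ge0. Qed.

Let inner A B (p : TR * TR) : \bar R := (\int[mu]_y' kernel A B (p, y'))%E.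

Let inner_ge0 A B p : (0 <= inner A B p)%E.
Proof. by apply: integral_ge0 => y' _; exact: kernel_ge0. Qed.

Let measurable_inner A B : measurable A -> measurable B ->
  measurable_fun setT (inner A B).
Proof.
move=> mA mB.
exact: (@measurable_fun_fubini_tonelli_F _ _ _ _ R mu _ (measurable_kernel mA mB) (kernel_ge0 A B)).
Qed.

Let slice A B (s : TR) : \bar R := (\int[mu]_y inner A B (s, y))%E.

Let slice_ge0 A B s : (0 <= slice A B s)%E.
Proof. by apply: integral_ge0 => y _; exact: inner_ge0. Qed.

Let measurable_slice A B : measurable A -> measurable B ->
  measurable_fun setT (slice A B).
Proof.
move=> mA mB.
exact: (@measurable_fun_fubini_tonelli_F _ _ _ _ R mu _ (measurable_inner mA mB) (inner_ge0 A B)).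
Qed.

Let noise_covE A B : noise_cov beta A B = (\int[mu]_(s in `[0%R, +oo[) slice A B s)%E.
Proof. by []. Qed.

Lemma noise_cov_ge0 A B : (0 <= noise_cov beta A B)%E.
Proof. by apply: integral_ge0 => s _; exact: slice_ge0. Qed.

Lemma noise_covDl A B C X : measurable B -> measurable C -> measurable X ->
  A = B `|` C -> B `&` C = set0 ->
  noise_cov beta A X = (noise_cov beta B X + noise_cov beta C X)%E.
Proof.
move=> mB mC mX -> BC0.
have indU p : \1_(B `|` C) p = \1_B p + \1_C p :> R.
  rewrite !indicE in_setU; case: (boolP (p \in B)) => pB; case: (boolP (p \in C)) => pC;
    rewrite /= ?addr0 ?add0r//.
  have : (B `&` C) p by split; exact: set_mem.
  by rewrite BC0.
have kU p : kernel (B `|` C) X p = (kernel B X p + kernel C X p)%E.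
  by rewrite /kernel indU !mulrDl EFinD.
have iU p : inner (B `|` C) X p = (inner B X p + inner C X p)%E.
  rewrite /inner; under eq_integral do rewrite kU.
  rewrite ge0_integralD//.
  - by apply: measurableT_comp; [exact: measurable_kernel|exact: pair1_measurable].
  - by apply: measurableT_comp; [exact: measurable_kernel|exact: pair1_measurable].
have sU s : slice (B `|` C) X s = (slice B X s + slice C X s)%E.
  rewrite /slice; under eq_integral do rewrite iU.
  rewrite ge0_integralD//.
  - by apply: measurableT_comp; [exact: measurable_inner|exact: pair1_measurable].
  - by apply: measurableT_comp; [exact: measurable_inner|exact: pair1_measurable].
rewrite (noise_covE (B `|` C)) (noise_covE B) (noise_covE C).
under eq_integral do rewrite sU.
rewrite ge0_integralD//.
- by apply: measurable_funTS; exact: measurable_slice.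
- by apply: measurable_funTS; exact: measurable_slice.
Qed.

Let integral_cst_itv (a b m : R) : 0 <= m -> a <= b ->
  (\int[mu]_y (m * \1_(`[a, b]%classic : set R) y)%:E = (m * (b - a))%:E)%E.
Proof.
move=> m0 ab; under eq_integral do rewrite EFinM.
rewrite ge0_integralZl//.
  rewrite integral_indic//= setIT lebesgue_measure_itv/= lte_fin.
  case: ifPn => [_|]; first by rewrite -EFinB -EFinM.
  by rewrite -leNgt => ba; rewrite (@le_anti _ _ a b) ?ab// subrr mulr0 mule0.
by apply/measurable_EFinP; exact: measurable_indic.
Qed.

(** The base point [c s] moves with time, because regions bounded by characteristics are slanted. *)
Lemma noise_cov_le A B (s0 s1 l m : R) (c : R -> R) : s0 <= s1 -> 0 <= l -> 0 <= m ->
  (forall s y, A (s, y) -> s0 <= s <= s1 /\ c s <= y <= c s + l) ->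
  (forall s y, A (s, y) ->
    (\int[mu]_y' (`|y - y'| `^ (- beta) * \1_B (s, y'))%:E <= m%:E)%E) ->
  (noise_cov beta A B <= ((s1 - s0) * (l * m))%:E)%E.
Proof.
move=> s01 l0 m0 Ac Bm.
have hi s y : (inner A B (s, y) <= (m * \1_(`[c s, c s + l]%classic : set R) y)%:E)%E.
  have [Asy|nA] := pselect (A (s, y)).
    have [_ cy] := Ac _ _ Asy.
    rewrite indicE mem_set ?mulr1/= ?in_itv//.
    apply: le_trans (Bm _ _ Asy); apply: ge0_le_integral_nomeas => y' _.
      exact: kernel_ge0.
    by rewrite lee_fin /= indicE mem_set// mul1r.
  rewrite /inner integral0_eq ?lee_fin ?mulr_ge0// => y' _.
  by rewrite /kernel/= indicE memNset// !mul0r.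
have hs s : (slice A B s <= ((l * m) * \1_(`[s0, s1]%classic : set R) s)%:E)%E.
  have [ss|nss] := pselect (s0 <= s <= s1).
    rewrite [X in (_ * X)%:E]indicE mem_set ?mulr1/= ?in_itv//.
    apply: (@le_trans _ _ (\int[mu]_y (m * \1_(`[c s, c s + l]%classic : set R) y)%:E)%E).
      by apply: ge0_le_integral_nomeas => y _.
    by rewrite integral_cst_itv ?lerDl// lee_fin (addrC (c s)) addrK mulrC.
  rewrite /slice integral0_eq ?lee_fin ?mulr_ge0// => y _.
  apply: integral0_eq => y' _; rewrite /kernel /= indicE memNset ?mul0r//.
  by move=> /Ac[].
rewrite noise_covE integral_mkcond.
apply: (@le_trans _ _ (\int[mu]_s ((l * m) * \1_(`[s0, s1]%classic : set R) s)%:E)%E).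
  apply: ge0_le_integral_nomeas => s _; first exact: erestrict_ge0.
  rewrite patchE; case: ifP => // _.
  by rewrite lee_fin !mulr_ge0.
by rewrite integral_cst_itv ?mulr_ge0// lee_fin mulrC.
Qed.

(** Dyadic shells around [y]: outside radius [e k.+1] the kernel is at most the power [- beta] of
    that radius, so the shells contribute a geometric series of ratio [r], which is below 1 because
    [beta < 1]. *)
Lemma riesz_kernel_bound : 0 < beta < 1 -> exists2 K : R, 0 < K & forall (y l : R), 0 < l ->
  (\int[mu]_y' (`|y - y'| `^ (- beta) * \1_(`[y - l, y + l]%classic : set R) y')%:E
    <= (K * l `^ (1 - beta))%:E)%E.
Proof.
move=> /andP[b0 b1]; pose r : R := 2 `^ (- (1 - beta)).
have r0 : 0 < r by exact: powR_gt0.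
have r1 : r < 1.
  rewrite /r powRN invf_lt1 ?powR_gt0//.
  have {1}-> : 1 = 1 `^ (1 - beta) :> R by rewrite powR1.
  by rewrite gt0_ltr_powR ?subr_gt0 ?nnegrE// ltr1n.
exists (4 * r * (1 - r)^-1); first by rewrite !mulr_gt0// invr_gt0 subr_gt0.
move=> y l l0.
pose e (k : nat) : R := l / 2 ^+ k.
have e0 k : 0 < e k by rewrite divr_gt0// exprn_gt0.
pose g (k : nat) y' := (e k.+1 `^ (- beta) * \1_(`[y - e k, y + e k]%classic : set R) y')%:E.
have g0 k y' : (0 <= g k y')%E by rewrite lee_fin mulr_ge0// powR_ge0.
apply: (@le_trans _ _ (\int[mu]_y' \sum_(k <oo) g k y')%E).
  apply: ge0_le_integral_nomeas => y' _; first by rewrite lee_fin mulr_ge0// powR_ge0.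
  rewrite indicE; case: (boolP (_ \in _)) => [/set_mem|_]; last first.
    by rewrite mulr0; apply: nneseries_ge0.
  rewrite /= in_itv/= => /andP[h1 h2]; rewrite mulr1.
  (* On the diagonal the power takes its default value 0. *)
  have [->|yy] := eqVneq y y'.
    rewrite subrr normr0 powR0 ?oppr_eq0 ?gt_eqF//.
    by apply: nneseries_ge0.
  have d0 : 0 < `|y - y'| by rewrite normr_gt0 subr_eq0.
  have dl : `|y - y'| <= l by rewrite ler_norml; apply/andP; split; lra.
  have ex : exists k, e k.+1 < `|y - y'|.
    have : e k @[k --> \oo] --> (0 : R).
      rewrite (_ : e = geometric l 2^-1); last first.
        by apply/funext => k; rewrite /e /geometric/= exprVn.
      by apply: cvg_geometric; rewrite ger0_norm// invf_lt1// ltr1n.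
    move=> /cvgr0_norm_lt /(_ _ d0) [k _ hk]; exists k.
    by have := hk k.+1 (leqnSn k); rewrite /= ger0_norm// ltW.
  (* The least such [k] is the shell containing [y']: minimality bounds the distance by [e k]. *)
  have [k hk kmin] := ex_minnP ex.
  have dk : `|y - y'| <= e k.
    case: k hk kmin => [|k] hk kmin; first by rewrite /e expr0 divr1.
    by rewrite leNgt; apply/negP => /kmin; rewrite ltnn.
  apply: (@le_trans _ _ (g k y')).
    rewrite /g lee_fin indicE mem_set ?mulr1.
      rewrite !powRN lef_pV2 ?posrE ?powR_gt0//.
      by rewrite ge0_ler_powR ?nnegrE ?(ltW b0)// ltW.
    by move: dk; rewrite /= in_itv/= ler_norml => /andP[? ?]; apply/andP; split; lra.
  have -> : g k y' = (\sum_(k <= i < k.+1) g i y')%E by rewrite big_nat1.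
  apply: (@le_trans _ _ (\sum_(0 <= i < k.+1) g i y')%E).
    by rewrite big_nat1 big_nat_recr//= leeDr// sume_ge0.
  exact: (@nneseries_lim_ge _ (fun i => g i y') xpredT 0 k.+1).
rewrite integral_nneseries//; last first.
  by move=> k; apply/measurable_EFinP; apply: measurable_funM.
have E k : (\int[mu]_y' g k y' = (4 * l `^ (1 - beta) * (r * r ^+ k))%:E)%E.
  rewrite integral_cst_itv ?powR_ge0//; last by rewrite lerD2l (@le_trans _ _ 0)// ?oppr_le0 ltW.
  congr EFin.
  have -> : y + e k - (y - e k) = 4 * e k.+1.
    by rewrite /e exprS; field; rewrite expf_neq0.
  rewrite mulrCA -!mulrA; congr (_ * _).
  have -> : e k.+1 `^ (- beta) * e k.+1 = e k.+1 `^ (1 - beta).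
    rewrite -(@mulr_powRB1 _ (e k.+1) (1 - beta)) ?subr_gt0// ?ltW// mulrC.
    by congr (_ * _ `^ _); ring.
  have -> : e k.+1 = l * (2^-1) ^+ k.+1 by rewrite /e exprVn.
  rewrite powRM ?exprn_ge0 ?ltW//; congr (_ * _).
  have rE : (2^-1 : R) `^ (1 - beta) = r.
    by rewrite -(@powR_inv1 _ 2)// -powRrM mulN1r.
  rewrite -exprS; elim: k.+1 => [|n ih]; first by rewrite !expr0 powR1.
  by rewrite !exprS powRM ?exprn_ge0 ?invr_ge0// ih rE.
under eq_eseriesr do rewrite E.
apply: lime_le.
  apply: is_cvg_nneseries => n _ _.
  by rewrite lee_fin !mulr_ge0 ?powR_ge0 ?exprn_ge0// ltW.
apply: nearW => n; rewrite sumEFin lee_fin -mulr_sumr -mulr_sumr.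
rewrite [leRHS](_ : _ = 4 * l `^ (1 - beta) * (r * (1 - r)^-1)); last by ring.
rewrite ler_wpM2l ?mulr_ge0 ?powR_ge0// ler_wpM2l ?(ltW r0)//.
rewrite -[leRHS]mul1r ler_pdivlMr ?subr_gt0// big_mkord.
by rewrite mulrC -opprB mulNr -subrX1 opprB lerBlDr lerDl exprn_ge0// ltW.
Qed.

Lemma noise_cov_self_le : 0 < beta < 1 -> exists2 K : R, 0 < K &
  forall A s0 s1 l (c : R -> R), s0 <= s1 -> 0 < l ->
  (forall s y, A (s, y) -> s0 <= s <= s1 /\ c s <= y <= c s + l) ->
  (noise_cov beta A A <= (K * (s1 - s0) * l `^ (2 - beta))%:E)%E.
Proof.
move=> b01; have [K K0 hK] := riesz_kernel_bound b01; exists K => //.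
move=> A s0 s1 l c s01 l0 Ac; have /andP[b0 b1] := b01.
have -> : K * (s1 - s0) * l `^ (2 - beta) = (s1 - s0) * (l * (K * l `^ (1 - beta))).
  rewrite -(@mulr_powRB1 _ l (2 - beta)) ?ltW// ?subr_gt0; last by lra.
  by rewrite (_ : 2 - beta - 1 = 1 - beta); ring.
apply: (@noise_cov_le A A s0 s1 l _ c) => //; first exact: ltW.
  by rewrite mulr_ge0 ?powR_ge0// ltW.
move=> s y Asy; apply: le_trans (hK y l l0); apply: ge0_le_integral_nomeas => y' _.
  by rewrite lee_fin mulr_ge0// powR_ge0.
rewrite lee_fin ler_wpM2l ?powR_ge0// !indicE.
case: (boolP ((s, y') \in A)) => [/set_mem Asy'|_]; last by rewrite ler0n.
have [_ /andP[? ?]] := Ac _ _ Asy; have [_ /andP[? ?]] := Ac _ _ Asy'.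
by rewrite mem_set//= in_itv/=; apply/andP; split; lra.
Qed.

Lemma noise_cov_gap_le A B s0 s1 l e (c c' : R -> R) : s0 <= s1 -> 0 <= l -> 0 < e ->
  0 < beta -> (forall s y, A (s, y) -> s0 <= s <= s1 /\ c s <= y <= c s + l) ->
  (forall s y, B (s, y) -> c' s <= y <= c' s + l) ->
  (forall s y y', A (s, y) -> B (s, y') -> e <= `|y - y'|) ->
  (noise_cov beta A B <= ((s1 - s0) * (l * (e `^ (- beta) * l)))%:E)%E.
Proof.
move=> s01 l0 e0 b0 Ac Bc ABe; apply: (@noise_cov_le A B s0 s1 l _ c) => //.
  by rewrite mulr_ge0// powR_ge0.
move=> s y Asy.
apply: (@le_trans _ _ (\int[mu]_y' (e `^ (- beta) * \1_(`[c' s, c' s + l]%classic : set R) y')%:E)%E).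
  apply: ge0_le_integral_nomeas => y' _.
    by rewrite lee_fin mulr_ge0// powR_ge0.
  rewrite lee_fin !indicE.
  case: (boolP ((s, y') \in B)) => [/set_mem Bsy'|_]; last first.
    by rewrite mulr0 mulr_ge0 ?powR_ge0.
  rewrite mulr1 mem_set/= ?in_itv ?Bc//= mulr1.
  have ee := ABe _ _ _ Asy Bsy'.
  rewrite !powRN lef_pV2 ?posrE ?powR_gt0 ?(lt_le_trans e0 ee)//.
  by rewrite ge0_ler_powR ?nnegrE// ltW.
by rewrite integral_cst_itv ?powR_ge0 ?lerDl// lee_fin (addrC (c' s)) addrK.
Qed.

(** Inside an interval of length [l] the kernel is at least the power [- beta] of [l], and each of
    the two space integrals contributes a factor [l]. *)
Lemma noise_cov_self_ge A s0 s1 l (c : R -> R) : 0 <= s0 <= s1 -> 0 < l -> 0 < beta ->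
  beta < 2 ->
  (forall s y, s0 <= s < s1 -> c s < y <= c s + l -> A (s, y)) ->
  (((s1 - s0) * l `^ (2 - beta))%:E <= noise_cov beta A A)%E.
Proof.
move=> /andP[s0_ge0 s01] l0 b0 b2 Ac.
pose I s : set TR := `]c s, c s + l]%classic.
have muI s : mu (I s) = l%:E.
  by rewrite lebesgue_measure_itv/= lte_fin ltrDl l0 -EFinB (addrC (c s)) addrK.
have indE (D : set TR) (mD : measurable D) (m : R) : 0 <= m ->
    (\int[mu]_y (m * \1_D y)%:E = m%:E * mu D)%E.
  move=> m0; under eq_integral do rewrite EFinM.
  rewrite ge0_integralZl//; first by rewrite integral_indic// setIT.
  by apply/measurable_EFinP; exact: measurable_indic.
have hi s y : s0 <= s < s1 -> I s y -> ((l `^ (- beta) * l)%:E <= inner A A (s, y))%E.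
  move=> ss Iy.
  (* The point [y] is removed: the kernel is 0 there by convention, and a point has measure 0. *)
  have mD : measurable (I s `\ y).
    by apply: measurableD; [exact: measurable_itv|exact: measurable_set1].
  have lD : (l%:E <= mu (I s `\ y))%E.
    rewrite -(muI s).
    have : (mu (I s) <= mu ((I s `\ y) `|` [set y]))%E.
      apply: le_measure => [||z Iz]; rewrite ?inE.
      - exact: measurable_itv.
      - exact: measurableU mD (measurable_set1 y).
      - by have [->|zy] := eqVneq z y; [right|left; split => //; exact/eqP].
    move=> h; apply: (le_trans h); apply: (le_trans (measureU2 _ _ _)) => //.
    have m0 : (mu [set y] = 0)%E := lebesgue_measure_set1 y.
    by rewrite [X in (_ + X <= _)%E]m0 adde0.
  apply: (@le_trans _ _ (\int[mu]_y' (l `^ (- beta) * \1_(I s `\ y) y')%:E)%E).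
    by rewrite indE ?powR_ge0// EFinM lee_wpmul2l// lee_fin powR_ge0.
  apply: ge0_le_integral_nomeas => y' _; first by rewrite lee_fin mulr_ge0// powR_ge0.
  rewrite /kernel lee_fin /= [X in _ * X <= _]indicE.
  case: (boolP (y' \in _)) => [/set_mem[Iy' /eqP/negP yy]|_]; last first.
    by rewrite mulr0 !mulr_ge0// powR_ge0.
  move: Iy Iy'; rewrite /I/= !in_itv/= => Iy Iy'.
  rewrite !indicE !mem_set ?mul1r ?mulr1; [|exact: Ac|exact: Ac].
  have d0 : 0 < `|y - y'| by rewrite normr_gt0 subr_eq0 eq_sym; exact/negP.
  rewrite !powRN lef_pV2 ?posrE ?powR_gt0//.
  rewrite ge0_ler_powR ?nnegrE ?(ltW b0) ?(ltW l0)//.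
  by move/andP: Iy => [? ?]; move/andP: Iy' => [? ?]; rewrite ler_norml; apply/andP; split; lra.
have hs s : s0 <= s < s1 -> ((l `^ (2 - beta))%:E <= slice A A s)%E.
  move=> ss; have -> : l `^ (2 - beta) = (l `^ (- beta) * l) * l.
    rewrite (_ : 2 - beta = - beta + 1 + 1); last by ring.
    by rewrite !powRD ?powRr1 ?ltW// (gt_eqF l0) implybT.
  apply: (@le_trans _ _ (\int[mu]_y ((l `^ (- beta) * l) * \1_(I s) y)%:E)%E).
    rewrite indE; last 2 first.
      exact: measurable_itv.
      by rewrite mulr_ge0 ?powR_ge0// ltW.
    by rewrite muI.
  apply: ge0_le_integral_nomeas => y _.
    by rewrite lee_fin !mulr_ge0 ?powR_ge0// ltW.
  rewrite [X in (_ * X)%:E]indicE; case: (boolP (y \in _)) => [/set_mem Iy|_].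
    by rewrite mulr1; exact: hi.
  by rewrite mulr0.
rewrite noise_covE.
apply: (@le_trans _ _ (\int[mu]_s (l `^ (2 - beta) * \1_(`[s0, s1[%classic : set TR) s)%:E)%E).
  rewrite (indE _ (measurable_itv _)) ?powR_ge0//.
  rewrite mulrC EFinM lebesgue_measure_itv/= lte_fin.
  move: s01; rewrite le_eqVlt => /predU1P[->|->]; last by rewrite -EFinB.
  by rewrite ltxx subrr !mule0.
rewrite [leRHS]integral_mkcond; apply: ge0_le_integral_nomeas => s _.
  by rewrite lee_fin !mulr_ge0 ?powR_ge0.
rewrite [X in (_ * X)%:E]indicE; case: (boolP (s \in _)) => [/set_mem|_].
  rewrite /= in_itv/= mulr1 => ss; rewrite patchE ifT; first exact: hs.
  by rewrite inE/= in_itv/= andbT (le_trans s0_ge0)//; case/andP: ss.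
by rewrite mulr0; apply: erestrict_ge0.
Qed.

End covariance.

(** * Additivity of the noise *)

Section additivity.
Context (R : realType) (d : measure_display) (Omega : measurableType d)
  (P : probability Omega R) (beta : R) (W : set (R * R) -> {RV P >-> R}).
Hypothesis W_noise : colored_noise beta W.

Let integrable_noise2 A B : noise_index A -> noise_index B ->
  P.-integrable setT (EFin \o (fun w => W A w * W B w)).
Proof.
by move=> nA nB; apply: (integrable_mul_linear_comb W_noise (@subset_refl _ (@noise_index R)));
  exact: linear_comb1.
Qed.

Lemma noise_cov_fin_num A B : noise_index A -> noise_index B ->
  noise_cov beta A B \is a fin_num.
Proof.
move=> nA nB; have [_ _ /(_ A B nA nB) <-] := W_noise; rewrite unlock.
exact/integrable_fin_num/integrable_noise2.
Qed.

(** The defect [W A - W B - W C] is orthogonal to every noise variable, by additivity of the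
    covariance in its first argument. In particular it is orthogonal to itself, so its variance is
    0. *)
Lemma noise_additive A B C : noise_index A -> noise_index B -> noise_index C ->
  A = B `|` C -> B `&` C = set0 -> {ae P, forall w, W A w = W B w + W C w}.
Proof.
move=> nA nB nC ABC BC0.
pose f w := W A w + -1 * (W B w + W C w).
have Df : linear_comb W (@noise_index R) f.
  apply: linear_combD; first exact: linear_comb1.
  by apply: linear_combZ; apply: linear_combD; exact: linear_comb1.
have orth X : noise_index X -> \int[P]_w (f w * W X w) = 0.
  move=> nX.
  have -> : (fun w => f w * W X w) = (fun w => W A w * W X w +
      -1 * (W B w * W X w + W C w * W X w)).
    by apply/funext => w; rewrite /f; ring.
  have i1 := integrable_noise2 nA nX.
  have i2 := integrable_noise2 nB nX.
  have i3 := integrable_noise2 nC nX.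
  rewrite RintegralD//; last by apply: integrable_mulrl => //; exact: integrable_addr.
  rewrite RintegralZl//; last exact: integrable_addr.
  rewrite RintegralD// !(cov_noise W_noise)//.
  have [[mB _] _] := nB; have [[mC _] _] := nC; have [[mX _] _] := nX.
  rewrite (noise_covDl beta mB mC mX ABC BC0) fineD ?noise_cov_fin_num//.
  by rewrite mulN1r subrr.
have f2 : \int[P]_w (f w ^+ 2) = 0.
  have -> : (fun w => f w ^+ 2) = (fun w => f w * W A w +
      -1 * (f w * W B w + f w * W C w)).
    by apply/funext => w; rewrite /f; ring.
  have i X : noise_index X -> P.-integrable setT (EFin \o (fun w => f w * W X w)).
    move=> nX; apply: (integrable_mul_linear_comb W_noise (@subset_refl _ (@noise_index R))) => //.
    exact: linear_comb1.
  rewrite RintegralD//; [|exact: i|]; last first.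
    by apply: integrable_mulrl => //; apply: integrable_addr => //; exact: i.
  rewrite RintegralZl//; last by apply: integrable_addr => //; exact: i.
  have iB := i _ nB; have iC := i _ nC.
  by rewrite RintegralD// !orth// addr0 mulr0 addr0.
have if2 := integrable_sqr_linear_comb W_noise (@subset_refl _ _) Df.
have if0 : (\int[P]_w `|(f w ^+ 2)%:E| = 0)%E.
  rewrite -[RHS]/(0%:E) -f2 fineK; last exact: integrable_fin_num.
  by apply: eq_integral => w _; rewrite /= ger0_norm ?sqr_ge0.
have := (ae_eq_integral_abs P measurableT (measurable_int _ if2)).1 if0.
apply: filterS => w /(_ I) [] h; move/eqP: h.
by rewrite sqrf_eq0 /f mulN1r subr_eq0 => /eqP.
Qed.

End additivity.

(** * Regions in characteristic coordinates *)

Lemma measurable_norm_gt d (T : measurableType d) (R : realType) (f : T -> R) (a : R) :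
  measurable_fun setT f -> measurable [set w | a < `|f w|].
Proof.
move=> mf; have mabs : measurable_fun setT (fun w => `|f w|) by exact: measurableT_comp.
rewrite [X in measurable X](_ : _ = (fun w => `|f w|) @^-1` `]a, +oo[%classic).
  by rewrite -[X in measurable X]setTI; exact: mabs.
by apply/seteqP; split => w /=; rewrite in_itv/= andbT.
Qed.

Lemma measurable_norm_le d (T : measurableType d) (R : realType) (f : T -> R) (a : R) :
  measurable_fun setT f -> measurable [set w | `|f w| <= a].
Proof.
move=> mf; rewrite [X in measurable X](_ : _ = ~` [set w | a < `|f w|]).
  by apply: measurableC; exact: measurable_norm_gt.
by apply/seteqP; split => w /=; rewrite leNgt => /negP.
Qed.

Section regions.
Context (R : realType).
Implicit Types q p : R.

(* In the characteristic coordinates [s - y] and [s + y] the light cones of the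
   half-plane are quadrants. *)
Definition cone q p : set (R * R) :=
  [set z | [/\ 0 <= z.1, z.1 - z.2 <= q & z.1 + z.2 <= p]].

Definition band q p0 p1 : set (R * R) :=
  [set z | [/\ 0 <= z.1, z.1 - z.2 <= q & p0 < z.1 + z.2 <= p1]].

Definition box q0 q1 p0 p1 : set (R * R) :=
  [set z | [/\ 0 <= z.1, q0 < z.1 - z.2 <= q1 & p0 < z.1 + z.2 <= p1]].

Let measurable_sub : measurable_fun setT (fun z : R * R => z.1 - z.2).
Proof. by apply: measurable_funB; [exact: measurable_fst|exact: measurable_snd]. Qed.

Let measurable_add : measurable_fun setT (fun z : R * R => z.1 + z.2).
Proof. by apply: measurable_funD; [exact: measurable_fst|exact: measurable_snd]. Qed.

Let measurable_pre (f : R * R -> R) (i : interval R) : measurable_fun setT f ->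
  measurable (f @^-1` [set` i]).
Proof. by move=> mf; rewrite -[X in measurable X]setTI; exact: mf. Qed.

Lemma measurable_cone q p : measurable (cone q p).
Proof.
have -> : cone q p = (fst @^-1` [set` `[0, +oo[]) `&`
    (((fun z => z.1 - z.2) @^-1` [set` `]-oo, q]]) `&`
     ((fun z => z.1 + z.2) @^-1` [set` `]-oo, p]])).
  apply/seteqP; split => z; rewrite /cone/= !in_itv/= ?andbT; first by case.
  by case=> ? [].
apply: measurableI; first by apply: measurable_pre; exact: measurable_fst.
by apply: measurableI; exact: measurable_pre.
Qed.

Lemma measurable_band q p0 p1 : measurable (band q p0 p1).
Proof.
have -> : band q p0 p1 = (fst @^-1` [set` `[0, +oo[]) `&`
    (((fun z => z.1 - z.2) @^-1` [set` `]-oo, q]]) `&`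
     ((fun z => z.1 + z.2) @^-1` [set` `]p0, p1]])).
  apply/seteqP; split => z; rewrite /band/= !in_itv/= ?andbT; first by case.
  by case=> ? [].
apply: measurableI; first by apply: measurable_pre; exact: measurable_fst.
by apply: measurableI; exact: measurable_pre.
Qed.

Lemma measurable_box q0 q1 p0 p1 : measurable (box q0 q1 p0 p1).
Proof.
have -> : box q0 q1 p0 p1 = (fst @^-1` [set` `[0, +oo[]) `&`
    (((fun z => z.1 - z.2) @^-1` [set` `]q0, q1]]) `&`
     ((fun z => z.1 + z.2) @^-1` [set` `]p0, p1]])).
  apply/seteqP; split => z; rewrite /box/= !in_itv/= ?andbT; first by case.
  by case=> ? [].
apply: measurableI; first by apply: measurable_pre; exact: measurable_fst.
by apply: measurableI; exact: measurable_pre.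
Qed.

Lemma noise_index_sub_cone (A : set (R * R)) q p : measurable A -> A `<=` cone q p ->
  noise_index A.
Proof.
move=> mA Ac; split; last by move=> z /Ac[].
split=> //; exists (`|q| + `|p|); split; first exact: num_real.
move=> M hM z /Ac [z0 h1 h2].
have := ler_norm q; have := ler_norm p; have := normr_ge0 p; have := normr_ge0 q.
move=> ? ? ? ?; rewrite /= prod_normE ge_max; apply/andP; split.
  by rewrite ger0_norm//; lra.
by rewrite ler_norml; apply/andP; split; lra.
Qed.

Lemma noise_index_cone q p : noise_index (cone q p).
Proof. by apply: noise_index_sub_cone (measurable_cone q p) (@subset_refl _ _). Qed.

Lemma band_sub_cone q p0 p1 : band q p0 p1 `<=` cone q p1.
Proof. by move=> z [z0 h1 /andP[_ h2]]. Qed.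

Lemma box_sub_cone q0 q1 p0 p1 : box q0 q1 p0 p1 `<=` cone q1 p1.
Proof. by move=> z [z0 /andP[_ h1] /andP[_ h2]]. Qed.

Lemma noise_index_band q p0 p1 : noise_index (band q p0 p1).
Proof. exact: noise_index_sub_cone (measurable_band _ _ _) (@band_sub_cone q p0 p1). Qed.

Lemma noise_index_box q0 q1 p0 p1 : noise_index (box q0 q1 p0 p1).
Proof. exact: noise_index_sub_cone (measurable_box _ _ _ _) (@box_sub_cone q0 q1 p0 p1). Qed.

Notation r2 := (Num.sqrt 2 : R).

Lemma sqrt2_gt0 : 0 < r2. Proof. by rewrite sqrtr_gt0. Qed.

Lemma sqrt2_sqr : r2 * r2 = 2. Proof. by rewrite -expr2 sqr_sqrtr. Qed.

(** Turns a division by the square root into a form where [r2 * x] is an atom for [lra]. *)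
Lemma half_sqrt2 (x : R) : x / r2 = r2 * x / 2.
Proof.
have := sqrt2_gt0; have := sqrt2_sqr => e /gt_eqF/negbT h.
apply: (mulIf h); rewrite divfK//.
have -> : r2 * x / 2 * r2 = x * (r2 * r2) / 2 by ring.
by rewrite e; field.
Qed.

Lemma light_cone_rotate (tau lam : R) :
  light_cone ((tau + lam) / r2) ((- tau + lam) / r2) = cone (r2 * tau) (r2 * lam).
Proof.
rewrite !half_sqrt2; apply/seteqP; split => -[s y] /=.
  by move=> [/andP[s0 _]]; rewrite /cone/= ler_norml => /andP[? ?]; split => //; lra.
move=> [/= s0 h1 h2]; rewrite /light_cone/= s0/= ler_norml.
by split; [lra|apply/andP; split; lra].
Qed.

End regions.
Notation r2 := (Num.sqrt 2).

(** * Increments of the rotated solution *)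

Section increments.
Context (R : realType) (d : measure_display) (Omega : measurableType d)
  (P : probability Omega R) (beta tau0 : R) (W : set (R * R) -> {RV P >-> R})
  (u : R -> R -> {RV P >-> R}).
Hypothesis beta01 : 0 < beta < 1.
Hypothesis tau0_gt0 : 0 < tau0.
Hypothesis W_noise : colored_noise beta W.
Hypothesis u_sol : continuous_solution W u.

Lemma rotate_cone tau lam : 0 <= tau + lam ->
  {ae P, forall w, rotate u tau lam w = 2^-1 * W (cone (r2 * tau) (r2 * lam)) w}.
Proof.
move=> tl; have [+ _] := u_sol.
move=> /(_ ((tau + lam) / r2) ((- tau + lam) / r2)).
rewrite light_cone_rotate; apply.
by rewrite divr_ge0// sqrtr_ge0.
Qed.

Lemma cone_band q p0 p1 : p0 <= p1 ->
  {ae P, forall w, W (cone q p1) w = W (cone q p0) w + W (band q p0 p1) w}.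
Proof.
move=> p01; apply: (noise_additive W_noise).
- exact: noise_index_cone.
- exact: noise_index_cone.
- exact: noise_index_band.
- apply/seteqP; split => z.
    move=> [z0 h1 h2]; have [h|h] := leP (z.1 + z.2) p0; [left|right]; split => //.
    by rewrite h h2.
  by move=> [[z0 h1 h2]|[z0 h1 /andP[h2 h3]]]; split => //; exact: le_trans h2 p01.
- apply/seteqP; split => z // [[_ _ h1] [_ _ /andP[h2 _]]].
  by move: (lt_le_trans h2 h1); rewrite ltxx.
Qed.

Lemma band_box q0 q1 p0 p1 : q0 <= q1 ->
  {ae P, forall w, W (band q1 p0 p1) w = W (band q0 p0 p1) w + W (box q0 q1 p0 p1) w}.
Proof.
move=> q01; apply: (noise_additive W_noise).
- exact: noise_index_band.
- exact: noise_index_band.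
- exact: noise_index_box.
- apply/seteqP; split => z.
    move=> [z0 h1 h2]; have [h|h] := leP (z.1 - z.2) q0; [left|right]; split => //.
    by rewrite h h1.
  by move=> [[z0 h1 h2]|[z0 /andP[h1 h2] h3]]; split => //; exact: le_trans h1 q01.
- apply/seteqP; split => z // [[_ h1 _] [_ /andP[h2 _] _]].
  by move: (lt_le_trans h2 h1); rewrite ltxx.
Qed.

Definition low x h := band (r2 * tau0) (r2 * x) (r2 * (x + h)) `&` strip tau0.
Definition high x h := band (r2 * tau0) (r2 * x) (r2 * (x + h)) `\` strip tau0.

Lemma noise_index_low x h : noise_index (low x h).
Proof.
apply: noise_index_sub_cone; first exact: measurableI (measurable_band _ _ _) (measurable_strip _).
by move=> z [/band_sub_cone + _]; exact.
Qed.

Lemma noise_index_high x h : noise_index (high x h).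
Proof.
apply: noise_index_sub_cone; first exact: measurableD (measurable_band _ _ _) (measurable_strip _).
by move=> z [/band_sub_cone + _]; exact.
Qed.

Lemma rotate_increment x h : 0 <= x -> 0 <= h ->
  {ae P, forall w, rotate u tau0 (x + h) w - rotate u tau0 x w =
    2^-1 * (W (low x h) w + W (high x h) w)}.
Proof.
move=> x0 h0.
have h1 : {ae P, forall w, W (band (r2 * tau0) (r2 * x) (r2 * (x + h))) w =
    W (low x h) w + W (high x h) w}.
  apply: (noise_additive W_noise).
  - exact: noise_index_band.
  - exact: noise_index_low.
  - exact: noise_index_high.
  - by rewrite /low /high setUIDK.
  - by apply/seteqP; split => z // [[_ ?] [_ ?]].
have h2 := @rotate_cone tau0 x (addr_ge0 (ltW tau0_gt0) x0).
have h3 := @rotate_cone tau0 (x + h) (addr_ge0 (ltW tau0_gt0) (addr_ge0 x0 h0)).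
have h4 : r2 * x <= r2 * (x + h) by rewrite ler_wpM2l ?sqrtr_ge0// lerDl.
have h5 := cone_band (r2 * tau0) h4.
near=> w; have -> : rotate u tau0 (x + h) w = 2^-1 * W (cone (r2 * tau0) (r2 * (x + h))) w.
  by near: w.
have -> : rotate u tau0 x w = 2^-1 * W (cone (r2 * tau0) (r2 * x)) w by near: w.
have -> : W (cone (r2 * tau0) (r2 * (x + h))) w = W (cone (r2 * tau0) (r2 * x)) w +
    W (band (r2 * tau0) (r2 * x) (r2 * (x + h))) w by near: w.
have -> : W (band (r2 * tau0) (r2 * x) (r2 * (x + h))) w =
    W (low x h) w + W (high x h) w by near: w.
by ring.
Unshelve. all: by end_near. Qed.

Lemma rotate_box tau tau' lam lam' : 0 <= tau -> 0 <= lam ->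
  tau <= tau' -> lam <= lam' ->
  {ae P, forall w, rotate u tau' lam' w - rotate u tau lam' w -
     (rotate u tau' lam w - rotate u tau lam w) =
     2^-1 * W (box (r2 * tau) (r2 * tau') (r2 * lam) (r2 * lam')) w}.
Proof.
move=> t0 l0 tt ll.
have r0 := sqrtr_ge0 (2 : R).
have k1 := @rotate_cone tau' lam' (addr_ge0 (le_trans t0 tt) (le_trans l0 ll)).
have k2 := @rotate_cone tau lam' (addr_ge0 t0 (le_trans l0 ll)).
have k3 := @rotate_cone tau' lam (addr_ge0 (le_trans t0 tt) l0).
have k4 := @rotate_cone tau lam (addr_ge0 t0 l0).
have k5 := cone_band (r2 * tau') (ler_wpM2l r0 ll).
have k6 := cone_band (r2 * tau) (ler_wpM2l r0 ll).
have k7 := band_box (r2 * lam) (r2 * lam') (ler_wpM2l r0 tt).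
near=> w.
have -> : rotate u tau' lam' w = 2^-1 * W (cone (r2 * tau') (r2 * lam')) w by near: w.
have -> : rotate u tau lam' w = 2^-1 * W (cone (r2 * tau) (r2 * lam')) w by near: w.
have -> : rotate u tau' lam w = 2^-1 * W (cone (r2 * tau') (r2 * lam)) w by near: w.
have -> : rotate u tau lam w = 2^-1 * W (cone (r2 * tau) (r2 * lam)) w by near: w.
have -> : W (cone (r2 * tau') (r2 * lam')) w = W (cone (r2 * tau') (r2 * lam)) w +
  W (band (r2 * tau') (r2 * lam) (r2 * lam')) w by near: w.
have -> : W (cone (r2 * tau) (r2 * lam')) w = W (cone (r2 * tau) (r2 * lam)) w +
  W (band (r2 * tau) (r2 * lam) (r2 * lam')) w by near: w.
have -> : W (band (r2 * tau') (r2 * lam) (r2 * lam')) w =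
  W (band (r2 * tau) (r2 * lam) (r2 * lam')) w +
  W (box (r2 * tau) (r2 * tau') (r2 * lam) (r2 * lam')) w by near: w.
by ring.
Unshelve. all: by end_near. Qed.

Lemma high_time x h z : high x h z -> tau0 / r2 <= z.1.
Proof.
move=> [[z0 _ _] nz]; rewrite leNgt; apply/negP => zt; apply: nz.
by rewrite /strip/= z0 zt.
Qed.

(** Time is half the sum of the two characteristic coordinates. *)
Lemma box_time q0 q1 p0 p1 z : r2 * tau0 <= q0 -> 0 <= p0 -> box q0 q1 p0 p1 z ->
  tau0 / r2 <= z.1.
Proof. by move=> hq p00 [z0 /andP[h1 _] /andP[h2 _]]; rewrite half_sqrt2; lra. Qed.

(** A rectangle in characteristic coordinates meets each time in an interval no longer than its
    shorter side, during a time no longer than its longer side. When [q1 - q0] is the shorter side,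
    its power [1 - beta] is bounded by that of [p1 - p0], which keeps the estimate linear in
    [q1 - q0]. *)
Lemma box_cov_le : exists2 K : R, 0 < K & forall q0 q1 p0 p1, q0 <= q1 -> p0 <= p1 ->
  (noise_cov beta (box q0 q1 p0 p1) (box q0 q1 p0 p1) <=
   (K * (q1 - q0) * (p1 - p0) `^ (2 - beta))%:E)%E.
Proof.
have [K K0 hK] := noise_cov_self_le beta01; exists K => // q0 q1 p0 p1.
have /andP[b0 b1] := beta01.
(* A degenerate box is empty; it is set apart since the section length must be positive. *)
rewrite le_eqVlt => /predU1P[<- p01|q01].
  rewrite subrr mulr0 mul0r noise_cov_time_disjoint// => s y y' [_ /andP[h1 h2]].
  by move: (lt_le_trans h1 h2); rewrite ltxx.
rewrite le_eqVlt => /predU1P[<-|p01].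
  rewrite subrr powR0 ?mulr0; last by rewrite gt_eqF// subr_gt0; lra.
  rewrite noise_cov_time_disjoint// => s y y' [_ _ /andP[h1 h2]].
  by move: (lt_le_trans h1 h2); rewrite ltxx.
have a0 : 0 < q1 - q0 by rewrite subr_gt0.
have c0 : 0 < p1 - p0 by rewrite subr_gt0.
have pw (x : R) : 0 < x -> x `^ (2 - beta) = x * x `^ (1 - beta).
  move=> x0; rewrite -(@mulr_powRB1 _ x (2 - beta)) ?ltW// ?subr_gt0; last by lra.
  by congr (_ * _ `^ _); ring.
have [pq|qp] := leP (p1 - p0) (q1 - q0).
  apply: le_trans (hK _ ((p0 + q0) / 2) ((p1 + q1) / 2) (p1 - p0) (fun s => p0 - s) _ c0 _) _.
  - by rewrite ler_pM2r ?invr_gt0//; lra.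
  - move=> s y [/= s0 /andP[? ?] /andP[? ?]]; split; apply/andP; split; lra.
  - rewrite lee_fin -!mulrA ler_wpM2l ?(ltW K0)// ler_wpM2r ?powR_ge0//.
    lra.
apply: le_trans (hK _ ((p0 + q0) / 2) ((p1 + q1) / 2) (q1 - q0) (fun s => s - q1) _ a0 _) _.
- by rewrite ler_pM2r ?invr_gt0//; lra.
- move=> s y [/= s0 /andP[? ?] /andP[? ?]]; split; apply/andP; split; lra.
- rewrite lee_fin -!mulrA ler_wpM2l ?(ltW K0)// !pw// mulrCA ler_wpM2l ?(ltW a0)//.
  apply: ler_pM.
  + lra.
  + exact: powR_ge0.
  + lra.
  + by rewrite ge0_ler_powR ?nnegrE ?subr_ge0 ?(ltW b1) ?(ltW q01) ?(ltW p01) ?(ltW qp).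
Qed.

Lemma high_cov_le M : exists2 K : R, 0 < K & forall x h, 0 <= x -> 0 < h -> x + h <= M ->
  (noise_cov beta (high x h) (high x h) <= (K * h `^ (2 - beta))%:E)%E.
Proof.
have [K K0 hK] := noise_cov_self_le beta01.
have r0 := sqrt2_gt0 R.
(* Above the strip the band lasts at most [r2 * M / 2]; adding 1 keeps the constant positive even
   for [M = 0]. *)
exists (K * (r2 * `|M| + 1) * r2 `^ (2 - beta)).
  by rewrite !mulr_gt0 ?powR_gt0// ltr_wpDl ?mulr_ge0// ltW.
move=> x h x0 h0 xhM.
have M0 : 0 <= M by lra.
apply: le_trans (hK _ (tau0 / r2) (tau0 / r2 + (r2 * `|M| + 1)) (r2 * h) (fun s => r2 * x - s) _ _ _) _.
- by rewrite lerDl addr_ge0// mulr_ge0// ltW.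
- by rewrite mulr_gt0.
- move=> s y hz; have ht := high_time hz.
  have [[/= s0 h1 /andP[h2 h3]] _] := hz.
  have h4 : r2 * (x + h) <= r2 * `|M| by rewrite ler_wpM2l ?(ltW r0)// ger0_norm.
  have h5 : r2 * (x + h) = r2 * x + r2 * h by rewrite mulrDr.
  move: ht => /= ht; rewrite ht/= half_sqrt2; split.
    by have : 0 <= r2 * `|M| by [rewrite mulr_ge0// ltW]; lra.
  by apply/andP; split; lra.
- rewrite lee_fin addrAC subrr add0r powRM ?(ltW r0) ?(ltW h0)//.
  by rewrite mulrA.
Qed.

(** Before time [tau0 / r2] the constraint on [s - y] is automatic, because [s + y] is nonnegative
    on the band. Each time section is thus a full interval of length [r2 * h]. *)
Lemma low_cov_ge x h : 0 <= x -> 0 < h ->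
  ((tau0 / r2 * (r2 * h) `^ (2 - beta))%:E <= noise_cov beta (low x h) (low x h))%E.
Proof.
move=> x0 h0; have r0 := sqrt2_gt0 R; have /andP[b0 b1] := beta01.
have t0 : 0 < tau0 / r2 by rewrite divr_gt0.
rewrite -[tau0 / r2]subr0.
apply: (@noise_cov_self_ge _ _ _ 0 (tau0 / r2) (r2 * h) (fun s => r2 * x - s)) => //.
- by rewrite lexx ltW.
- by rewrite mulr_gt0.
- by rewrite (lt_trans b1)// ltr1n.
- move=> s y ss yy; split; last by rewrite /strip.
  move: ss yy; rewrite half_sqrt2 => /andP[s0 s1] /andP[y0 y1].
  have : 0 <= r2 * x by rewrite mulr_ge0// ltW.
  have h5 : r2 * (x + h) = r2 * x + r2 * h by rewrite mulrDr.
  by move=> ?; split => //=; [lra|apply/andP; split; lra].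
Qed.

(** At a common time the two sections lie in intervals of length [r2 * h] whose left ends are [r2]
    times the distance of [x] and [x'] apart, so a gap [e] separates them. *)
Lemma low_cov_gap_le x x' h e : 0 <= h -> 0 < e -> r2 * h + e <= r2 * `|x - x'| ->
  (noise_cov beta (low x h) (low x' h) <=
   (tau0 / r2 * ((r2 * h) ^+ 2 * e `^ (- beta)))%:E)%E.
Proof.
move=> h0 e0 xx; have r0 := sqrt2_gt0 R; have /andP[b0 b1] := beta01.
have t0 : 0 < tau0 / r2 by rewrite divr_gt0.
have -> : tau0 / r2 * ((r2 * h) ^+ 2 * e `^ (- beta)) =
  (tau0 / r2 - 0) * ((r2 * h) * (e `^ (- beta) * (r2 * h))) by rewrite subr0; ring.
have hE z : r2 * (z + h) = r2 * z + r2 * h by rewrite mulrDr.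
apply: (@noise_cov_gap_le _ _ _ _ 0 (tau0 / r2) (r2 * h) e
   (fun s => r2 * x - s) (fun s => r2 * x' - s)) => //.
- exact: ltW.
- by rewrite mulr_ge0// ltW.
- move=> s y [[/= s0 _ /andP[? ?]] /andP[/= _ s1]]; have := hE x.
  by rewrite s0 (ltW s1); split => //; apply/andP; split; lra.
- move=> s y [[/= s0 _ /andP[? ?]] _]; have := hE x'.
  by move=> ?; apply/andP; split; lra.
- move=> s y y' [[/= _ _ /andP[? ?]] _] [[/= _ _ /andP[? ?]] _].
  have := hE x; have := hE x' => ? ?; rewrite ler_normr.
  move: xx; have [xx'|xx'] := leP 0 (x - x') => xx.
    rewrite ger0_norm// in xx.
    have : r2 * (x - x') = r2 * x - r2 * x' by rewrite mulrBr.
    by move=> ?; apply/orP; left; lra.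
  rewrite ltr0_norm// in xx.
  have : r2 * - (x - x') = r2 * x' - r2 * x by rewrite mulrN mulrBr opprB.
  by move=> ?; apply/orP; right; lra.
Qed.

Lemma noise_tail A v a : noise_index A -> (noise_cov beta A A <= v%:E)%E -> 0 < v ->
  0 <= a ->
  (P [set w | (a < `|W A w|)%R] <= (2 * expR (- (a ^+ 2 / (v *+ 2))))%:E)%E.
Proof.
move=> nA Av v0 a0.
have mW := measurable_funPT (W A).
have mabs : measurable_fun setT (fun w => `|W A w|) by exact: measurableT_comp.
apply: le_trans (gaussian_tail mW (gaussian_noise W_noise nA) (mean_noise W_noise nA) _ v0 a0).
  apply: le_measure; rewrite ?inE.
  - exact: measurable_norm_gt.
  - have -> : [set w | a <= `|W A w|] = (fun w => `|W A w|) @^-1` `[a, +oo[%classic.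
      by apply/seteqP; split => w /=; rewrite in_itv/= andbT.
    by rewrite -[X in measurable X]setTI; exact: mabs.
  - by move=> w /= /ltW.
under eq_Rintegral do rewrite expr2.
rewrite (cov_noise W_noise)//.
by rewrite -lee_fin fineK ?(noise_cov_fin_num W_noise).
Qed.

End increments.

(** * Chaining and Borel-Cantelli *)

Section lil.
Context (R : realType) (beta : R).

Definition lil_gauge (h : R) := Num.sqrt (h `^ (2 - beta) * ln (ln (1 / h))).

Lemma lil_limsup_pinftyP (f : R -> R) x : lil_limsup beta f x = +oo%E <->
  forall M e : R, 0 < e ->
    exists2 h, 0 < h < e & M < `|f (x + h) - f x| / lil_gauge h.
Proof.
split=> [/ereal_inf_pinfty h M e e0|h].
  have := h (ereal_sup ((fun h => (`|f (x + h) - f x| / lil_gauge h)%:E)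
    @` [set h | 0 < h < e])).
  move=> /(_ _)/= hs.
  have /ereal_sup_gt[_ [t te <-]] : (M%:E < ereal_sup ((fun h =>
      (`|f (x + h) - f x| / lil_gauge h)%:E) @` [set h | (0 < h < e)%R]))%E.
    rewrite hs ?ltry//; exists [set h | 0 < h < e] => //=.
    near=> t => /=; apply/andP; split; first by near: t; exact: nbhs_right_gt.
    by near: t; exact: nbhs_right_lt.
  by rewrite lte_fin => ?; exists t.
apply/ereal_inf_pinfty => _ [V [e /= e0 eV] <-] /=.
apply: eq_infty => M; have [t /andP[t0 te] Mt] := h M e e0.
apply: (@le_trans _ _ (`|f (x + t) - f x| / lil_gauge t)%:E).
  by rewrite lee_fin ltW.
apply: ereal_sup_ubound; exists t => //; apply: eV => //=.
by rewrite sub0r normrN gtr0_norm.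
Unshelve. all: by end_near. Qed.

Lemma lil_limsup_transfer (f g : R -> R) x C e : 0 < e ->
  (forall h, 0 < h < e ->
    `|(g (x + h) - g x) - (f (x + h) - f x)| <= C * lil_gauge h) ->
  lil_limsup beta f x = +oo%E -> lil_limsup beta g x = +oo%E.
Proof.
move=> e0 hfg /lil_limsup_pinftyP hf; apply/lil_limsup_pinftyP => M e' e'0.
have ee' : 0 < Num.min e e' by rewrite lt_min e0.
(* The maximum with 0 forces the quotient to be positive, hence the gauge to be nonzero, as division
   by zero gives 0. *)
have [h /andP[h0 +] Mh] := hf (Num.max 0 (M + C)) _ ee'.
rewrite lt_min => /andP[he he']; exists h; rewrite ?h0//.
move: Mh; rewrite gt_max => /andP[Mh1 Mh2].
have g0 : 0 < lil_gauge h.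
  rewrite lt_neqAle sqrtr_ge0 andbT; apply/eqP => g0.
  by move: Mh1; rewrite -g0 invr0 mulr0 ltxx.
have := hfg h; rewrite h0 he => /(_ isT) hC.
move: Mh2; rewrite !ltr_pdivlMr// mulrDl => Mh2.
have : `|f (x + h) - f x| <= `|g (x + h) - g x| +
    `|g (x + h) - g x - (f (x + h) - f x)|.
  by rewrite -{1}[f (x + h) - f x](subKr (g (x + h) - g x)) (le_trans (ler_normB _ _)).
by move=> ?; lra.
Qed.

End lil.

Section chaining.
Context (R : realType).

Let dyadic J (x : R) : R := (Num.truncn (x * 2 ^+ J))%:R / 2 ^+ J.

Let expr2_gt0 J : 0 < 2 ^+ J :> R. Proof. exact: exprn_gt0. Qed.

Let truncn_dyadic J (x : R) : 0 <= x < 1 ->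
  (Num.truncn (x * 2 ^+ J) < 2 ^ J)%N /\
  (Num.truncn (x * 2 ^+ J.+1) = (Num.truncn (x * 2 ^+ J)).*2 \/
   Num.truncn (x * 2 ^+ J.+1) = (Num.truncn (x * 2 ^+ J)).*2.+1).
Proof.
move=> /andP[x0 x1].
have xJ0 : 0 <= x * 2 ^+ J by rewrite mulr_ge0// ltW.
split.
  by rewrite truncn_lt_nat// natrX -[ltRHS]mul1r ltr_pM2r.
set k := Num.truncn (x * 2 ^+ J).
have /andP[] := truncn_itv xJ0; rewrite -/k => k1 k2.
have e : x * 2 ^+ J.+1 = 2 * (x * 2 ^+ J) by rewrite exprS; ring.
have [kx|kx] := leP ((2 * k).+1%:R) (x * 2 ^+ J.+1).
  right; apply: truncn_def; rewrite -addnn; apply/andP; split.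
    by move: kx; rewrite mul2n -addnn.
  have -> : (k + k).+2%:R = k%:R + k%:R + 2 :> R by rewrite -addn2 !natrD.
  by have : k.+1%:R = k%:R + 1 :> R by [rewrite -addn1 natrD]; rewrite e; lra.
left; apply: truncn_def; rewrite -addnn; apply/andP; split; last first.
  by move: kx; rewrite mul2n -addnn.
by rewrite e natrD; lra.
Qed.

Let dyadicS J (x : R) : dyadic J x = (Num.truncn (x * 2 ^+ J)).*2%:R / 2 ^+ J.+1.
Proof.
have := expr2_gt0 J => /gt_eqF/negbT J0.
by rewrite /dyadic -muln2 natrM exprS; field.
Qed.

Lemma cvg_dyadic (x : R) : 0 <= x -> dyadic J x @[J --> \oo] --> x.
Proof.
move=> x0.
have h J : x - 2^-1 ^+ J <= dyadic J x <= x.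
  have xJ0 : 0 <= x * 2 ^+ J by rewrite mulr_ge0// ltW.
  have /andP[k1 k2] := truncn_itv xJ0.
  rewrite /dyadic ler_pdivrMr// k1 andbT ler_pdivlMr// mulrBl exprVn.
  rewrite mulVf ?gt_eqF//.
  by move: k2; rewrite mulrSr; lra.
have half : (2^-1 : R) ^+ J @[J --> \oo] --> (0 : R).
  by apply: cvg_expr; rewrite ger0_norm// invf_lt1// ltr1n.
apply: (@squeeze_cvgr _ _ _ _ (fun J => x - 2^-1 ^+ J) (cst x)).
- by apply: nearW => J; exact: h.
- by rewrite -[X in _ --> X]subr0; apply: cvgB => //; exact: cvg_cst.
- exact: cvg_cst.
Qed.

(* The dyadic approximations of [(x, y)] of two consecutive levels differ by at
   most one grid step in each direction. *)
Lemma dyadic_chaining (G : R -> R -> R) (t : nat -> R) (S x y : R) :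
  (forall J (i l : nat), (i < 2 ^ J)%N -> (l <= 2 ^ J)%N ->
    `|G (i.+1%:R / 2 ^+ J) (l%:R / 2 ^+ J) - G (i%:R / 2 ^+ J) (l%:R / 2 ^+ J)| <= t J) ->
  (forall J (i l : nat), (i <= 2 ^ J)%N -> (l < 2 ^ J)%N ->
    `|G (i%:R / 2 ^+ J) (l.+1%:R / 2 ^+ J) - G (i%:R / 2 ^+ J) (l%:R / 2 ^+ J)| <= t J) ->
  G 0 0 = 0 -> (forall J, \sum_(i < J) (t i.+1 *+ 2) <= S) -> 0 <= x < 1 -> 0 <= y < 1 ->
  (forall f g : nat -> R, f @ \oo --> x -> g @ \oo --> y ->
     (forall n, 0 <= f n) -> (forall n, 0 <= g n) ->
     G (f n) (g n) @[n --> \oo] --> G x y) ->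
  `|G x y| <= S.
Proof.
move=> t1 t2 G0 hS hx hy cG.
have t0 J : 0 <= t J by apply: le_trans (t1 J 0%N 0%N _ _) => //; rewrite expn_gt0.
have /andP[x0 _] := hx; have /andP[y0 _] := hy.
have dy0 z : 0 <= z < 1 -> dyadic 0 z = 0.
  move=> hz; have [+ _] := truncn_dyadic 0 hz.
  by rewrite /dyadic expn0 ltnS leqn0 => /eqP ->; rewrite mul0r.
have step J : `|G (dyadic J.+1 x) (dyadic J.+1 y) - G (dyadic J x) (dyadic J y)| <= t J.+1 *+ 2.
  have [hx1 hx2] := truncn_dyadic J hx; have [hy1 hy2] := truncn_dyadic J hy.
  rewrite (dyadicS J x) (dyadicS J y).
  set i := Num.truncn (x * 2 ^+ J); set l := Num.truncn (y * 2 ^+ J).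
  have i2 : (i.*2.+1 < 2 ^ J.+1)%N by rewrite expnS mul2n -doubleS leq_double.
  have l2 : (l.*2.+1 < 2 ^ J.+1)%N by rewrite expnS mul2n -doubleS leq_double.
  rewrite /dyadic.
  set a := Num.truncn _; set b := Num.truncn (y * 2 ^+ J.+1).
  set u := i.*2%:R / _; set v := l.*2%:R / _.
  have lb : (b <= 2 ^ J.+1)%N.
    by rewrite /b; case: hy2 => ->; rewrite ltnW// ltnW.
  have -> : G (a%:R / 2 ^+ J.+1) (b%:R / 2 ^+ J.+1) - G u v =
    (G (a%:R / 2 ^+ J.+1) (b%:R / 2 ^+ J.+1) - G u (b%:R / 2 ^+ J.+1)) +
    (G u (b%:R / 2 ^+ J.+1) - G u v) by ring.
  apply: le_trans (ler_normD _ _) _; rewrite mulr2n; apply: lerD.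
    rewrite /a; case: hx2 => ->; first by rewrite subrr normr0.
    by apply: t1 => //; rewrite ltnW.
  rewrite /b; case: hy2 => ->; first by rewrite subrr normr0.
  by apply: t2; rewrite ltnW// ltnW.
have bound J : `|G (dyadic J x) (dyadic J y)| <= \sum_(i < J) (t i.+1 *+ 2).
  elim: J => [|J ih]; first by rewrite !dy0// G0 normr0 big_ord0.
  rewrite big_ord_recr /= -[X in `|X|](subrK (G (dyadic J x) (dyadic J y))) addrC.
  by apply: le_trans (ler_normD _ _) _; exact: lerD.
have /cvg_norm cv : G (dyadic J x) (dyadic J y) @[J --> \oo] --> G x y.
  by apply: cG => //; try (by apply: cvg_dyadic); move=> n; rewrite divr_ge0// ltW.
rewrite -(cvg_lim _ cv)//; apply: limr_le; first by apply/cvg_ex; eexists; exact: cv.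
by apply: nearW => J; exact: le_trans (bound J) (hS J).
Qed.

End chaining.

(** * Borel-Cantelli and the noise of selected sets *)

Section selection.
Context (R : realType) (d : measure_display) (Omega : measurableType d)
  (P : probability Omega R).

Let nneseries_le_bound (F : nat -> set Omega) (b : nat -> R) S :
  (forall n, (P (F n) <= (b n)%:E)%E) -> (forall N, \sum_(i < N) b i <= S) ->
  (\sum_(n <oo) P (F n) <= S%:E)%E.
Proof.
move=> Fb bS; apply: lime_le; first exact: is_cvg_nneseries.
apply: nearW => N; rewrite big_mkord; apply: (@le_trans _ _ (\sum_(i < N) (b i)%:E)%E).
  by apply: lee_sum => i _; exact: Fb.
by rewrite sumEFin lee_fin.
Qed.

Lemma union_bound (F : nat -> set Omega) (b : nat -> R) S :
  (forall n, measurable (F n)) -> (forall n, (P (F n) <= (b n)%:E)%E) ->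
  (forall N, \sum_(i < N) b i <= S) -> (P (\bigcup_n F n) <= S%:E)%E.
Proof.
move=> mF Fb bS.
have mU : measurable (\bigcup_n F n) by exact: bigcupT_measurable.
apply: (@le_trans _ _ (\sum_(n <oo) P (F n))%E); last exact: nneseries_le_bound Fb bS.
exact: measure_sigma_subadditive.
Qed.

Lemma finite_union_bound (F : nat -> set Omega) (b : R) m :
  (forall n, measurable (F n)) -> (forall n, (n < m)%N -> (P (F n) <= b%:E)%E) ->
  (P (\bigcup_(n in `I_m) F n) <= (b *+ m)%:E)%E.
Proof.
move=> mF Fb.
have mU : measurable (\bigcup_(n in `I_m) F n) by exact: bigcup_measurable.
apply: (@le_trans _ _ (\sum_(i < m) P (F i))%E).
  by apply: content_subadditive => //; rewrite bigcup_mkord.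
apply: (@le_trans _ _ (\sum_(i < m) b%:E)%E).
  by apply: lee_sum => i _; exact: Fb.
by rewrite sumEFin lee_fin sumr_const card_ord.
Qed.

Lemma borel_cantelli (F : nat -> set Omega) (b : nat -> R) S :
  (forall n, measurable (F n)) -> (forall n, (P (F n) <= (b n)%:E)%E) ->
  (forall N, \sum_(i < N) b i <= S) ->
  {ae P, forall w, exists N, forall n, (N <= n)%N -> ~ F n w}.
Proof.
move=> mF Fb bS.
have mL : measurable (lim_sup_set F).
  by apply: bigcapT_measurable => n; exact: bigcup_measurable.
exists (lim_sup_set F); split => //.
  apply: lim_sup_set_cvg0 => //; apply: (@le_lt_trans _ _ S%:E); last exact: ltry.
  exact: nneseries_le_bound Fb bS.
move=> w /= nw n _; apply: contrapT => h; apply: nw; exists n => k nk Fk.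
by apply: h; exists k.
Qed.

Variables (beta tau0 : R) (W : set (R * R) -> {RV P >-> R}).
Hypothesis P_complete : measure_is_complete P.
Hypothesis W_noise : colored_noise beta W.

Variables (K : Omega -> nat) (A : nat -> set (R * R)).
Hypothesis pastK : forall k, <<s past_events W tau0 >> (K @^-1` [set k]).

Let selectedE a : [set w | a < `|W (A (K w)) w|] =
  \bigcup_k (K @^-1` [set k] `&` [set w | (a < `|W (A k) w|)%R]).
Proof. by apply/seteqP; split => [w h|w [k _ /= [<-]]]//; exists (K w). Qed.

Lemma measurable_selected a : measurable [set w | a < `|W (A (K w)) w|].
Proof.
rewrite selectedE; apply: bigcupT_measurable => k; apply: measurableI.
  exact: measurable_past (pastK k).
by apply: measurable_norm_gt; exact: measurable_funPT.
Qed.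

(* The selection is independent of the noise after time [tau0 / Num.sqrt 2]. *)
Lemma selected_tail a q : (forall k, noise_index (A k)) ->
  (forall k p, A k p -> tau0 / Num.sqrt 2 <= p.1) -> 0 <= a ->
  (forall k, (P [set w | (a < `|W (A k) w|)%R] <= q%:E)%E) ->
  (P [set w | (a < `|W (A (K w)) w|)%R] <= q%:E)%E.
Proof.
move=> nA At a0 hq; rewrite selectedE.
have q0 : 0 <= q by rewrite -lee_fin; apply: le_trans (hq 0%N).
have mK k : measurable (K @^-1` [set k]) by exact: measurable_past (pastK k).
have mKA k : measurable (K @^-1` [set k] `&` [set w | (a < `|W (A k) w|)%R]).
  by apply: measurableI => //; by apply: measurable_norm_gt; exact: measurable_funPT.
have tK : trivIset setT (fun k => K @^-1` [set k]).
  by apply/trivIsetP => i j _ _ /eqP ij; apply/seteqP; split => // w [/= wi wj]; apply: ij; rewrite -wi.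
have tKA : trivIset setT (fun k => K @^-1` [set k] `&` [set w | (a < `|W (A k) w|)%R]).
  by apply: trivIset_setIr.
rewrite measure_bigcup//.
have le1 : (\sum_(k <oo | k \in setT) P (K @^-1` [set k]) <= 1)%E.
  rewrite -measure_bigcup//; apply: probability_le1; exact: bigcupT_measurable.
apply: (@le_trans _ _ (\sum_(k <oo | k \in setT) (q%:E * P (K @^-1` [set k])))%E).
  apply: lee_nneseries => // k _.
  have e := past_independent P_complete W_noise (nA k) (At k) (pastK k) a0.
  apply: (@le_trans _ _ (P (K @^-1` [set k]) * P [set w | (a < `|W (A k) w|)%R])%E).
    by rewrite -e.
  by rewrite [leRHS]muleC; exact: lee_wpmul2l.
rewrite nneseriesZl//.
by rewrite -[leRHS]mule1 lee_wpmul2l// lee_fin.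
Qed.

End selection.

(** * Dyadic scales and numerical estimates *)

Section scales.
Context (R : realType).

Lemma dyadic_scale (h : R) N : 0 < h -> h * 2 ^+ N < 1 ->
  exists2 n, (N <= n)%N & h * 2 ^+ n < 1 <= h * 2 ^+ n.+1.
Proof.
move=> h0 hN.
have ex : exists m, 1 <= h * 2 ^+ m.
  exists (Num.truncn h^-1).+1.
  rewrite -ler_pdivrMl// mulr1 ltW// (lt_le_trans (truncnS_gt _))// -natrX ler_nat.
  by rewrite ltnW// ltn_expl.
have [m hm mmin] := ex_minnP ex.
have Nm : (N < m)%N.
  rewrite ltnNge; apply/negP => mN; move: hN; rewrite ltNge => /negP; apply.
  by rewrite (le_trans hm)// ler_pM2l// ler_eXn2l// ltr1n.
case: m hm mmin Nm => // m hm mmin Nm; exists m => //.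
by rewrite hm andbT ltNge; apply/negP => /mmin; rewrite ltnn.
Qed.

Lemma ln2_ge_half : 2^-1 <= ln 2 :> R.
Proof.
rewrite -ler_expR lnK ?posrE// -[2^-1]opprK expRN -[leRHS]invrK lef_pV2 ?posrE ?expR_gt0//.
have := expR_ge1Dx (- 2^-1 : R); lra.
Qed.

(** Here [2 / 2 ^+ n <= 4 * h], which costs a factor at most 16 in the power. Moreover
    [n / 2 <= ln (1 / h)], and [n <= (n / 2) ^+ 2] from 4 on, which costs a factor 2 in the iterated
    logarithm. Under the square root, 32 is at most [8 ^+ 2]. *)
Lemma lil_gauge_scale (beta h : R) n : 0 < beta < 1 -> (4 <= n)%N -> 0 < h ->
  h * 2 ^+ n < 1 <= h * 2 ^+ n.+1 ->
  Num.sqrt ((2 / 2 ^+ n) `^ (2 - beta) * ln n%:R) <= 8 * lil_gauge beta h.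
Proof.
move=> /andP[b0 b1] n4 h0 /andP[h1 h2].
have e0 : 0 < 2 ^+ n :> R by rewrite exprn_gt0.
have n0 : 0 < n%:R :> R by rewrite ltr0n (leq_trans _ n4).
have n4R : 4 <= n%:R :> R by rewrite ler_nat.
have L1 : n%:R / 2 <= ln (1 / h).
  apply: (@le_trans _ _ (ln (2 ^+ n))).
    by rewrite lnXn// -[leRHS]mulr_natl ler_wpM2l ?ln2_ge_half// ltW.
  by rewrite ler_ln ?posrE ?divr_gt0// ler_pdivlMr// mulrC ltW.
have L2 : ln n%:R <= 2 * ln (ln (1 / h)).
  apply: (@le_trans _ _ (ln ((n%:R / 2) ^+ 2))).
    rewrite ler_ln ?posrE ?exprn_gt0 ?divr_gt0// expr2.
    have : n%:R * 4 <= n%:R * n%:R :> R by rewrite ler_pM2l.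
    by lra.
  rewrite lnXn ?divr_gt0// -[leLHS]mulr_natl ler_pM2l// ler_ln ?posrE ?divr_gt0//.
  by apply: lt_le_trans L1; rewrite divr_gt0.
have L3 : (2 / 2 ^+ n) `^ (2 - beta) <= 16 * h `^ (2 - beta).
  apply: (@le_trans _ _ ((4 * h) `^ (2 - beta))).
    have : 2 / 2 ^+ n <= 4 * h.
      by rewrite ler_pdivrMr//; move: h2; rewrite exprS; lra.
    have p0 : 0 <= 2 - beta by lra.
    have q0 : 0 <= 2 / 2 ^+ n :> R by rewrite divr_ge0// ltW.
    have r0 : 0 <= 4 * h by lra.
    by move=> ?; apply: ge0_ler_powR.
  rewrite powRM ?(ltW h0)// ler_wpM2r ?powR_ge0//.
  have -> : 16 = 4 `^ (2%:R) :> R by rewrite powR_mulrn// expr2; ring.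
  by apply: ler_powR; [rewrite ler1n|lra].
have -> : 8 = Num.sqrt (8 ^+ 2) :> R by rewrite sqrtr_sqr ger0_norm.
rewrite /lil_gauge -sqrtrM ?sqr_ge0// ler_sqrt; last first.
  rewrite mulr_ge0 ?sqr_ge0// mulr_ge0 ?powR_ge0//.
  by have : 0 <= ln n%:R :> R by [rewrite ln_ge0//; lra]; lra.
have l0 : 0 <= ln n%:R :> R by rewrite ln_ge0//; lra.
apply: (@le_trans _ _ (16 * h `^ (2 - beta) * (2 * ln (ln (1 / h))))).
  by apply: ler_pM => //; rewrite powR_ge0.
have : 0 <= h `^ (2 - beta) * ln (ln (1 / h)) by rewrite mulr_ge0 ?powR_ge0//; lra.
by rewrite expr2; lra.
Qed.

Lemma bernoulli_ineq (x : R) J : 0 <= x -> 1 + J%:R * x <= (1 + x) ^+ J.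
Proof.
move=> x0; elim: J => [|J ih]; first by rewrite mul0r addr0.
rewrite exprS; apply: (@le_trans _ _ ((1 + x) * (1 + J%:R * x))); last first.
  by rewrite ler_wpM2l// addr_ge0.
rewrite -natr1; have : 0 <= J%:R * x * x by rewrite !mulr_ge0.
by lra.
Qed.

(** Per level the squared threshold shrinks by 49/64 and the variance by 1/2, so the exponent grows
    by 49/32, that is [1 + 17 / 32]. By Bernoulli's inequality it is at least [4 + 2 * J] times the
    logarithm of [n.+3], whose square exceeds 8. The fourth power is meant for Borel-Cantelli, and
    [8 ^+ J] for the number of grid points. *)
Lemma chaining_tail (v : R) n J : 0 < v ->
  2 * expR (- ((Num.sqrt (8 * v * ln n.+3%:R) * (7 / 8) ^+ J) ^+ 2 / (v / 2 ^+ J *+ 2))) <=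
  2 / (n.+3%:R ^+ 4 * 8 ^+ J).
Proof.
move=> v0; rewrite ler_pM2l// expRN lef_pV2 ?posrE ?expR_gt0 ?mulr_gt0 ?exprn_gt0//.
have l0 : 0 <= ln n.+3%:R :> R by rewrite ln_ge0// ler1n.
have e0 : 0 < 2 ^+ J :> R by rewrite exprn_gt0.
rewrite exprMn sqr_sqrtr ?mulr_ge0 ?(ltW v0)//.
have -> : 8 * v * ln n.+3%:R * ((7 / 8) ^+ J) ^+ 2 / (v / 2 ^+ J *+ 2) =
    4 * ln n.+3%:R * (1 + 17 / 32) ^+ J.
  have -> : 1 + 17 / 32 = 7 / 8 * (7 / 8) * 2 :> R by field.
  rewrite !exprMn -mulr_natr; field.
  by rewrite !gt_eqF.
apply: (@le_trans _ _ (expR (ln (n.+3%:R ^+ 4 * (n.+3%:R ^+ 2) ^+ J)))); last first.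
  rewrite ler_expR lnM ?posrE ?exprn_gt0// -exprM !lnXn//.
  rewrite -[_ *+ 4]mulr_natr -[_ *+ (2 * J)]mulr_natr natrM.
  have := @bernoulli_ineq (17 / 32) J; have h : 0 <= 17 / 32 :> R by lra.
  move=> /(_ h) hb.
  have : 4 * ln n.+3%:R * (1 + J%:R * (17 / 32)) <= 4 * ln n.+3%:R * (1 + 17 / 32) ^+ J :> R.
    by rewrite ler_wpM2l// mulr_ge0.
  have : 0 <= ln n.+3%:R * J%:R :> R by rewrite mulr_ge0.
  by lra.
rewrite lnK ?posrE ?mulr_gt0 ?exprn_gt0// ler_pM2l ?exprn_gt0//.
rewrite lerXn2r ?nnegrE ?exprn_ge0//.
have h3 : 3 <= n.+3%:R :> R by rewrite ler_nat.
by rewrite expr2; have := ler_pM _ _ h3 h3; lra.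
Qed.

Lemma sum_inv_succ N : \sum_(i < N) (i.+1%:R * i.+2%:R)^-1 <= (1 : R).
Proof.
suff -> : \sum_(i < N) (i.+1%:R * i.+2%:R)^-1 = 1 - N.+1%:R^-1 :> R.
  by rewrite gerBl invr_ge0.
elim: N => [|N ih]; first by rewrite big_ord0 invr1 subrr.
rewrite big_ord_recr/= ih.
have h1 : N.+1%:R != 0 :> R by rewrite pnatr_eq0.
have h2 : N.+2%:R != 0 :> R by rewrite pnatr_eq0.
have e : N.+2%:R = N.+1%:R + 1 :> R by rewrite -natr1.
by move: h1 h2; rewrite e; move: N.+1%:R => a h1 h2; field; rewrite h1 h2.
Qed.

Lemma sum_geometric_le (x c : R) N : 0 <= c -> 0 < x < 1 ->
  \sum_(i < N) c * x ^+ i <= c / (1 - x).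
Proof.
move=> c0 /andP[x0 x1].
have := @geometric_le_lim R N c x c0 x0.
by rewrite (ger0_norm (ltW x0)) => /(_ x1); rewrite /series/= /geometric big_mkord.
Qed.

End scales.

(** * Transfer of the singularity to later times *)

Section transfer.
Context (R : realType) (d : measure_display) (Omega : measurableType d)
  (P : probability Omega R) (beta tau0 : R) (W : set (R * R) -> {RV P >-> R})
  (u : R -> R -> {RV P >-> R}).
Hypothesis P_complete : measure_is_complete P.
Hypothesis beta01 : 0 < beta < 1.
Hypothesis tau0_gt0 : 0 < tau0.
Hypothesis W_noise : colored_noise beta W.
Hypothesis u_sol : continuous_solution W u.

(** Rounding turns the random point into a countably valued index, the form in which independence is
    used. *)
Lemma past_truncn (L : Omega -> R) c k : (forall w, 0 <= L w) -> 0 <= c ->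
  past_measurable W tau0 L ->
  <<s past_events W tau0 >> ((fun w => Num.truncn (L w * c)) @^-1` [set k]).
Proof.
move=> L0 c0 pL.
have -> : (fun w => Num.truncn (L w * c)) @^-1` [set k] =
    L @^-1` ((fun x => x * c) @^-1` [set` `[k%:R, k.+1%:R[]).
  apply/seteqP; split => w /=; rewrite in_itv/=.
    by move/eqP; rewrite truncn_eq ?mulr_ge0.
  by move=> h; apply/eqP; rewrite truncn_eq ?mulr_ge0.
have mB : measurable ((fun x : R => x * c) @^-1` [set` `[k%:R, k.+1%:R[]).
  have mf : measurable_fun setT (fun x : R => x * c).
    by apply: measurable_funM; [exact: measurable_id|exact: measurable_cst].
  by rewrite -[X in measurable X]setTI; apply: mf.
by have := pL measurableT _ mB; rewrite setTI.
Qed.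

Lemma rotate_cvg w T (F : set_system T) (FF : Filter F) (f g : T -> R) (tau lam : R) :
  {within @half_plane R, continuous (fun p => u p.1 p.2 w)} ->
  f @ F --> tau -> g @ F --> lam -> 0 <= tau + lam ->
  (\forall t \near F, 0 <= f t + g t) ->
  rotate u (f t) (g t) w @[t --> F] --> rotate u tau lam w.
Proof.
move=> /subspace_continuousP cu cf cg tl fg.
have hp (a b : R) : 0 <= a + b -> half_plane ((a + b) / r2, (- a + b) / r2).
  by move=> ab; rewrite /half_plane/= divr_ge0// sqrtr_ge0.
have c1 : (f t + g t) / r2 @[t --> F] --> (tau + lam) / r2.
  by apply: cvgMr_tmp; exact: cvgD.
have c2 : (- f t + g t) / r2 @[t --> F] --> (- tau + lam) / r2.
  by apply: cvgMr_tmp; apply: cvgD => //; exact: cvgN.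
have cpt : ((f t + g t) / r2, (- f t + g t) / r2) @[t --> F] -->
    ((tau + lam) / r2, (- tau + lam) / r2) by exact: (cvg_pair c1 c2).
have cwpt : ((f t + g t) / r2, (- f t + g t) / r2) @[t --> F] -->
    within (@half_plane R) (nbhs ((tau + lam) / r2, (- tau + lam) / r2)).
  move=> A /= wA.
  have h : \forall t \near F, half_plane ((f t + g t) / r2, (- f t + g t) / r2) ->
      A ((f t + g t) / r2, (- f t + g t) / r2) := cpt _ wA.
  suff : \forall t \near F, A ((f t + g t) / r2, (- f t + g t) / r2) by [].
  by apply: filterS2 h fg => t h ?; apply: h; exact: hp.
exact: (cvg_comp _ _ cwpt (cu _ (hp _ _ tl))).
Qed.

Section window.
Variable M : R.
Hypothesis M_gt0 : 0 < M.

(** A normalised double increment: [x] runs over times up to [tau0 + M], [y] over two dyadic cells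
    from index [k] on. Two cells let the window contain a point of the first cell together with
    every point less than [2 ^- n] to its right. *)
Definition window_incr (n k : nat) (x y : R) w :=
  (rotate u (tau0 + M * x) (k%:R / 2 ^+ n + 2 / 2 ^+ n * y) w -
   rotate u tau0 (k%:R / 2 ^+ n + 2 / 2 ^+ n * y) w) -
  (rotate u (tau0 + M * x) (k%:R / 2 ^+ n) w - rotate u tau0 (k%:R / 2 ^+ n) w).

Let tt (J i : nat) : R := tau0 + M * (i%:R / 2 ^+ J).
Let yy (n k J l : nat) : R := k%:R / 2 ^+ n + 2 / 2 ^+ n * (l%:R / 2 ^+ J).

Let boxV n k J i l := box (r2 * tt J i) (r2 * tt J i.+1) (r2 * (k%:R / 2 ^+ n)) (r2 * yy n k J l).
Let boxH n k J i l := box (r2 * tau0) (r2 * tt J i) (r2 * yy n k J l) (r2 * yy n k J l.+1).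

Let e0 n : 0 < 2 ^+ n :> R. Proof. by rewrite exprn_gt0. Qed.
Let frac_ge0 i J : 0 <= i%:R / 2 ^+ J :> R. Proof. by rewrite divr_ge0// ltW. Qed.
Let frac_le1 i J : (i <= 2 ^ J)%N -> i%:R / 2 ^+ J <= 1 :> R.
Proof. by move=> h; rewrite ler_pdivrMr// mul1r -natrX ler_nat. Qed.
Let fracS i J : i.+1%:R / 2 ^+ J = i%:R / 2 ^+ J + (2 ^+ J)^-1 :> R.
Proof. by rewrite -natr1 mulrDl mul1r. Qed.
Let tt0 J i : tau0 <= tt J i. Proof. by rewrite lerDl mulr_ge0// ltW. Qed.
Let ttS J i : tt J i <= tt J i.+1.
Proof. by rewrite lerD2l ler_pM2l// ler_pM2r ?invr_gt0// ler_nat. Qed.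
Let yy0 n k J l : k%:R / 2 ^+ n <= yy n k J l.
Proof. by rewrite lerDl !mulr_ge0// invr_ge0 ltW. Qed.
Let yyS n k J l : yy n k J l <= yy n k J l.+1.
Proof. by rewrite lerD2l ler_pM2l ?divr_gt0// ler_pM2r ?invr_gt0// ler_nat. Qed.

(** Halving the mesh in either direction at least halves the variance bound: the box covariance is
    linear in its first side, and in the second the exponent [2 - beta] exceeds 1. *)
Let box_var : exists2 V : R, 0 < V & forall n k J i l,
  ((l <= 2 ^ J)%N -> (noise_cov beta (boxV n k J i l) (boxV n k J i l) <=
     (V * (2 / 2 ^+ n) `^ (2 - beta) / 2 ^+ J)%:E)%E) /\
  ((i <= 2 ^ J)%N -> (noise_cov beta (boxH n k J i l) (boxH n k J i l) <=
     (V * (2 / 2 ^+ n) `^ (2 - beta) / 2 ^+ J)%:E)%E).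
Proof.
have [K K0 hK] := box_cov_le beta01; have r0 := sqrt2_gt0 R.
have /andP[b0 b1] := beta01; have b2 : 0 <= 2 - beta by lra.
exists (K * (r2 * M) * r2 `^ (2 - beta)); first by rewrite !mulr_gt0// powR_gt0.
have pw (a x y : R) : 0 <= a -> 0 <= x -> 0 <= y -> (a * (x * y)) `^ (2 - beta) =
    a `^ (2 - beta) * x `^ (2 - beta) * y `^ (2 - beta).
  by move=> a0 x0 y0; rewrite powRM ?mulr_ge0// powRM// mulrA.
have p1 r : 1 `^ r = 1 :> R by rewrite powR1.
have d0 n : 0 <= 2 / 2 ^+ n :> R by rewrite divr_ge0// ltW.
move=> n k J i l; split => [lJ|iJ].
  apply: le_trans (hK _ _ _ _ _ _) _; rewrite ?ler_pM2l//.
  rewrite lee_fin -!mulrBr /tt /yy (fracS i J).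
  have -> : tau0 + M * (i%:R / 2 ^+ J + (2 ^+ J)^-1) - (tau0 + M * (i%:R / 2 ^+ J)) =
    M / 2 ^+ J by ring.
  have -> : k%:R / 2 ^+ n + 2 / 2 ^+ n * (l%:R / 2 ^+ J) - k%:R / 2 ^+ n =
    2 / 2 ^+ n * (l%:R / 2 ^+ J) :> R by ring.
  rewrite pw ?(ltW r0)//.
  have -> : K * (r2 * M) * r2 `^ (2 - beta) * (2 / 2 ^+ n) `^ (2 - beta) / 2 ^+ J =
    K * (r2 * (M / 2 ^+ J)) * (r2 `^ (2 - beta) * (2 / 2 ^+ n) `^ (2 - beta) * 1) by ring.
  rewrite ler_wpM2l//; first by rewrite !mulr_ge0 ?invr_ge0 ?(ltW r0) ?(ltW K0) ?(ltW M_gt0) ?(ltW (e0 _)).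
  rewrite ler_wpM2l ?mulr_ge0 ?powR_ge0//.
  by rewrite -[leRHS](p1 (2 - beta)) ge0_ler_powR ?nnegrE ?frac_le1.
apply: le_trans (hK _ _ _ _ _ _) _; rewrite ?ler_pM2l//.
rewrite lee_fin -!mulrBr /tt /yy (fracS l J).
have -> : tau0 + M * (i%:R / 2 ^+ J) - tau0 = M * (i%:R / 2 ^+ J) by ring.
have -> : k%:R / 2 ^+ n + 2 / 2 ^+ n * (l%:R / 2 ^+ J + (2 ^+ J)^-1) -
  (k%:R / 2 ^+ n + 2 / 2 ^+ n * (l%:R / 2 ^+ J)) = 2 / 2 ^+ n * (2 ^+ J)^-1 :> R by ring.
have i0 : 0 <= (2 ^+ J)^-1 :> R by rewrite invr_ge0 ltW.
rewrite pw ?(ltW r0)//.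
have -> : K * (r2 * M) * r2 `^ (2 - beta) * (2 / 2 ^+ n) `^ (2 - beta) / 2 ^+ J =
  K * (r2 * (M * 1)) * (r2 `^ (2 - beta) * (2 / 2 ^+ n) `^ (2 - beta) * (2 ^+ J)^-1) by ring.
apply: ler_pM.
- by rewrite !mulr_ge0 ?(ltW r0) ?(ltW K0) ?(ltW M_gt0).
- by rewrite !mulr_ge0 ?powR_ge0.
- by rewrite ler_pM2l// ler_pM2l// ler_pM2l// frac_le1.
- rewrite ler_wpM2l ?mulr_ge0 ?powR_ge0//.
  have -> : (2 ^+ J)^-1 `^ (2 - beta) = (2 ^+ J)^-1 * (2 ^+ J)^-1 `^ (1 - beta) :> R.
    rewrite -(@mulr_powRB1 _ _ (2 - beta)) ?subr_gt0; [|by []|by lra].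
    by congr (_ * _ `^ _); ring.
  rewrite -[leRHS]mulr1 ler_wpM2l// -[leRHS](p1 (1 - beta)).
  apply: ge0_ler_powR; rewrite ?nnegrE//; first by lra.
  by rewrite invf_le1// exprn_ege1// ler1n.
Qed.

Let incrV n k J i l : {ae P, forall w,
  window_incr n k (i.+1%:R / 2 ^+ J) (l%:R / 2 ^+ J) w -
  window_incr n k (i%:R / 2 ^+ J) (l%:R / 2 ^+ J) w = 2^-1 * W (boxV n k J i l) w}.
Proof.
have := @rotate_box _ _ _ P beta W u W_noise u_sol (tt J i) (tt J i.+1) (k%:R / 2 ^+ n) (yy n k J l).
have t0 : 0 <= tt J i by apply: le_trans (tt0 _ _); exact: ltW.
move=> /(_ t0 (frac_ge0 _ _) (ttS _ _) (yy0 _ _ _ _)).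
by apply: filterS => w; rewrite /boxV => <-; rewrite /window_incr /tt /yy; ring.
Qed.

Let incrH n k J i l : {ae P, forall w,
  window_incr n k (i%:R / 2 ^+ J) (l.+1%:R / 2 ^+ J) w -
  window_incr n k (i%:R / 2 ^+ J) (l%:R / 2 ^+ J) w = 2^-1 * W (boxH n k J i l) w}.
Proof.
have := @rotate_box _ _ _ P beta W u W_noise u_sol tau0 (tt J i) (yy n k J l) (yy n k J l.+1).
have y0 : 0 <= yy n k J l by apply: le_trans (yy0 _ _ _ _).
move=> /(_ (ltW tau0_gt0) y0 (tt0 _ _) (yyS _ _ _ _)).
by apply: filterS => w; rewrite /boxH => <-; rewrite /window_incr /tt /yy; ring.
Qed.

Lemma window_incr_le (L : Omega -> R) : (forall w, 0 < L w) ->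
  past_measurable W tau0 L -> exists2 C, 0 <= C & {ae P, forall w, exists N, forall n,
    (N <= n)%N -> forall x y : R, 0 <= x < 1 -> 0 <= y < 1 ->
    `|window_incr n (Num.truncn (L w * 2 ^+ n)) x y w| <=
      C * Num.sqrt ((2 / 2 ^+ n) `^ (2 - beta) * ln n%:R)}.
Proof.
move=> L0 pL; have [V V0 hV] := box_var; have r0 := sqrt2_gt0 R.
pose K n w := Num.truncn (L w * 2 ^+ n).
have pK n k : <<s past_events W tau0 >> (K n @^-1` [set k]).
  by apply: past_truncn => // w; exact: ltW.
pose v n : R := V * (2 / 2 ^+ n) `^ (2 - beta).
have v0 n : 0 < v n by rewrite mulr_gt0// powR_gt0// divr_gt0.
pose s n := Num.sqrt (8 * v n * ln n%:R).
pose thr n J : R := s n * (7 / 8) ^+ J.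
have thr0 n J : 0 <= thr n J by rewrite mulr_ge0 ?sqrtr_ge0// exprn_ge0// divr_ge0.
(* A pair of grid indices, each at most [2 ^ J], is coded by one number below [D J * D J], as
   quotient and remainder by [D J]. *)
pose D J := (2 ^ J).+1.
pose FV m J c := [set w | thr m.+3 J <
  `|W (boxV m.+3 (K m.+3 w) J (c %/ D J) (c %% D J)%N) w|].
pose FH m J c := [set w | thr m.+3 J <
  `|W (boxH m.+3 (K m.+3 w) J (c %/ D J) (c %% D J)%N) w|].
pose F m J c := FV m J c `|` FH m J c.
have mFV m J c : measurable (FV m J c).
  exact: (measurable_selected P_complete (fun k => boxV m.+3 k J (c %/ D J) (c %% D J)%N) (pK m.+3)).
have mFH m J c : measurable (FH m J c).
  exact: (measurable_selected P_complete (fun k => boxH m.+3 k J (c %/ D J) (c %% D J)%N) (pK m.+3)).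
have mF m J c : measurable (F m J c) by exact: measurableU.
pose q m J : R := 2 / (m.+3%:R ^+ 4 * 8 ^+ J).
have q0 m J : 0 <= q m J by rewrite divr_ge0 ?mulr_ge0 ?exprn_ge0.
have vJ0 n J : 0 < v n / 2 ^+ J by rewrite divr_gt0.
have PF m J c : (c < D J * D J)%N -> (P (F m J c) <= (q m J *+ 2)%:E)%E.
  move=> cD.
  have i2 : (c %/ D J <= 2 ^ J)%N by rewrite -ltnS ltn_divLR.
  have l2 : (c %% D J <= 2 ^ J)%N by rewrite -ltnS ltn_mod.
  have tl n : (forall A, noise_index A ->
      (noise_cov beta A A <= (v n.+3 / 2 ^+ J)%:E)%E ->
      (P [set w | (thr n.+3 J < `|W A w|)%R] <= (q n J)%:E)%E).
    move=> A nA cA; apply: le_trans (noise_tail W_noise nA cA (vJ0 _ _) (thr0 _ _)) _.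
    by rewrite lee_fin /thr /s; exact: chaining_tail.
  apply: le_trans (measureU2 _ (mFV _ _ _) (mFH _ _ _)) _.
  rewrite mulr2n EFinD; apply: leeD.
    apply: (selected_tail P_complete W_noise (pK m.+3)
      (A := fun k => boxV m.+3 k J (c %/ D J) (c %% D J)%N)) => //.
    - by move=> k; exact: noise_index_box.
    - by move=> k p; apply: box_time => //; rewrite ?ler_pM2l// mulr_ge0// ltW.
    - by move=> k; apply: tl; [exact: noise_index_box|exact: (hV _ _ _ _ _).1].
  apply: (selected_tail P_complete W_noise (pK m.+3)
    (A := fun k => boxH m.+3 k J (c %/ D J) (c %% D J)%N)) => //.
  - by move=> k; exact: noise_index_box.
  - move=> k p; apply: box_time => //; rewrite mulr_ge0 ?(ltW r0)//.
    exact: le_trans (yy0 _ _ _ _).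
  - by move=> k; apply: tl; [exact: noise_index_box|exact: (hV _ _ _ _ _).2].
pose U m := \bigcup_J \bigcup_(c in `I_(D J * D J)) F m J c.
have mUJ m J : measurable (\bigcup_(c in `I_(D J * D J)) F m J c) by exact: bigcup_measurable.
have mU m : measurable (U m) by exact: bigcupT_measurable.
(* There are at most [4 * 4 ^+ J] pairs, with two events of probability at most [q m J] each; what
   is left at level [J] decays like [2 ^- J], and the sum over [J] is 32 over the fourth power of
   [m.+3]. *)
have PU m : (P (U m) <= (32 * (m.+1%:R * m.+2%:R)^-1)%:E)%E.
  have h3 : m.+3%:R ^+ 4 > 0 :> R by rewrite exprn_gt0.
  apply: (@union_bound _ _ _ _ _ (fun J => 16 / m.+3%:R ^+ 4 * 2^-1 ^+ J)) => //.
    move=> J; apply: le_trans (finite_union_bound (b := q m J *+ 2) _ _) _ => //.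
      exact: PF.
    rewrite lee_fin -(mulr_natr (q m J *+ 2)) -(mulr_natr (q m J) 2) /q.
    have -> : 2 / (m.+3%:R ^+ 4 * 8 ^+ J) * 2 * (D J * D J)%:R =
        4 / (m.+3%:R ^+ 4) * ((8 ^+ J)^-1 * (D J * D J)%:R) :> R.
      by field; rewrite !gt_eqF ?exprn_gt0.
    have -> : 16 / m.+3%:R ^+ 4 * 2^-1 ^+ J = 4 / m.+3%:R ^+ 4 * (4 * 2^-1 ^+ J) :> R by ring.
    rewrite ler_wpM2l ?divr_ge0 ?(ltW h3)//.
    rewrite ler_pdivrMl ?exprn_gt0// natrM.
    have d2 : (D J)%:R <= 2 * 2 ^+ J :> R.
      by rewrite -natrX -natrM ler_nat /D mul2n -addnn -addn1 leq_add2l expn_gt0.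
    apply: le_trans (ler_pM _ _ d2 d2) _ => //.
    have -> : 8 = 2 * 2 * 2 :> R by ring.
    rewrite !exprMn exprVn le_eqVlt; apply/orP; left; apply/eqP.
    by field; rewrite gt_eqF.
  move=> N; apply: le_trans (sum_geometric_le _ _ _) _.
  - by rewrite divr_ge0// ltW.
  - by lra.
  have -> : 16 / m.+3%:R ^+ 4 / (1 - 2^-1) = 32 / m.+3%:R ^+ 4 :> R.
    by field; rewrite gt_eqF.
  rewrite ler_pM2l// lef_pV2 ?posrE ?mulr_gt0// -!natrM -natrX ler_nat.
  rewrite 3!expnS expn1; apply: leq_mul; first by rewrite ltnW.
  apply: leq_trans (leq_pmulr _ _) => //; by rewrite ltnW.
have bc := borel_cantelli mU PU.
have /bc {bc} hU : forall N, \sum_(i < N) 32 * (i.+1%:R * i.+2%:R)^-1 <= (32 : R).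
  by move=> N; rewrite -mulr_sumr -[leRHS]mulr1 ler_pM2l// sum_inv_succ.
have hV' : {ae P, forall w, forall n k J i l,
  window_incr n k (i.+1%:R / 2 ^+ J) (l%:R / 2 ^+ J) w -
  window_incr n k (i%:R / 2 ^+ J) (l%:R / 2 ^+ J) w = 2^-1 * W (boxV n k J i l) w}.
  by do 5 (apply: ae_foralln => ?); exact: incrV.
have hH' : {ae P, forall w, forall n k J i l,
  window_incr n k (i%:R / 2 ^+ J) (l.+1%:R / 2 ^+ J) w -
  window_incr n k (i%:R / 2 ^+ J) (l%:R / 2 ^+ J) w = 2^-1 * W (boxH n k J i l) w}.
  by do 5 (apply: ae_foralln => ?); exact: incrH.
have [_ cu] := u_sol.
(* 7 is the sum of the powers of 7/8 from the first on. The two grid directions double it, and the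
   factor 1/2 in front of the noise undoes this. *)
exists (7 * Num.sqrt (8 * V)); first by rewrite mulr_ge0 ?sqrtr_ge0.
near=> w.
have [N hN] : exists N, forall n, (N <= n)%N -> ~ U n w by near: w.
have eV : forall n k J i l,
  window_incr n k (i.+1%:R / 2 ^+ J) (l%:R / 2 ^+ J) w -
  window_incr n k (i%:R / 2 ^+ J) (l%:R / 2 ^+ J) w = 2^-1 * W (boxV n k J i l) w by near: w.
have eH : forall n k J i l,
  window_incr n k (i%:R / 2 ^+ J) (l.+1%:R / 2 ^+ J) w -
  window_incr n k (i%:R / 2 ^+ J) (l%:R / 2 ^+ J) w = 2^-1 * W (boxH n k J i l) w by near: w.
have cw : {within @half_plane R, continuous (fun p => u p.1 p.2 w)} by near: w.
exists N.+3 => n Nn x y hx hy.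
case: n Nn => [//|[//|[//|m]]]; rewrite !ltnS => Nm; set k := Num.truncn _.
have nU := hN _ Nm.
have bV J i l : (i <= 2 ^ J)%N -> (l <= 2 ^ J)%N ->
    `|W (boxV m.+3 k J i l) w| <= thr m.+3 J /\ `|W (boxH m.+3 k J i l) w| <= thr m.+3 J.
  move=> iJ lJ; have dE : ((i * D J + l) %/ D J = i)%N.
    by rewrite divnMDl// divn_small ?addn0.
  have mE : ((i * D J + l) %% D J = l)%N by rewrite modnMDl modn_small.
  have cD : (i * D J + l < D J * D J)%N.
    apply: (@leq_trans (i.+1 * D J)%N); first by rewrite mulSn addnC ltn_add2r ltnS.
    by rewrite leq_mul2r ltnS iJ orbT.
  split; rewrite leNgt; apply/negP => h; apply: nU; exists J => //; exists (i * D J + l)%N => //.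
    by left; rewrite /FV/= dE mE.
  by right; rewrite /FH/= dE mE.
have half (z t : R) : `|z| <= t -> `|2^-1 * z| <= t / 2.
  by move=> h; rewrite normrM ger0_norm ?invr_ge0//; lra.
have -> : 7 * Num.sqrt (8 * V) * Num.sqrt ((2 / 2 ^+ m.+3) `^ (2 - beta) * ln m.+3%:R) =
    7 * s m.+3.
  rewrite -mulrA -sqrtrM ?mulr_ge0 ?(ltW V0)// /s /v.
  by congr (7 * Num.sqrt _); ring.
apply: (@dyadic_chaining _ (fun x y => window_incr m.+3 k x y w) (fun J => thr m.+3 J / 2)) => //.
- by move=> J i l iJ lJ /=; rewrite eV; apply: half; exact: (bV _ _ _ (ltnW iJ) lJ).1.
- by move=> J i l iJ lJ /=; rewrite eH; apply: half; exact: (bV _ _ _ iJ (ltnW lJ)).2.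
- by rewrite /window_incr !mulr0 !addr0 !subrr.
- move=> J; apply: le_trans (_ : \sum_(i < J) (7 / 8 * s m.+3) * (7 / 8) ^+ i <= _).
    by apply: ler_sum => i _; rewrite /thr exprS; lra.
  have s0 : 0 <= s m.+3 by exact: sqrtr_ge0.
  have h7 : 0 < (7 / 8 : R) < 1 by apply/andP; split; lra.
  have h8 : 0 <= 7 / 8 * s m.+3 by lra.
  apply: le_trans (sum_geometric_le _ h8 h7) _.
  by have -> : 1 - 7 / 8 = 8^-1 :> R by [field]; rewrite invrK; lra.
- move=> f g fx gy f0 g0; rewrite /window_incr.
  have M0 := ltW M_gt0; have ta0 := ltW tau0_gt0.
  have d0 : 0 <= 2 / 2 ^+ m.+3 :> R by rewrite divr_ge0// ltW.
  have k0 : 0 <= k%:R / 2 ^+ m.+3 :> R by [].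
  have /andP[x0 _] := hx; have /andP[y0 _] := hy.
  have c1 : tau0 + M * f n @[n --> \oo] --> tau0 + M * x.
    by apply: cvgD; [exact: cvg_cst|apply: cvgMl_tmp].
  have c2 : k%:R / 2 ^+ m.+3 + 2 / 2 ^+ m.+3 * g n @[n --> \oo] -->
      k%:R / 2 ^+ m.+3 + 2 / 2 ^+ m.+3 * y.
    by apply: cvgD; [exact: cvg_cst|apply: cvgMl_tmp].
  have c3 (z : R) : (fun _ : nat => z) @ \oo --> z by exact: cvg_cst.
  by apply: cvgB; apply: cvgB; apply: rotate_cvg => //;
    try (apply: nearW => ?); rewrite !addr_ge0// mulr_ge0.
Unshelve. all: by end_near. Qed.

End window.

Lemma lil_limsup_rotate (L : Omega -> R) : (forall w, 0 < L w) ->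
  past_measurable W tau0 L ->
  {ae P, forall w, forall tau : R, tau0 < tau ->
    (lil_limsup beta (fun lam => rotate u tau0 lam w) (L w) = +oo%E <->
     lil_limsup beta (fun lam => rotate u tau lam w) (L w) = +oo%E)}.
Proof.
move=> L0 pL.
(* One null set for all [tau]: each falls in a window of integer height [M.+1], and there are
   countably many of these. *)
have /ae_foralln h : forall M, {ae P, forall w, exists C, 0 <= C /\ exists N, forall n,
    (N <= n)%N -> forall x y : R, 0 <= x < 1 -> 0 <= y < 1 ->
    `|window_incr M.+1%:R n (Num.truncn (L w * 2 ^+ n)) x y w| <=
      C * Num.sqrt ((2 / 2 ^+ n) `^ (2 - beta) * ln n%:R)}.
  move=> M; have [C C0] := @window_incr_le M.+1%:R (ltr0Sn _ _) L L0 pL.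
  by apply: filterS => w h; exists C.
apply: filterS h => w hw tau t0.
pose M := Num.truncn (tau - tau0).
have [C [C0 [N hN]]] := hw M.
have M0 : 0 < M.+1%:R :> R by rewrite ltr0n.
pose x := (tau - tau0) / M.+1%:R.
have hx : 0 <= x < 1.
  rewrite divr_ge0 ?(ltW M0) ?subr_ge0 ?(ltW t0)//= ltr_pdivrMr// mul1r.
  exact: truncnS_gt.
have tE : tau = tau0 + M.+1%:R * x.
  by rewrite /x mulrC divfK ?gt_eqF//; ring.
pose N' := maxn N 4; have e0 n : 0 < 2 ^+ n :> R by rewrite exprn_gt0.
have main h : 0 < h < (2 ^+ N')^-1 ->
    `|(rotate u tau (L w + h) w - rotate u tau (L w) w) -
      (rotate u tau0 (L w + h) w - rotate u tau0 (L w) w)| <= 16 * C * lil_gauge beta h.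
  move=> /andP[h0 hN'].
  have [n N'n hn] := @dyadic_scale _ h N' h0 ltac:(by rewrite -ltr_pdivlMr// mul1r).
  have Nn : (N <= n)%N by apply: leq_trans N'n; exact: leq_maxl.
  have n4 : (4 <= n)%N by apply: leq_trans N'n; exact: leq_maxr.
  have /andP[hn1 hn2] := hn.
  have Ln0 : 0 <= L w * 2 ^+ n by rewrite mulr_ge0// ltW.
  set k := Num.truncn (L w * 2 ^+ n) in hN *.
  have /andP[k1 k2] := truncn_itv Ln0; rewrite -/k in k1 k2.
  (* [y] and [y'] are the window coordinates of [L w] and [L w + h]: the first is below 1/2, and [h]
     adds less than 1/2. *)
  pose y := (L w * 2 ^+ n - k%:R) / 2.
  pose y' := y + h * 2 ^+ n / 2.
  have hy : 0 <= y < 1 by rewrite /y; move: k2; rewrite -[k.+1%:R]natr1 => k2; apply/andP; split; lra.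
  have hy' : 0 <= y' < 1.
    have : 0 < h * 2 ^+ n by rewrite mulr_gt0.
    by rewrite /y' /y; move: k2; rewrite -[k.+1%:R]natr1 => k2 ?; apply/andP; split; lra.
  have Ly : k%:R / 2 ^+ n + 2 / 2 ^+ n * y = L w.
    by rewrite /y; field; rewrite gt_eqF.
  have Ly' : k%:R / 2 ^+ n + 2 / 2 ^+ n * y' = L w + h.
    by rewrite /y' /y; field; rewrite gt_eqF.
  have b := hN n Nn x y hx hy; have b' := hN n Nn x y' hx hy'.
  have g := lil_gauge_scale beta01 n4 h0 hn.
  move: b b'; rewrite -/k /window_incr Ly Ly' -tE.
  set a1 := rotate u tau (L w) w; set a2 := rotate u tau0 (L w) w.
  set b1 := rotate u tau (L w + h) w; set b2 := rotate u tau0 (L w + h) w.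
  set c := rotate u tau (k%:R / _) w - _ => b b'.
  (* The values at the left end of the window cancel. *)
  have -> : b1 - a1 - (b2 - a2) = (b1 - b2 - c) - (a1 - a2 - c) by ring.
  apply: le_trans (ler_normB _ _) _.
  apply: le_trans (lerD b' b) _.
  have : C * Num.sqrt ((2 / 2 ^+ n) `^ (2 - beta) * ln n%:R) <= C * (8 * lil_gauge beta h).
    by rewrite ler_wpM2l.
  by lra.
have N0 : 0 < (2 ^+ N')^-1 :> R by rewrite invr_gt0.
split; first exact: lil_limsup_transfer N0 main.
apply: lil_limsup_transfer N0 _ => h hh; rewrite -normrN opprB; exact: main.
Qed.

End transfer.

(** * The second moment argument *)

Section second_moment.
Context (R : realType) (d : measure_display) (Omega : measurableType d)
  (P : probability Omega R) (beta : R) (W : set (R * R) -> {RV P >-> R}).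
Hypothesis W_noise : colored_noise beta W.
Notation Ex f := (\int[P]_w f w).
Notation integrableP f := (P.-integrable setT (EFin \o f)).

Let noise_sub : @noise_index R `<=` @noise_index R. Proof. by []. Qed.

Let Rintegral_sum (n : nat) (f : 'I_n -> Omega -> R) : (forall i, integrableP (f i)) ->
  integrableP (fun w => \sum_(i < n) f i w) /\
  Ex (fun w => \sum_(i < n) f i w) = \sum_(i < n) Ex (f i).
Proof.
elim: n f => [|n ih] f fi.
  have -> : (fun w => \sum_(i < 0) f i w) = cst 0.
    by apply/funext => w; rewrite big_ord0.
  split; first exact: finite_measure_integrable_cst.
  by rewrite Rintegral_cst// mul0r big_ord0.
have [i1 e1] := ih (fun i => f (lift ord0 i)) (fun i => fi _).
have -> : (fun w => \sum_(i < n.+1) f i w) =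
    (fun w => f ord0 w + \sum_(i < n) f (lift ord0 i) w).
  by apply/funext => w; rewrite big_ord_recl.
split; first exact: (integrable_addr measurableT).
by rewrite RintegralD// e1 big_ord_recl.
Qed.

Variables (A : nat -> set (R * R)) (N : nat) (s eps a : R).
Hypothesis nA : forall i, noise_index (A i).
Hypothesis s_gt0 : 0 < s.
Hypothesis a_ge1 : 1 <= a.
Hypothesis N_gt0 : (0 < N)%N.
Hypothesis cov_self : forall i, ((s ^+ 2)%:E <= noise_cov beta (A i) (A i))%E.
Hypothesis cov_cross : forall i j, i != j ->
  (noise_cov beta (A i) (A j) <= (eps * s ^+ 2)%:E)%E.

Let c i j : R := fine (noise_cov beta (A i) (A j)).
Let cE i j : noise_cov beta (A i) (A j) = (c i j)%:E.
Proof. by rewrite fineK// (noise_cov_fin_num W_noise). Qed.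
Let c_self i : s ^+ 2 <= c i i. Proof. by have := cov_self i; rewrite cE. Qed.
Let c_cross i j : i != j -> c i j <= eps * s ^+ 2.
Proof. by move=> /cov_cross; rewrite cE. Qed.
Let c_ge0 i j : 0 <= c i j. Proof. by rewrite fine_ge0// noise_cov_ge0. Qed.

(** With this tilt, a variable below the threshold has exponent at most
    [3 * a ^+ 2 - 9 / 2 * a ^+ 2], which is below -1 as [1 <= a]. *)
Let k := 3 * a.
Let sd i := Num.sqrt (c i i).
Let sd_ge i : s <= sd i.
Proof.
by rewrite -[leLHS](ger0_norm (ltW s_gt0)) -sqrtr_sqr ler_sqrt// (le_trans (sqr_ge0 s)).
Qed.
Let sd_gt0 i : 0 < sd i. Proof. exact: lt_le_trans (sd_ge i). Qed.
Let sd2 i : sd i * sd i = c i i.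
Proof. by rewrite -expr2 sqr_sqrtr// (le_trans (sqr_ge0 s)). Qed.
Let t i := k / sd i.
(** The Cameron-Martin density: its mean is 1 and its joint moments depend only on correlations. *)
Let Y i w := expR (t i * W (A i) w - k ^+ 2 / 2).

Let lW i : linear_comb W (@noise_index R) (W (A i)).
Proof. exact: linear_comb1. Qed.

Let pair i j w := t i * W (A i) w + t j * W (A j) w.
Let lpair i j : linear_comb W (@noise_index R) (pair i j).
Proof. by apply: linear_combD; exact: linear_combZ. Qed.

Let iXX i j : integrableP (fun w => W (A i) w * W (A j) w).
Proof. exact: (integrable_mul_linear_comb W_noise noise_sub (lW i) (lW j)). Qed.

Let exp_comb f : linear_comb W (@noise_index R) f ->
  integrableP (fun w => expR (f w)) /\
  Ex (fun w => expR (f w)) = expR (2^-1 * Ex (fun w => f w ^+ 2)).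
Proof.
move=> lf; have mf := measurable_linear_comb lf.
have gf := gaussian_linear_comb W_noise noise_sub lf.
have f0 := mean_linear_comb W_noise noise_sub lf.
have e : (fun w => expR (f w)) = (fun w => expR (1 * f w)).
  by apply/funext => w; rewrite mul1r.
rewrite e; split; first exact: (gaussian_integrable_expR mf gf f0 1).
by rewrite (gaussian_expR mf gf f0) expr1n mul1r.
Qed.

Let Y_mean i : integrableP (Y i) /\ Ex (Y i) = 1.
Proof.
have [i1 e1] := exp_comb (linear_combZ (t i) (lW i)).
have -> : Y i = (fun w => expR (- (k ^+ 2 / 2)) * expR (t i * W (A i) w)).
  by apply/funext => w; rewrite /Y expRD mulrC.
split; first exact: integrable_mulrl.
rewrite RintegralZl// e1.
have -> : (fun w => (t i * W (A i) w) ^+ 2) = (fun w => t i ^+ 2 * (W (A i) w * W (A i) w)).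
  by apply/funext => w; rewrite exprMn expr2.
rewrite RintegralZl// (cov_noise W_noise)// -/(c i i) -sd2 -expRD.
have -> : - (k ^+ 2 / 2) + 2^-1 * (t i ^+ 2 * (sd i * sd i)) = 0.
  have key (x y : R) : y != 0 -> - (x ^+ 2 / 2) + 2^-1 * ((x / y) ^+ 2 * (y * y)) = 0.
    by move=> y0; field.
  by apply: key; rewrite gt_eqF.
by rewrite expR0.
Qed.

Let YY_mean i j : integrableP (fun w => Y i w * Y j w) /\
  Ex (fun w => Y i w * Y j w) = expR (k ^+ 2 * (c i j / (sd i * sd j))).
Proof.
have [i1 e1] := exp_comb (lpair i j).
have -> : (fun w => Y i w * Y j w) = (fun w => expR (- k ^+ 2) * expR (pair i j w)).
  have key (x y r : R) : x - r / 2 + (y - r / 2) = - r + (x + y) by field.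
  by apply/funext => w; rewrite /Y -!expRD /pair key.
split; first exact: integrable_mulrl.
rewrite RintegralZl// e1 -expRD; congr expR.
have -> : (fun w => pair i j w ^+ 2) = (fun w => t i ^+ 2 * (W (A i) w * W (A i) w) +
    (2 * t i * t j * (W (A i) w * W (A j) w) + t j ^+ 2 * (W (A j) w * W (A j) w))).
  have key (x y z v : R) : (x * z + y * v) ^+ 2 =
      x ^+ 2 * (z * z) + (2 * x * y * (z * v) + y ^+ 2 * (v * v)) by ring.
  by apply/funext => w; exact: key.
have iZ r i' j' : integrableP (fun w => r * (W (A i') w * W (A j') w)).
  exact: integrable_mulrl.
have ZE r i' j' : Ex (fun w => r * (W (A i') w * W (A j') w)) = r * c i' j'.
  by rewrite RintegralZl//; congr (_ * _); exact: cov_noise.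
have e2 := RintegralD measurableT (iZ (2 * t i * t j) i j) (iZ (t j ^+ 2) j j).
have e3 := RintegralD measurableT (iZ (t i ^+ 2) i i)
  (integrable_addr measurableT (iZ (2 * t i * t j) i j) (iZ (t j ^+ 2) j j)).
rewrite e3 e2 !ZE.
rewrite -(sd2 i) -(sd2 j).
have key (x y z v : R) : y != 0 -> z != 0 -> - x ^+ 2 + 2^-1 *
    ((x / y) ^+ 2 * (y * y) + (2 * (x / y) * (x / z) * v + (x / z) ^+ 2 * (z * z))) =
    x ^+ 2 * (v / (y * z)) by move=> y0 z0; field; rewrite y0 z0.
by apply: key; rewrite gt_eqF.
Qed.

(** If no variable exceeds the threshold, every [Y i] is at most 1/2 although its mean is 1, so the
    sum of the [Y i - 1] is at most [- N / 2]; Chebyshev's inequality bounds this event by the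
    variance of the sum. A diagonal term is at most [expR (9 * a ^+ 2)], and a pair of distinct
    indices contributes at most [expR (9 * a ^+ 2 * eps) - 1]. In this way exponential moments
    replace a lower bound for Gaussian tails. *)
Lemma second_moment :
  (P [set w | forall i, (i < N)%N -> (W (A i) w <= a * s)%R] <=
   (4 * (expR (9 * a ^+ 2) / N%:R + expR (9 * a ^+ 2 * eps) - 1))%:E)%E.
Proof.
set E := [set w | _].
have mW i : measurable_fun setT (W (A i)) by exact: measurable_funPT.
have mE : measurable E.
  have -> : E = \bigcap_(i in `I_N) (W (A i) @^-1` `]-oo, (a * s)]%classic).
    by apply/seteqP; split => w h i /h; rewrite /= in_itv.
  apply: bigcap_measurable => //; first by exists 0%N.
  move=> i _; exact: measurable_funPTI.
pose g (i j : 'I_N) w := Y i w * Y j w - Y i w - Y j w + 1.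
have ig i j : integrableP (g i j).
  apply: (integrable_addr measurableT); last exact: finite_measure_integrable_cst.
  apply: (integrable_subr measurableT); last exact: (Y_mean _).1.
  by apply: (integrable_subr measurableT); [exact: (YY_mean _ _).1|exact: (Y_mean _).1].
have eg i j : Ex (g i j) = expR (k ^+ 2 * (c i j / (sd i * sd j))) - 1.
  rewrite RintegralD//; last 2 first.
    apply: (integrable_subr measurableT); last exact: (Y_mean _).1.
    by apply: (integrable_subr measurableT); [exact: (YY_mean _ _).1|exact: (Y_mean _).1].
    exact: finite_measure_integrable_cst.
  rewrite RintegralB//; last 2 first.
    by apply: (integrable_subr measurableT); [exact: (YY_mean _ _).1|exact: (Y_mean _).1].
    exact: (Y_mean _).1.
  rewrite RintegralB//; [|exact: (YY_mean _ _).1|exact: (Y_mean _).1].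
  rewrite (YY_mean _ _).2 !(Y_mean _).2.
  have -> : Ex (fun=> 1) = 1 :> R.
    have := Rintegral_cst P measurableT (1 : R); rewrite mul1r => ->.
    exact: (congr1 fine (probability_setT P)).
  by rewrite subrK.
pose Z w := \sum_(i < N) (Y i w - 1).
have ZE w : Z w ^+ 2 = \sum_(i < N) \sum_(j < N) g i j w.
  rewrite expr2 /Z mulr_suml; apply: eq_bigr => i _.
  rewrite mulr_sumr; apply: eq_bigr => j _; rewrite /g.
  have key (x y : R) : (x - 1) * (y - 1) = x * y - x - y + 1 by ring.
  exact: key.
have [ih eh] : integrableP (fun w => Z w ^+ 2) /\
    Ex (fun w => Z w ^+ 2) = \sum_(i < N) \sum_(j < N) Ex (g i j).
  have -> : (fun w => Z w ^+ 2) = (fun w => \sum_(i < N) \sum_(j < N) g i j w).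
    exact/funext.
  have [i1 e1] := Rintegral_sum (fun i => (Rintegral_sum (ig i)).1).
  split => //; rewrite e1; apply: eq_bigr => i _; exact: (Rintegral_sum (ig i)).2.
have a0 : 0 <= a by exact: le_trans ler01 a_ge1.
have eZ : Ex (fun w => Z w ^+ 2) <=
    N%:R * expR (9 * a ^+ 2) + N%:R ^+ 2 * (expR (9 * a ^+ 2 * eps) - 1).
  have k2 : k ^+ 2 = 9 * a ^+ 2 by rewrite /k exprMn !expr2; congr (_ * _); ring.
  rewrite eh; apply: (@le_trans _ _ (\sum_(i < N) \sum_(j < N)
     ((i == j)%:R * expR (9 * a ^+ 2) + (expR (9 * a ^+ 2 * eps) - 1)))).
    apply: ler_sum => i _; apply: ler_sum => j _; rewrite eg k2.
    have [<-|ij] := eqVneq i j.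
      rewrite -sd2 divff ?mulf_neq0 ?gt_eqF// !mulr1 mul1r.
      have e1 : 0 <= expR (9 * a ^+ 2 * eps) by exact: expR_ge0.
      lra.
    rewrite mul0r add0r lerD2r ler_expR ler_wpM2l ?mulr_ge0 ?sqr_ge0//.
    rewrite ler_pdivrMr ?mulr_gt0//; apply: le_trans (c_cross ij) _.
    (* Two distinct indices exist here, and covariances are nonnegative. *)
    have eps0 : 0 <= eps.
      have := le_trans (c_ge0 i j) (c_cross ij).
      by rewrite pmulr_lge0// exprn_gt0.
    by rewrite ler_wpM2l// expr2 ler_pM// ltW.
  rewrite (eq_bigr (fun=> expR (9 * a ^+ 2) + N%:R * (expR (9 * a ^+ 2 * eps) - 1))); last first.
    move=> i _; rewrite big_split/= sumr_const card_ord -[_ *+ N]mulr_natl; congr (_ + _).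
    rewrite (bigD1 i)//= eqxx mul1r big1 ?addr0// => j ji.
    by rewrite eq_sym (negbTE ji) mul0r.
  rewrite sumr_const card_ord -[_ *+ N]mulr_natl le_eqVlt; apply/orP; left; apply/eqP.
  have key (n x y : R) : n * (x + n * y) = n * x + n ^+ 2 * y by ring.
  exact: key.
have ZN w : E w -> N%:R ^+ 2 / 4 <= Z w ^+ 2.
  move=> Ew; have hY i : (i < N)%N -> Y i w <= 2^-1.
    move=> iN; apply: (@le_trans _ _ (expR (- 1))); last first.
      rewrite expRN lef_pV2 ?posrE ?expR_gt0//.
      by have := expR_ge1Dx (1 : R); lra.
    rewrite ler_expR /t.
    have : k / sd i * W (A i) w <= k * a.
      have k0 : 0 <= k by rewrite mulr_ge0.
      have h1 : W (A i) w <= a * sd i.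
        by apply: le_trans (Ew i iN) _; rewrite ler_wpM2l.
      rewrite -mulrA ler_wpM2l// mulrC ler_pdivrMr//.
    have aa : 1 <= a * a by rewrite -[leLHS]mulr1 ler_pM.
    by rewrite expr2 /k; lra.
  have : Z w <= \sum_(i < N) - 2^-1.
    by apply: ler_sum => i _; have := hY i (ltn_ord i); lra.
  rewrite sumr_const card_ord -[_ *+ N]mulr_natr => hZ.
  have N0 : 0 <= N%:R :> R by [].
  by rewrite !expr2; nra.
have PE : ((N%:R ^+ 2 / 4)%:E * P E <= (Ex (fun w => Z w ^+ 2))%:E)%E.
  rewrite -integral_cst// fineK; last exact: integrable_fin_num.
  apply: (@le_trans _ _ (\int[P]_(w in E) (Z w ^+ 2)%:E)%E).
    apply: ge0_le_integral => //.
    - by move=> w _; rewrite lee_fin divr_ge0// sqr_ge0.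
    - by apply: (measurable_funS measurableT) => //; exact: (measurable_int _ ih).
  apply: ge0_subset_integral => //; first exact: (measurable_int _ ih).
  by move=> w _; rewrite lee_fin sqr_ge0.
have NR : 0 < N%:R :> R by rewrite ltr0n.
have PEf : P E = (fine (P E))%:E by rewrite fineK// fin_num_measure.
move: PE; rewrite PEf -EFinM !lee_fin => PE.
have := le_trans PE eZ.
rewrite -ler_pdivlMl ?divr_gt0 ?exprn_gt0// => h; apply: le_trans h _.
rewrite le_eqVlt; apply/orP; left; apply/eqP.
have key (n x y : R) : n != 0 -> (n ^+ 2 / 4)^-1 * (n * x + n ^+ 2 * (y - 1)) =
  4 * (x / n + y - 1) by move=> n0; field.
by apply: key; rewrite gt_eqF.
Qed.

End second_moment.

(** * Asymptotics of the scales *)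

Section asymptotics.
Context (R : realType).

Lemma ln_pow4_bounds m : m%:R <= ln (4 ^+ m : R) <= m%:R * 4.
Proof.
rewrite lnXn// -[ln 4 *+ m]mulr_natl.
have e4 : ln 4 = 2 * ln 2 :> R.
  have -> : 4 = 2 ^+ 2 :> R by rewrite expr2; ring.
  by rewrite lnXn// mulr2n; lra.
have h4 : 1 <= ln (4 : R) <= 4.
  apply/andP; split; first by have := ln2_ge_half R; lra.
  by rewrite ltW// ln_sublinear.
have /andP[h1 h2] := h4.
apply/andP; split; last by rewrite ler_wpM2l.
by rewrite -[leLHS]mulr1 ler_wpM2l.
Qed.

Lemma near_loglog (A : R) : \forall m \near \oo, A <= ln (ln (4 ^+ m : R)).
Proof.
near=> m.
have hm : expR A <= m%:R by near: m; exact: nbhs_infty_ger.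
have /andP[h1 _] := ln_pow4_bounds m.
rewrite -ler_expR lnK; first exact: le_trans hm h1.
by rewrite posrE; apply: lt_le_trans h1; apply: lt_le_trans hm; exact: expR_gt0.
Unshelve. all: by end_near. Qed.

Lemma lil_gauge_pow4 (beta : R) m :
  lil_gauge beta (4 ^- m : R) = Num.sqrt ((4 ^- m) `^ (2 - beta) * ln (ln (4 ^+ m))).
Proof. by rewrite /lil_gauge div1r invrK. Qed.

Lemma cvg_expn_div_pow2 k : m%:R ^+ k / 2 ^+ m @[m --> \oo] --> (0 : R).
Proof.
case: k => [|k].
  have h : (2^-1 : R) ^+ m @[m --> \oo] --> (0 : R).
    by apply: cvg_expr; rewrite ger0_norm// invf_lt1// ltr1n.
  have -> // : (fun m => m%:R ^+ 0 / 2 ^+ m) = (fun m => (2^-1 : R) ^+ m).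
  by apply/funext => m; rewrite expr0 div1r exprVn.
(* With [x] the root of order [k.+1] of 1/2, the sequence is the power [k.+1] of [m * x ^+ m]. *)
pose x : R := 2^-1 `^ (k.+1%:R^-1).
have x01 : 0 <= x < 1.
  have k0 : 0 < k.+1%:R^-1 :> R by rewrite invr_gt0.
  rewrite powR_ge0/= /x; have := @gt0_ltr_powR R _ k0 2^-1 1.
  by rewrite powR1 !nnegrE invr_ge0 ler0n ler01 => /(_ isT isT); apply; rewrite invf_lt1// ltr1n.
have h := cvg_mulrn_expr x01.
have -> : (fun m => m%:R ^+ k.+1 / 2 ^+ m) = (fun m => (m%:R * x ^+ m) ^+ k.+1).
  apply/funext => m; rewrite exprMn; congr (_ * _).
  rewrite exprAC -(powR_mulrn k.+1) ?powR_ge0// /x -powRrM mulVf ?pnatr_eq0//.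
  by rewrite powRr1// exprVn.
by have := cvg_comp _ _ h (@exprn_continuous _ k.+1 0); rewrite expr0n.
Qed.

Lemma cvg_mul_powR (beta : R) : 0 < beta ->
  m%:R * (2 / 2 ^+ m) `^ beta @[m --> \oo] --> (0 : R).
Proof.
move=> b0; pose y : R := 2^-1 `^ beta.
have y01 : 0 <= y < 1.
  rewrite powR_ge0/= /y; have := @gt0_ltr_powR R beta b0 2^-1 1.
  by rewrite powR1 !nnegrE invr_ge0 ler0n ler01 => /(_ isT isT); apply; rewrite invf_lt1// ltr1n.
have -> : (fun m => m%:R * (2 / 2 ^+ m) `^ beta) = (fun m => 2 `^ beta * (m%:R * y ^+ m)).
  apply/funext => m; rewrite powRM// ?invr_ge0 ?exprn_ge0// mulrCA; congr (_ * (_ * _)).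
  have h2 : 0 <= 2^-1 :> R by rewrite invr_ge0.
  rewrite -exprVn -(powR_mulrn m h2) -powRrM mulrC powRrM.
  by rewrite powR_mulrn// powR_ge0.
have h := cvg_mulrn_expr y01.
by rewrite -[X in _ --> X](mulr0 (2 `^ beta)); apply: cvgMl_tmp.
Qed.

End asymptotics.

(** * Estimates at a single scale *)

Section stage.
Context (R : realType) (d : measure_display) (Omega : measurableType d)
  (P : probability Omega R) (beta tau0 : R) (W : set (R * R) -> {RV P >-> R})
  (u : R -> R -> {RV P >-> R}).
Hypothesis beta01 : 0 < beta < 1.
Hypothesis tau0_gt0 : 0 < tau0.
Hypothesis W_noise : colored_noise beta W.
Hypothesis u_sol : continuous_solution W u.

Lemma measurable_forall_lt N (F : nat -> set Omega) : (forall i, measurable (F i)) ->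
  measurable [set w | forall i, (i < N)%N -> F i w].
Proof. by move=> mF; apply: (@fin_bigcap_measurable _ _ _ `I_N F). Qed.

(** The squared threshold exceeds the variance by a factor of order [ln (ln (4 ^+ m))], which
    diverges. Since scales may be chosen as sparse as desired, smallness without a rate suffices. *)
Lemma high_small (c eps : R) : 0 < c -> 0 < eps -> \forall m \near \oo,
  forall x, 0 <= x <= 2 ->
  (P [set w | (c * lil_gauge beta (4 ^- m) < `|W (high tau0 x (4 ^- m)) w|)%R] <= eps%:E)%E.
Proof.
move=> c0 eps0; have [K K0 hK] := high_cov_le tau0 beta01 3.
near=> m => x /andP[x0 x2].
have h0 : 0 < 4 ^- m :> R by rewrite invr_gt0 exprn_gt0.
have h1 : 4 ^- m <= 1 :> R by rewrite invf_le1 ?exprn_gt0// exprn_ege1// ler1n.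
have hh : x + 4 ^- m <= 3 by lra.
have p0 : 0 < (4 ^- m) `^ (2 - beta) :> R by rewrite powR_gt0.
have v0 : 0 < K * (4 ^- m) `^ (2 - beta) by rewrite mulr_gt0.
have L0 : Num.max 0 (ln (2 / eps) * (2 * K) / c ^+ 2) <= ln (ln (4 ^+ m)).
  by near: m; exact: near_loglog.
move: L0; rewrite ge_max => /andP[L0 L1].
have g0 : 0 <= c * lil_gauge beta (4 ^- m) by rewrite mulr_ge0 ?sqrtr_ge0// ltW.
apply: le_trans (noise_tail W_noise (noise_index_high tau0 x _) (hK _ _ x0 h0 hh) v0 g0) _.
rewrite lee_fin lil_gauge_pow4 exprMn sqr_sqrtr ?mulr_ge0 ?(ltW p0)//.
set L := ln (ln _) in L0 L1 *; set p := _ `^ _ in p0 v0 *.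
have -> : c ^+ 2 * (p * L) / (K * p *+ 2) = L * c ^+ 2 / (2 * K).
  by rewrite -mulr_natr; field; rewrite !gt_eqF.
rewrite mulrC -ler_pdivlMr// -[leRHS]lnK ?posrE ?divr_gt0// ler_expR.
rewrite lerNl -lnV ?posrE ?divr_gt0// invf_div ler_pdivlMr ?mulr_gt0//.
by rewrite -ler_pdivrMr ?exprn_gt0.
Unshelve. all: by end_near. Qed.

(** The candidates fill the left half of an interval of length [2 ^- r]. Only distances between them
    enter, which makes the estimate uniform in the starting index [j]; the union over all starting
    points relies on this. *)
Lemma low_small (r : nat) (c eps : R) : 0 < c -> 0 < eps -> \forall m \near \oo,
  forall j : nat,
  (P [set w | forall i, (i < 2 ^ (m - r.+1))%N ->
     (`|W (low tau0 ((j + i)%:R / 2 ^+ m) (4 ^- m)) w| <=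
       c * lil_gauge beta (4 ^- m))%R] <= eps%:E)%E.
Proof.
move=> c0 eps0; have r0 := sqrt2_gt0 R; have /andP[b0 b1] := beta01.
pose k0 := tau0 / r2 * r2 `^ (2 - beta).
have k0_gt0 : 0 < k0 by rewrite mulr_gt0 ?powR_gt0 ?divr_gt0.
pose q := c ^+ 2 / k0.
have q0 : 0 < q by rewrite divr_gt0// exprn_gt0.
(* An integer above [9 * q], so that [expR (9 * a ^+ 2)] is at most the power [k] of
   [ln (4 ^+ m)]. *)
pose k := (Num.truncn (9 * q)).+1.
have kq : 9 * q <= k%:R by rewrite ltW// truncnS_gt.
(* The bound of [second_moment], with [ln (4 ^+ m)] and its logarithm both replaced by [4 * m]. *)
pose b m : R := 4 * (4 ^+ k * 2 ^+ r.+1 * (m%:R ^+ k / 2 ^+ m) +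
  expR (k%:R * 4 * (m%:R * (2 / 2 ^+ m) `^ beta)) - 1).
have cb : b m @[m --> \oo] --> (0 : R).
  have h1 := @cvg_expn_div_pow2 R k.
  have h2 := cvg_mul_powR b0.
  have h3 : 4 ^+ k * 2 ^+ r.+1 * (m%:R ^+ k / 2 ^+ m) @[m --> \oo] --> (0 : R).
    by rewrite -[X in _ --> X](mulr0 (4 ^+ k * 2 ^+ r.+1)); apply: cvgMl_tmp.
  have h4 : expR (k%:R * 4 * (m%:R * (2 / 2 ^+ m) `^ beta)) @[m --> \oo] --> (1 : R).
    have h5 : k%:R * 4 * (m%:R * (2 / 2 ^+ m) `^ beta) @[m --> \oo] --> (0 : R).
      by rewrite -[X in _ --> X](mulr0 (k%:R * 4)); apply: cvgMl_tmp.
    by have := cvg_comp _ _ h5 (@continuous_expR R 0); rewrite expR0.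
  have h5 := @cvgMl_tmp _ _ _ _ _ (4 : R) _ (cvgB (cvgD h3 h4) (@cvg_cst _ (1 : R) _ _ _)).
  by move: h5; rewrite add0r subrr mulr0; apply.
near=> m => j.
have h0 : 0 < 4 ^- m :> R by rewrite invr_gt0 exprn_gt0.
have rm : (r.+1 <= m)%N by near: m; exact: nbhs_infty_ge.
have bm : b m <= eps by near: m; apply: (cvgr_le _ cb).
have L0 : Num.max 0 (q^-1) <= ln (ln (4 ^+ m)) by near: m; exact: near_loglog.
move: L0; rewrite ge_max; set L := ln (ln _) => /andP[L0 Lq].
pose s := Num.sqrt (tau0 / r2 * (r2 * 4 ^- m) `^ (2 - beta)).
have s2E : tau0 / r2 * (r2 * 4 ^- m) `^ (2 - beta) = k0 * (4 ^- m) `^ (2 - beta).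
  by rewrite powRM ?(ltW r0) ?(ltW h0)// mulrA.
have p0 : 0 < (4 ^- m) `^ (2 - beta) :> R by rewrite powR_gt0.
have s2 : s ^+ 2 = tau0 / r2 * (r2 * 4 ^- m) `^ (2 - beta).
  by rewrite sqr_sqrtr// s2E ltW// mulr_gt0.
have s0 : 0 < s by rewrite sqrtr_gt0 s2E mulr_gt0.
pose a := c * lil_gauge beta (4 ^- m) / s.
have aE : a ^+ 2 = q * L.
  rewrite /a lil_gauge_pow4 !exprMn exprVn s2 s2E sqr_sqrtr ?mulr_ge0 ?(ltW p0)//.
  by rewrite -/L /q; field; rewrite !gt_eqF.
have a1 : 1 <= a.
  rewrite -(@ler_pXn2r _ 2) ?nnegrE ?ler01 ?divr_ge0 ?mulr_ge0 ?sqrtr_ge0 ?(ltW c0)//.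
  by rewrite expr1n aE mulrC -ler_pdivrMr// div1r.
have e0 n : 0 < 2 ^+ n :> R by rewrite exprn_gt0.
pose eps' : R := (2 / 2 ^+ m) `^ beta.
pose x i : R := (j + i)%:R / 2 ^+ m.
have x0 i : 0 <= x i by rewrite divr_ge0// ltW.
have N0 : (0 < 2 ^ (m - r.+1))%N by rewrite expn_gt0.
have fourE : 4 ^- m = (2 ^+ m)^-1 / 2 ^+ m :> R.
  by rewrite -invfM -exprMn; congr (_ ^- _); ring.
have cross i i' : i != i' -> (noise_cov beta (low tau0 (x i) (4 ^- m))
    (low tau0 (x i') (4 ^- m)) <= (eps' * s ^+ 2)%:E)%E.
  (* Left ends of neighbouring bands are [r2 * 2 ^- m] apart. Half of this is the gap [e], the other
     half covers the width [r2 * 4 ^- m], as [m] is positive. *)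
  move=> ii'; pose e : R := r2 * (2 ^+ m)^-1 / 2.
  have ep : 0 < e by rewrite divr_gt0 ?mulr_gt0 ?invr_gt0.
  have gap : r2 * 4 ^- m + e <= r2 * `|x i - x i'|.
    have h1 : (2 ^+ m)^-1 <= `|x i - x i'|.
      rewrite /x -mulrBl normrM (ger0_norm (x := (2 ^+ m)^-1)) ?invr_ge0 ?(ltW (e0 _))//.
      rewrite -[leLHS]mul1r ler_pM2r ?invr_gt0// !natrD opprD addrACA subrr add0r.
      have dist n n' : (n < n')%N -> 1 <= `|n'%:R - n%:R| :> R.
        by move=> nn'; rewrite -natrB ?(ltnW nn')// ger0_norm ?ler0n// ler1n subn_gt0.
      by move: ii'; rewrite neq_ltn => /orP[/dist|/dist]; rewrite // distrC.
    have h2 : 4 ^- m <= (2 ^+ m)^-1 / 2 :> R.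
      rewrite fourE ler_pM2l ?invr_gt0// lef_pV2 ?posrE// -[leLHS]expr1 ler_eXn2l ?ltr1n//.
      exact: leq_trans rm.
    rewrite /e -[_ / 2]mulrA -mulrDr ler_pM2l//; lra.
  apply: le_trans (low_cov_gap_le beta01 tau0_gt0 (ltW h0) ep gap) _.
  rewrite lee_fin s2 [leRHS]mulrCA ler_pM2l ?divr_gt0//.
  (* The ratio of width to gap is [2 / 2 ^+ m], and [eps'] is its power [beta]. *)
  have hE : r2 * 4 ^- m = e * (2 / 2 ^+ m).
    by rewrite fourE /e; field; rewrite gt_eqF.
  have z0 : (0 : R) < r2 * 4 ^- m by rewrite mulr_gt0.
  have -> : (r2 * 4 ^- m) ^+ 2 = (r2 * 4 ^- m) `^ (2 - beta) * (r2 * 4 ^- m) `^ beta.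
    rewrite -powR_mulrn ?(ltW z0)// -powRD; last first.
      by apply/implyP => _; rewrite gt_eqF.
    by congr (_ `^ _); ring.
  have -> : (r2 * 4 ^- m) `^ beta = e `^ beta * eps'.
    by rewrite hE powRM ?(ltW ep)// divr_ge0// ltW.
  rewrite powRN; set A := _ `^ (2 - beta).
  rewrite le_eqVlt; apply/orP; left; apply/eqP.
  by field; rewrite gt_eqF// powR_gt0.
have self i : ((s ^+ 2)%:E <= noise_cov beta (low tau0 (x i) (4 ^- m))
    (low tau0 (x i) (4 ^- m)))%E.
  by rewrite s2; exact: low_cov_ge.
have sm := second_moment W_noise (fun i => noise_index_low tau0 (x i) (4 ^- m)) s0 a1 N0 self cross.
apply: (@le_trans _ _ (P [set w | forall i, (i < 2 ^ (m - r.+1))%N ->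
    (W (low tau0 (x i) (4 ^- m)) w <= a * s)%R])).
  apply: le_measure; rewrite ?inE.
  - apply: measurable_forall_lt => i.
    by apply: measurable_norm_le; exact: measurable_funPT.
  - apply: measurable_forall_lt => i.
    rewrite [X in measurable X](_ : _ =
        W (low tau0 (x i) (4 ^- m)) @^-1` `]-oo, (a * s)]%classic).
      exact: measurable_funPTI.
    by apply/seteqP; split => w /=; rewrite in_itv.
  - move=> w h i iN; have := h i iN; rewrite /a divfK ?gt_eqF// => /(le_trans (ler_norm _)).
    exact.
apply: le_trans sm _; rewrite lee_fin; apply: le_trans bm; rewrite /b ler_pM2l//.
have /andP[l1 l2] := ln_pow4_bounds R m.
have m0 : 0 < m%:R :> R by rewrite ltr0n (leq_trans _ rm).
have ln0 : 0 < ln (4 ^+ m) :> R by exact: lt_le_trans l1.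
have kL : 9 * a ^+ 2 <= k%:R * L by rewrite aE mulrA ler_wpM2r.
rewrite lerD2r; apply: lerD.
  rewrite natrX.
  have -> : (2 ^+ (m - r.+1))^-1 = 2 ^+ r.+1 / 2 ^+ m :> R.
    by rewrite -[in RHS](subnK rm) exprD; field; rewrite !gt_eqF.
  have key (y z v v' : R) : y * z * (v / v') = v * y * (z / v') by ring.
  rewrite key -exprMn.
  rewrite ler_wpM2r ?divr_ge0 ?(ltW (e0 _))//.
  apply: (@le_trans _ _ (expR (k%:R * L))); first by rewrite ler_expR.
  by rewrite expRM_natl lnK ?posrE// ler_pXn2r// ?nnegrE ?(ltW ln0)// mulr_ge0.
rewrite ler_expR -/eps'.
have -> : k%:R * 4 * (m%:R * eps') = k%:R * (m%:R * 4) * eps' by ring.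
rewrite ler_wpM2r ?powR_ge0//; apply: le_trans kL _; rewrite ler_wpM2l//.
by apply: le_trans l2; rewrite ltW// ln_sublinear.
Unshelve. all: by end_near. Qed.

End stage.

(** * Modulus of continuity of the paths *)

Section oscillation.
Context (R : realType) (d : measure_display) (Omega : measurableType d)
  (P : probability Omega R) (tau0 : R) (W : set (R * R) -> {RV P >-> R})
  (u : R -> R -> {RV P >-> R}).
Hypothesis tau0_gt0 : 0 < tau0.
Hypothesis u_sol : continuous_solution W u.

Let path_cvg w T (F : set_system T) (FF : Filter F) (g : T -> R) (x : R) :
  {within @half_plane R, continuous (fun p => u p.1 p.2 w)} -> 0 <= x ->
  g @ F --> x -> (\forall t \near F, 0 <= g t) ->
  rotate u tau0 (g t) w @[t --> F] --> rotate u tau0 x w.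
Proof.
move=> cw x0 gx g0; apply: (rotate_cvg FF cw (@cvg_cst _ tau0 _ _ _) gx).
  by rewrite addr_ge0// ltW.
by apply: filterS g0 => t ?; rewrite addr_ge0// ltW.
Qed.

Let near_pow2 (c : R) : 0 < c -> \forall r \near \oo, 2 / 2 ^+ r < c.
Proof.
move=> c0; near=> r; rewrite ltr_pdivrMr ?exprn_gt0// mulrC -ltr_pdivrMr//.
apply: (@lt_trans _ _ r%:R); first by near: r; exact: nbhs_infty_gtr.
by rewrite -natrX ltr_nat ltn_expl.
Unshelve. all: by end_near. Qed.

Let path_unif_continuous w (eta : R) :
  {within @half_plane R, continuous (fun p => u p.1 p.2 w)} -> 0 < eta ->
  exists r, forall x y, 0 <= x <= 4 -> 0 <= y <= 4 -> `|x - y| <= 2 / 2 ^+ r ->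
    `|rotate u tau0 x w - rotate u tau0 y w| <= eta.
Proof.
move=> cw eta0.
pose K : set R := [set x | 0 <= x <= 4].
have cK : compact K.
  have -> : K = `[0, 4]%classic by apply/seteqP; split => x /=; rewrite in_itv.
  exact: segment_compact.
pose Q (r : nat) (x : R) := forall y, 0 <= y <= 4 -> `|x - y| <= 2 / 2 ^+ r ->
    `|rotate u tau0 x w - rotate u tau0 y w| <= eta.
(* A modulus valid near each point becomes uniform by compactness, used in its near-covering
   form. *)
have : \forall r \near \oo, K `<=` Q r.
  move/compact_near_coveringP/near_covering_withinP : cK; apply => x Kx.
  have /andP[x0 _] : 0 <= x <= 4 := Kx.
  have c : rotate u tau0 z w @[z --> within K (nbhs x)] --> rotate u tau0 x w.
    apply: path_cvg => //.
      by apply: (cvg_within_filter (F := nbhs x)); exact: cvg_id.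
    by apply: filterS (withinT K _) => z /andP[].
  have eta2 : 0 < eta / 2 by rewrite divr_gt0.
  have /cvgrPdist_le/(_ _ eta2) [e /= e0 he] := c.
  have e2 : 0 < e / 2 by rewrite divr_gt0.
  exists (ball x (e / 2), [set r | 2 / 2 ^+ r < e / 2]) => /=.
    by split; [exact: nbhsx_ballx|exact: near_pow2].
  move=> [x' r] [/= hx' hr] Kx' y Ky hy.
  have h1 : `|rotate u tau0 x w - rotate u tau0 x' w| <= eta / 2.
    by apply: he => //; apply: lt_trans hx' _; rewrite ltr_pdivrMr// ltr_pMr// ltr1n.
  have h2 : `|rotate u tau0 x w - rotate u tau0 y w| <= eta / 2.
    apply: he => //=; have := ler_distD x' x y; rewrite /ball/= in hx'.
    by move=> ?; lra.
  have -> : rotate u tau0 x' w - rotate u tau0 y w =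
    (rotate u tau0 x w - rotate u tau0 y w) - (rotate u tau0 x w - rotate u tau0 x' w) by ring.
  by apply: le_trans (ler_normB _ _) _; lra.
by move=> /filter_ex[r hr]; exists r => x y Kx; exact: hr.
Qed.

(** Continuous paths are uniformly continuous on [0, 4], so the events of failure at distance
    [2 ^- r] decrease to a null event and their probabilities tend to 0. To be measurable, [O] tests
    dyadic points only. *)
Lemma small_oscillation (eta eps : R) m : 0 < eta -> 0 < eps ->
  exists r (O : set Omega), [/\ (m <= r)%N, measurable O, (P O <= eps%:E)%E &
    {ae P, forall w, ~ O w -> forall x y, 0 <= x <= 4 -> 0 <= y <= 4 ->
       `|x - y| <= 2 ^- r -> `|rotate u tau0 x w - rotate u tau0 y w| <= eta}].
Proof.
move=> eta0 eps0; have [_ cu] := u_sol.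
have e0 n : 0 < 2 ^+ n :> R by rewrite exprn_gt0.
pose q (j k : nat) : R := k%:R / 2 ^+ j.
have q0 j k : 0 <= q j k by rewrite divr_ge0// ltW.
(* The distance allowed here is twice that of the conclusion, which leaves room to replace two
   points by dyadic approximations of a common level. *)
pose F (r j k l : nat) : set Omega :=
  if [&& q j k <= 4, q j l <= 4 & `|q j k - q j l| <= 2 / 2 ^+ r]
  then [set w | eta < `|rotate u tau0 (q j k) w - rotate u tau0 (q j l) w|] else set0.
have mF r j k l : measurable (F r j k l).
  rewrite /F; case: ifP => // _.
  by apply: measurable_norm_gt; apply: measurable_funB; exact: measurable_funPT.
pose O r := \bigcup_j \bigcup_k \bigcup_l F r j k l.
have mO r : measurable (O r).
  by apply: bigcupT_measurable => j; apply: bigcupT_measurable => k;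
    exact: bigcupT_measurable.
have dO : nonincreasing_seq O.
  move=> r r' rr'; apply/subsetPset => w [j _ [k _ [l _ h]]].
  exists j => //; exists k => //; exists l => //; move: h; rewrite /F.
  case: ifPn => // /and3P[h1 h2 h3] h; rewrite h1 h2/=.
  by rewrite (le_trans h3)// ler_pM2l// lef_pV2 ?posrE// ler_eXn2l// ltr1n.
have mI : measurable (\bigcap_r O r) by exact: bigcapT_measurable.
have PI : P (\bigcap_r O r) = 0%E.
  apply: measure_negligible => //; apply: negligibleS cu => w /= hw cw.
  have [r hr] := path_unif_continuous cw eta0.
  have [j _ [k _ [l _]]] := hw r I; rewrite /F; case: ifP => // /and3P[h1 h2 h3] /=.
  by rewrite ltNge => /negP; apply; apply: hr => //; rewrite q0.
have cO : P \o O @ \oo --> P (\bigcap_n O n).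
  by apply: nonincreasing_cvg_mu => //; rewrite ltey_eq fin_num_measure.
rewrite PI in cO; have /fine_cvgP[_ cO'] := cO.
have near_small : \forall r \near \oo, (fine \o (P \o O)) r <= eps.
  by apply: (cvgr_le _ cO').
have [r [mr Pr]] := filter_ex (filterI (nbhs_infty_ge m) near_small).
exists r, (O r); split => //.
  by move: Pr => /=; rewrite -lee_fin fineK// fin_num_measure.
apply: filterS cu => w cw nO x y hx hy xy.
have /andP[x0 x4] := hx; have /andP[y0 y4] := hy.
have cx := cvg_dyadic x0; have cy := cvg_dyadic y0.
have dy_ge0 (z : R) J : 0 <= (Num.truncn (z * 2 ^+ J))%:R / 2 ^+ J :> R.
  by rewrite divr_ge0// ltW.
have dy_le (z : R) J : 0 <= z <= 4 -> (Num.truncn (z * 2 ^+ J))%:R / 2 ^+ J <= 4 :> R.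
  move=> /andP[z0 z4]; apply: le_trans z4; rewrite ler_pdivrMr// truncn_le.
  by rewrite mulr_ge0// ltW.
have cf : `|rotate u tau0 ((Num.truncn (x * 2 ^+ J))%:R / 2 ^+ J) w -
    rotate u tau0 ((Num.truncn (y * 2 ^+ J))%:R / 2 ^+ J) w| @[J --> \oo] -->
    `|rotate u tau0 x w - rotate u tau0 y w|.
  by apply: cvg_norm; apply: cvgB; apply: path_cvg => //; exact: nearW.
rewrite -(cvg_lim _ cf)//; apply: limr_le; first by apply/cvg_ex; eexists; exact: cf.
have cxy : `|(Num.truncn (x * 2 ^+ J))%:R / 2 ^+ J -
    (Num.truncn (y * 2 ^+ J))%:R / 2 ^+ J| @[J --> \oo] --> `|x - y|.
  by apply: cvg_norm; exact: cvgB.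
have xy2 : `|x - y| < 2 / 2 ^+ r.
  by apply: le_lt_trans xy _; rewrite ltr_pMl ?invr_gt0// ltr1n.
have hxy : \forall J \near \oo, `|(Num.truncn (x * 2 ^+ J))%:R / 2 ^+ J -
    (Num.truncn (y * 2 ^+ J))%:R / 2 ^+ J| <= 2 / 2 ^+ r :> R.
  by apply: (cvgr_le _ cxy).
apply: filterS hxy => J hJ; rewrite leNgt; apply/negP => h.
apply: nO; exists J => //; exists (Num.truncn (x * 2 ^+ J)) => //.
exists (Num.truncn (y * 2 ^+ J)) => //.
by rewrite /F /q !dy_le// hJ.
Qed.

End oscillation.

(** * The singular point *)

Section last_hit.
Implicit Types b : nat -> bool.

(** A selection rule given by recursion, so that its measurability is an induction. It returns 0
    when nothing is hit. *)
Fixpoint last_hit (b : nat -> bool) (N : nat) : nat :=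
  if N is N'.+1 then if b N' then N' else last_hit b N' else 0%N.

Lemma last_hitP b N i : (i < N)%N -> b i -> b (last_hit b N).
Proof.
elim: N => // N ih; rewrite ltnS leq_eqVlt /= => /predU1P[-> bN|iN bi].
  by rewrite bN.
by case: ifP => // _; exact: ih.
Qed.

Lemma last_hit_lt b N : (0 < N)%N -> (last_hit b N < N)%N.
Proof.
case: N => // N _; rewrite ltnS; elim: N => [|N ih] /=; first by case: ifP.
by case: ifP => // _; exact: leqW.
Qed.

End last_hit.

Section past_index.
Context (R : realType) (d : measure_display) (Omega : measurableType d)
  (P : probability Omega R) (tau0 : R) (W : set (R * R) -> {RV P >-> R}).
Notation past := (<<s past_events W tau0 >>).

Let T := g_sigma_algebraType (past_events W tau0).
Let pastE (E : set Omega) : past E = measurable (E : set T). Proof. by []. Qed.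

Lemma past_low x h (a : R) : past [set w | a < `|W (low tau0 x h) w|].
Proof.
apply: sub_sigma_algebra; left.
exists (band (r2 * tau0) (r2 * x) (r2 * (x + h))), [set y : R | a < `|y|]; split => //.
  exact: (noise_index_band _ _ _).1.
exact: (@measurable_norm_gt _ _ _ id).
Qed.

Lemma past_last_hit (b : Omega -> nat -> bool) N : (forall i, past [set w | b w i]) ->
  forall k, past ((fun w => last_hit (b w) N) @^-1` [set k]).
Proof.
move=> pb; elim: N => [|N ih] k /=.
  case: k => [|k]; last first.
    rewrite (_ : _ @^-1` _ = set0); first exact: sigma_algebra0.
    by apply/seteqP; split => w.
  rewrite (_ : _ @^-1` _ = setT); first by rewrite pastE; exact: measurableT.
  by apply/seteqP; split => w.
have -> : (fun w => if b w N then N else last_hit (b w) N) @^-1` [set k] =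
    ([set w | b w N] `&` [set w | N = k]) `|`
    (~` [set w | b w N] `&` (fun w => last_hit (b w) N) @^-1` [set k]).
  apply/seteqP; split => w /=; first by case: ifP => bN; [left|right].
  by case=> [[-> //]|[/negP/negbTE ->]].
have pb' : measurable ([set w | b w N] : set T) := pb N.
have ih' : measurable ((fun w => last_hit (b w) N) @^-1` [set k] : set T) := ih k.
rewrite pastE; apply: measurableU.
  apply: measurableI => //; have [->|Nk] := eqVneq N k.
    by rewrite (_ : [set w | _] = setT) //; apply/seteqP; split.
  by rewrite (_ : [set w | _] = set0) //; apply/seteqP; split => // w /= /eqP; rewrite (negbTE Nk).
by apply: measurableI => //; exact: measurableC.
Qed.

(** Successive random choices remain in the past because each takes countably many values. *)
Lemma past_index_comp (K : Omega -> nat) (F : nat -> Omega -> nat) :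
  (forall k, past (K @^-1` [set k])) -> (forall j k, past (F j @^-1` [set k])) ->
  forall k, past ((fun w => F (K w) w) @^-1` [set k]).
Proof.
move=> pK pF k.
have -> : (fun w => F (K w) w) @^-1` [set k] =
    \bigcup_j (K @^-1` [set j] `&` F j @^-1` [set k]).
  by apply/seteqP; split => w /= => [h|[j _ [/= <-]]]//; exists (K w).
rewrite pastE; apply: bigcupT_measurable => j.
have pK' : measurable (K @^-1` [set j] : set T) := pK j.
have pF' : measurable (F j @^-1` [set k] : set T) := pF j k.
exact: measurableI.
Qed.

Lemma past_index_cst (c k : nat) : past ((fun _ : Omega => c) @^-1` [set k]).
Proof.
have [->|ck] := eqVneq c k.
  by rewrite (_ : _ @^-1` _ = setT) ?pastE//; apply/seteqP; split.
rewrite (_ : _ @^-1` _ = set0) ?pastE//; apply/seteqP; split => // w /= /eqP.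
by rewrite (negbTE ck).
Qed.

Lemma past_index_fun (K : Omega -> nat) (f : nat -> nat) :
  (forall k, past (K @^-1` [set k])) -> forall k, past ((fun w => f (K w)) @^-1` [set k]).
Proof.
move=> pK; apply: (past_index_comp (F := fun j _ => f j) pK) => j k.
exact: past_index_cst.
Qed.

Lemma past_measurable_index (K : Omega -> nat) (f : nat -> R) :
  (forall k, past (K @^-1` [set k])) -> past_measurable W tau0 (fun w => f (K w)).
Proof.
move=> pK _ B mB; rewrite setTI.
have -> : (fun w => f (K w)) @^-1` B = \bigcup_(j in [set j | B (f j)]) K @^-1` [set j].
  by apply/seteqP; split => w /= => [h|[j Bj /= ->]]//; exists (K w).
by apply: bigcup_measurable => j _; exact: pK.
Qed.

Lemma past_measurable_lim (f : nat -> Omega -> R) (g : Omega -> R) :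
  (forall n, past_measurable W tau0 (f n)) ->
  (forall w, f n w @[n --> \oo] --> g w) -> past_measurable W tau0 g.
Proof.
move=> pf fg; apply: (@measurable_fun_cvg _ T R setT f g) => //.
Qed.

End past_index.

Section singular_point.
Context (R : realType) (d : measure_display) (Omega : measurableType d)
  (P : probability Omega R) (beta tau0 : R) (W : set (R * R) -> {RV P >-> R})
  (u : R -> R -> {RV P >-> R}).
Hypothesis P_complete : measure_is_complete P.
Hypothesis beta01 : 0 < beta < 1.
Hypothesis tau0_gt0 : 0 < tau0.
Hypothesis W_noise : colored_noise beta W.
Hypothesis u_sol : continuous_solution W u.

Let e0 n : 0 < 2 ^+ n :> R. Proof. by rewrite exprn_gt0. Qed.

Let pow2_div a b : (a <= b)%N -> (2 ^ (b - a))%:R / 2 ^+ b = 2 ^- a :> R.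
Proof.
move=> ab; rewrite natrX -[in 2 ^+ b](subnK ab) exprD invfM mulrA divff ?mul1r//.
Qed.

Let gauge m : R := lil_gauge beta (4 ^- m).

Let gauge_gt0 m : (2 <= m)%N -> 0 < gauge m.
Proof.
move=> m2; rewrite /gauge lil_gauge_pow4 sqrtr_gt0 mulr_gt0//.
have /andP[h _] := ln_pow4_bounds R m.
rewrite ln_gt0//; apply: lt_le_trans h; by rewrite ltr1n.
Qed.

Section construction.
(** [rr n] is the level of the nested interval and [mm n] that of the grid searched inside it, for
    increments of length [4 ^- mm n]. [O n] is the event that a displacement of [2 ^- rr n.+1] may
    alter the path by more than a quarter of the gauge; this is what decides how far [rr n.+1] lies
    beyond [mm n]. *)
Variables (mm rr : nat -> nat) (O : nat -> set Omega).
Hypothesis rr0 : rr 0%N = 0%N.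
Hypothesis rm : forall n, (rr n < mm n)%N.
Hypothesis mr : forall n, (mm n < rr n.+1)%N.
Hypothesis mm2 : forall n, (2 <= mm n)%N.
Hypothesis low_bad : forall n j,
  (P [set w | forall i, (i < 2 ^ (mm n - (rr n).+1))%N ->
     (`|W (low tau0 ((j + i)%:R / 2 ^+ mm n) (4 ^- mm n)) w| <=
       4 * n.+1%:R * gauge (mm n))%R] <= (2 ^- n / (2 ^ rr n).*2.+1%:R)%:E)%E.
Hypothesis high_bad : forall n x, 0 <= x <= 2 ->
  (P [set w | (n.+1%:R * gauge (mm n) < `|W (high tau0 x (4 ^- mm n)) w|)%R] <=
     (2 ^- n)%:E)%E.
Hypothesis mO : forall n, measurable (O n).
Hypothesis PO : forall n, (P (O n) <= (2 ^- n)%:E)%E.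
Hypothesis O_osc : forall n, {ae P, forall w, ~ O n w -> forall x y,
  0 <= x <= 4 -> 0 <= y <= 4 -> `|x - y| <= 2 ^- rr n.+1 ->
  `|rotate u tau0 x w - rotate u tau0 y w| <= gauge (mm n) / 4}.

Let N n := (2 ^ (mm n - (rr n).+1))%N.
Let hit n (j : nat) w i := 4 * n.+1%:R * gauge (mm n) <
  `|W (low tau0 ((j * 2 ^ (mm n - rr n) + i)%:R / 2 ^+ mm n) (4 ^- mm n)) w|.
Let step n j w := (j * 2 ^ (mm n - rr n) + last_hit (hit n j w) (N n))%N.

(** [J n] is the index of the current point at level [rr n]; a grid index chosen at level [mm n] is
    rescaled to level [rr n.+1]. Starting from 1 places the limit in [1, 2], hence makes it
    positive. *)
Let J := nat_rect (fun=> Omega -> nat) (fun=> 1%N)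
  (fun n Jn w => step n (Jn w) w * 2 ^ (rr n.+1 - mm n))%N.
Let K n w := step n (J n w) w.
Let y n w : R := (J n w)%:R / 2 ^+ rr n.

Let past_J n k : <<s past_events W tau0 >> (J n @^-1` [set k]).
Proof.
elim: n k => [|n ih] k /=.
  exact: past_index_cst.
apply: (past_index_fun (fun i => (i * 2 ^ (rr n.+1 - mm n))%N)) => k'.
apply: (past_index_comp ih) => j k''.
apply: (past_index_fun (fun i => (j * 2 ^ (mm n - rr n) + i)%N)).
by apply: past_last_hit => i; exact: past_low.
Qed.

Let past_K n k : <<s past_events W tau0 >> (K n @^-1` [set k]).
Proof.
apply: (past_index_comp (past_J n)) => j k'.
apply: (past_index_fun (fun i => (j * 2 ^ (mm n - rr n) + i)%N)).
by apply: past_last_hit => i; exact: past_low.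
Qed.

Let yK n w : y n.+1 w = (K n w)%:R / 2 ^+ mm n.
Proof.
rewrite /y -[J n.+1 w]/(K n w * 2 ^ (rr n.+1 - mm n))%N natrM -mulrA.
by rewrite pow2_div// ltnW.
Qed.

(** The intervals of length [2 ^- rr n] from [y n w] are nested: the chosen grid cell lies in the
    left half of the current interval, and the next length is at most one cell. *)
Let y_step n w : y n w <= y n.+1 w /\
  y n.+1 w + 2 ^- rr n.+1 <= y n w + 2 ^- rr n.
Proof.
have iN : (last_hit (hit n (J n w) w) (N n) < N n)%N by apply: last_hit_lt; rewrite expn_gt0.
rewrite yK /K /step; set i := last_hit _ _ in iN *.
rewrite natrD mulrDl natrM -mulrA pow2_div ?(ltnW (rm n))// -/(y n w).
have i0 : 0 <= i%:R / 2 ^+ mm n :> R by rewrite divr_ge0// ltW.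
have i1 : i%:R / 2 ^+ mm n + (2 ^+ mm n)^-1 <= 2 ^- (rr n).+1 :> R.
  rewrite -(pow2_div (rm n)).
  have -> : i%:R / 2 ^+ mm n + (2 ^+ mm n)^-1 = i.+1%:R / 2 ^+ mm n :> R.
    by rewrite -[i.+1%:R]natr1 mulrDl mul1r.
  by rewrite ler_pM2r ?invr_gt0// ler_nat.
have h1 : 2 ^- rr n.+1 <= (2 ^+ mm n)^-1 :> R.
  by rewrite lef_pV2 ?posrE// ler_eXn2l ?ltr1n// ltnW.
have h2 : 2 ^- (rr n).+1 <= 2 ^- rr n :> R.
  by rewrite lef_pV2 ?posrE// ler_eXn2l ?ltr1n.
by split; lra.
Qed.

Let y_nondecr w : nondecreasing_seq (y ^~ w).
Proof. by apply/nondecreasing_seqP => n; exact: (y_step n w).1. Qed.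

Let y_upper n k w : (n <= k)%N -> y k w + 2 ^- rr k <= y n w + 2 ^- rr n.
Proof.
move=> /subnK <-; elim: (k - n)%N => [|i ih] //.
by rewrite addSn; apply: le_trans ih; exact: (y_step _ w).2.
Qed.

Let y0 w : y 0 w = 1.
Proof. by rewrite /y rr0 expr0 divr1. Qed.

Let y_cvg w : cvgn (y ^~ w).
Proof.
apply: nondecreasing_is_cvgn => //; exists 2 => _ [n _ <-].
have := y_upper w (leq0n n); rewrite y0 rr0 expr0 invr1 => h.
have : 0 <= 2 ^- rr n :> R by rewrite invr_ge0 ltW.
lra.
Qed.

Let Lambda w : R := limn (y ^~ w).

Let Lambda_ge n w : y n w <= Lambda w.
Proof. exact: nondecreasing_cvgn_le. Qed.

Let Lambda_le n w : Lambda w <= y n w + 2 ^- rr n.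
Proof.
apply: limr_le => //; exists n => // k /= nk.
have := y_upper w nk; have : 0 <= 2 ^- rr k :> R by rewrite invr_ge0 ltW.
lra.
Qed.

Let Lambda12 w : 1 <= Lambda w <= 2.
Proof.
have := Lambda_ge 0 w; have := Lambda_le 0 w.
rewrite y0 rr0 expr0 invr1 => h1 h2; apply/andP; split; lra.
Qed.

Let y12 n w : 1 <= y n w <= 2.
Proof.
have := y_nondecr w (leq0n n); have := Lambda_ge n w; have /andP[_ h] := Lambda12 w.
by rewrite y0 => h1 h2; rewrite h2 (le_trans h1).
Qed.

(** The index [J n] depends on the same noise, so no conditioning is possible. All starting points
    of [0, 2] at level [rr n] are considered at once; their number is the divisor in [low_bad]. *)
Let fail n := \bigcup_(j in `I_((2 ^ rr n).*2.+1)) [set w | forall i, (i < N n)%N ->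
  `|W (low tau0 ((j * 2 ^ (mm n - rr n) + i)%:R / 2 ^+ mm n) (4 ^- mm n)) w| <=
    4 * n.+1%:R * gauge (mm n)].

(** The minimum keeps the position in [0, 2] for every index, as [high_bad] demands; on the indices
    actually chosen it changes nothing. *)
Let high_at n k := high tau0 ((minn k (2 * 2 ^ mm n))%:R / 2 ^+ mm n) (4 ^- mm n).

Let loud n := [set w | n.+1%:R * gauge (mm n) < `|W (high_at n (K n w)) w|].

Let measurable_quiet n j : measurable [set w | forall i, (i < N n)%N ->
  `|W (low tau0 ((j * 2 ^ (mm n - rr n) + i)%:R / 2 ^+ mm n) (4 ^- mm n)) w| <=
    4 * n.+1%:R * gauge (mm n)].
Proof.
apply: measurable_forall_lt => i.
by apply: measurable_norm_le; exact: measurable_funPT.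
Qed.

Let fail_small n : measurable (fail n) /\ (P (fail n) <= (2 ^- n)%:E)%E.
Proof.
split; first exact: bigcup_measurable.
apply: le_trans (finite_union_bound (b := 2 ^- n / (2 ^ rr n).*2.+1%:R) _ _) _ => //.
  by move=> j _; exact: low_bad.
by rewrite lee_fin -[leLHS]mulr_natr divfK// pnatr_eq0.
Qed.

Let loud_small n : measurable (loud n) /\ (P (loud n) <= (2 ^- n)%:E)%E.
Proof.
split; first exact: (measurable_selected P_complete (high_at n) (past_K n)).
apply: (selected_tail P_complete W_noise (past_K n) (A := high_at n)).
- by move=> k; exact: noise_index_high.
- by move=> k p; exact: high_time.
- by rewrite mulr_ge0// ltW// gauge_gt0.
- move=> k; apply: high_bad; rewrite divr_ge0 ?(ltW (e0 _))//=.
  rewrite ler_pdivrMr// -natrX -natrM ler_nat; exact: geq_minr.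
Qed.

Let good : {ae P, forall w, exists n0, forall n, (n0 <= n)%N ->
  ~ (fail n `|` loud n `|` O n) w}.
Proof.
apply: (@borel_cantelli _ _ _ P _ (fun n => 3 * 2^-1 ^+ n) 6).
- move=> n; apply: measurableU => //.
  by apply: measurableU; [exact: (fail_small n).1|exact: (loud_small n).1].
- move=> n.
  have m1 : measurable (fail n `|` loud n).
    by apply: measurableU; [exact: (fail_small n).1|exact: (loud_small n).1].
  apply: le_trans (measureU2 _ m1 (mO n)) _.
  have -> : 3 * 2^-1 ^+ n = 2 ^- n + 2 ^- n + 2 ^- n :> R by rewrite exprVn; ring.
  rewrite !EFinD; apply: leeD; last exact: PO.
  apply: le_trans (measureU2 _ (fail_small n).1 (loud_small n).1) _.
  by apply: leeD; [exact: (fail_small n).2|exact: (loud_small n).2].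
- move=> n; apply: le_trans (sum_geometric_le _ _ _) _ => //.
    by apply/andP; split; lra.
  by have -> : 1 - 2^-1 = 2^-1 :> R by [field]; rewrite invrK; lra.
Qed.

Let incr : {ae P, forall w n k,
  rotate u tau0 (k%:R / 2 ^+ mm n + 4 ^- mm n) w - rotate u tau0 (k%:R / 2 ^+ mm n) w =
  2^-1 * (W (low tau0 (k%:R / 2 ^+ mm n) (4 ^- mm n)) w +
          W (high tau0 (k%:R / 2 ^+ mm n) (4 ^- mm n)) w)}.
Proof.
apply: ae_foralln => n; apply: ae_foralln => k.
apply: (rotate_increment tau0_gt0 W_noise u_sol); first by rewrite divr_ge0// ltW.
by rewrite invr_ge0 exprn_ge0.
Qed.

Lemma lil_limsup_Lambda : exists Lambda : Omega -> R, [/\ forall w, 0 < Lambda w,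
  past_measurable W tau0 Lambda &
  {ae P, forall w,
    lil_limsup beta (fun lam => rotate u tau0 lam w) (Lambda w) = +oo%E}].
Proof.
exists Lambda; split.
- by move=> w; have /andP[h _] := Lambda12 w; exact: lt_le_trans h.
- apply: (@past_measurable_lim _ _ _ _ _ _ y) => [n|w]; last exact: y_cvg.
  exact: (past_measurable_index (fun k => k%:R / 2 ^+ rr n) (past_J n)).
have /ae_foralln osc := O_osc.
have g0 := good; have i0 := incr.
near=> w.
have [n0 hn0] : exists n0, forall n, (n0 <= n)%N -> ~ (fail n `|` loud n `|` O n) w.
  by near: w.
have oscw : forall n, ~ O n w -> forall x y, 0 <= x <= 4 -> 0 <= y <= 4 ->
  `|x - y| <= 2 ^- rr n.+1 ->
  `|rotate u tau0 x w - rotate u tau0 y w| <= gauge (mm n) / 4 by near: w.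
have incrw : forall n k,
  rotate u tau0 (k%:R / 2 ^+ mm n + 4 ^- mm n) w - rotate u tau0 (k%:R / 2 ^+ mm n) w =
  2^-1 * (W (low tau0 (k%:R / 2 ^+ mm n) (4 ^- mm n)) w +
          W (high tau0 (k%:R / 2 ^+ mm n) (4 ^- mm n)) w) by near: w.
apply/lil_limsup_pinftyP => M e e_gt0.
(* [n.+1] exceeds both [M], to make the ratio large, and [1 / e], to make the increment short, since
   [mm n] is larger than [n]. *)
pose n := maxn n0 (Num.truncn (Num.max M e^-1)).
have hn : Num.max M e^-1 < n.+1%:R.
  by apply: lt_le_trans (truncnS_gt _) _; rewrite ler_nat ltnS leq_maxr.
move: hn; rewrite gt_max => /andP[Mn en].
have nr : (n <= rr n)%N.
  by elim: (n) => // i ih; apply: leq_ltn_trans ih _; exact: ltn_trans (rm i) (mr i).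
have nm : (n.+1 <= mm n)%N by apply: leq_ltn_trans nr (rm n).
set h : R := 4 ^- mm n.
have h0 : 0 < h by rewrite invr_gt0 exprn_gt0.
have h1 : h <= 1 by rewrite invf_le1 ?exprn_gt0// exprn_ege1// ler1n.
have he : h < e.
  rewrite -[e]invrK ltf_pV2 ?posrE ?invr_gt0 ?exprn_gt0//.
  apply: lt_trans en _; rewrite -natrX ltr_nat; apply: leq_ltn_trans nm _.
  exact: ltn_expl.
exists h; first by rewrite h0.
have gp : 0 < gauge (mm n) := gauge_gt0 (mm2 n).
rewrite ltr_pdivlMr//.
have nb : ~ (fail n `|` loud n `|` O n) w by apply: hn0; exact: leq_maxl.
have nO : ~ O n w by move=> ?; apply: nb; right.
have nl : ~ loud n w by move=> ?; apply: nb; left; right.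
have nf : ~ fail n w by move=> ?; apply: nb; left; left.
have /andP[y1 y2] := y12 n.+1 w.
have /andP[L1 L2] := Lambda12 w.
have dL : `|Lambda w - y n.+1 w| <= 2 ^- rr n.+1.
  have := Lambda_ge n.+1 w; have := Lambda_le n.+1 w => ? ?.
  by rewrite ger0_norm; lra.
(* Moving each end of the increment from the grid point to the limit costs a quarter of the
   gauge. *)
have o1 : `|rotate u tau0 (Lambda w) w - rotate u tau0 (y n.+1 w) w| <= gauge (mm n) / 4.
  by apply: oscw => //; apply/andP; split; lra.
have o2 : `|rotate u tau0 (Lambda w + h) w - rotate u tau0 (y n.+1 w + h) w| <=
    gauge (mm n) / 4.
  apply: oscw => //; [apply/andP; split; lra|apply/andP; split; lra|].
  by rewrite opprD addrACA subrr addr0.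
have big : 4 * n.+1%:R * gauge (mm n) < `|W (low tau0 (y n.+1 w) h) w|.
  rewrite yK /K /step.
  have [i iN hi] : exists2 i, (i < N n)%N & hit n (J n w) w i.
    apply: contrapT => nh; apply: nf; exists (J n w) => /=.
      have /andP[_ yn] := y12 n w.
      by move: yn; rewrite /y ler_pdivrMr// -natrX -natrM ler_nat mul2n ltnS.
    by move=> i iN; rewrite leNgt; apply/negP => hi; apply: nh; exists i.
  exact: (last_hitP iN hi).
have small : `|W (high tau0 (y n.+1 w) h) w| <= n.+1%:R * gauge (mm n).
  rewrite leNgt; apply/negP => hl; apply: nl; move: hl; rewrite /loud/= /high_at yK.
  have -> // : minn (K n w) (2 * 2 ^ mm n) = K n w.
  apply/minn_idPl; move: y2.
  by rewrite yK ler_pdivrMr// -natrX -natrM ler_nat.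
have I := incrw n (K n w); rewrite -yK -/h in I.
set a := W (low _ _ _) w in I big; set b := W (high _ _ _) w in I small.
have ab : `|a| <= `|a + b| + `|b|.
  by rewrite -{1}[a](addrK b) (le_trans (ler_normB _ _)).
set f1 := rotate u tau0 (Lambda w + h) w in o2 *; set f2 := rotate u tau0 (Lambda w) w in o1 *.
set x1 := rotate u tau0 (y n.+1 w + h) w in o2 I; set x2 := rotate u tau0 (y n.+1 w) w in o1 I.
(* In units of the gauge, the grid increment exceeds half of [4 * n.+1 - n.+1]; the displacement of
   the two ends costs 1/2, which leaves at least [n.+1], more than [M]. This is the origin of the
   factor 4 in the threshold. *)
have tri : `|x1 - x2| <= `|f1 - f2| + (`|f1 - x1| + `|f2 - x2|).
  have -> : x1 - x2 = (f1 - f2) - ((f1 - x1) - (f2 - x2)) by ring.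
  apply: le_trans (ler_normB _ _) _; rewrite lerD2l; exact: ler_normB.
rewrite I normrM ger0_norm ?invr_ge0// in tri.
have n1 : gauge (mm n) <= n.+1%:R * gauge (mm n) by rewrite ler_peMl ?ler1n// ltW.
have Mg : M * gauge (mm n) < n.+1%:R * gauge (mm n) by rewrite ltr_pM2r.
rewrite -[lil_gauge beta h]/(gauge (mm n)).
rewrite -mulrA in big.
lra.
Unshelve. all: by end_near. Qed.

End construction.

Lemma exists_lil_limsup : exists Lambda : Omega -> R, [/\ forall w, 0 < Lambda w,
  past_measurable W tau0 Lambda &
  {ae P, forall w,
    lil_limsup beta (fun lam => rotate u tau0 lam w) (Lambda w) = +oo%E}].
Proof.
(* The two levels are chosen alternately, each after the other, so each choice is a function of a
   pair: here the stage and the level of the current interval. *)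
have ex_m (p : nat * nat) : exists m, [/\ (p.2 < m)%N, (2 <= m)%N,
    forall j, (P [set w | forall i, (i < 2 ^ (m - p.2.+1))%N ->
      (`|W (low tau0 ((j + i)%:R / 2 ^+ m) (4 ^- m)) w| <=
       4 * p.1.+1%:R * gauge m)%R] <= (2 ^- p.1 / (2 ^ p.2).*2.+1%:R)%:E)%E &
    forall x, 0 <= x <= 2 ->
      (P [set w | (p.1.+1%:R * gauge m < `|W (high tau0 x (4 ^- m)) w|)%R] <=
       (2 ^- p.1)%:E)%E].
  have c1 : 0 < 4 * p.1.+1%:R :> R by rewrite mulr_gt0.
  have c2 : 0 < p.1.+1%:R :> R by [].
  have v1 : 0 < 2 ^- p.1 :> R by rewrite invr_gt0.
  have v2 : 0 < 2 ^- p.1 / (2 ^ p.2).*2.+1%:R :> R by rewrite divr_gt0.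
  have [m [[h1 h2] [h3 h4]]] := filter_ex (filterI
    (filterI (nbhs_infty_ge p.2.+1) (nbhs_infty_ge 2))
    (filterI (low_small beta01 tau0_gt0 W_noise p.2 c1 v2)
      (high_small tau0 beta01 W_noise c2 v1))).
  by exists m.
have [fm hfm] := choice ex_m.
(* Here the pair is the stage and the grid level. The guard [2 <= p.2] makes the choice total, the
   gauge being known to be positive from that level on. *)
have ex_r (p : nat * nat) : exists rO : nat * set Omega, (2 <= p.2)%N ->
    [/\ (p.2 < rO.1)%N, measurable rO.2, (P rO.2 <= (2 ^- p.1)%:E)%E &
    {ae P, forall w, ~ rO.2 w -> forall x y, 0 <= x <= 4 -> 0 <= y <= 4 ->
      `|x - y| <= 2 ^- rO.1 ->
      `|rotate u tau0 x w - rotate u tau0 y w| <= gauge p.2 / 4}].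
  case: (leqP 2 p.2) => p2; last by exists (0%N, set0).
  have g4 : 0 < gauge p.2 / 4 by rewrite divr_gt0// gauge_gt0.
  have v1 : 0 < 2 ^- p.1 :> R by rewrite invr_gt0.
  have [r [E [h1 h2 h3 h4]]] := small_oscillation tau0_gt0 u_sol p.2.+1 g4 v1.
  by exists (r, E).
have [fr hfr] := choice ex_r.
pose rr := nat_rect (fun=> nat) 0%N (fun n r => (fr (n, fm (n, r))).1).
pose mm n := fm (n, rr n).
have mm2 n : (2 <= mm n)%N by have [] := hfm (n, rr n).
apply: (@lil_limsup_Lambda mm rr (fun n => (fr (n, mm n)).2)) => // n.
- by have [] := hfm (n, rr n).
- by have [] := hfr (n, mm n) (mm2 n).
- by have [] := hfm (n, rr n).
- by have [_ _ _ +] := hfm (n, rr n); exact.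
- by have [] := hfr (n, mm n) (mm2 n).
- by have [] := hfr (n, mm n) (mm2 n).
- by have [] := hfr (n, mm n) (mm2 n).
Qed.

End singular_point.

Theorem theorem4p3 (R : realType) (d : measure_display)
    (Omega : measurableType d) (P : probability Omega R)
    (beta tau0 : R) (W : set (R * R) -> {RV P >-> R})
    (u : R -> R -> {RV P >-> R})
    (P_complete : measure_is_complete P)
    (beta01 : 0 < beta < 1) (tau0_gt0 : 0 < tau0)
    (W_noise : colored_noise beta W) (u_sol : continuous_solution W u) :
  (exists Lambda : Omega -> R,
    [/\ forall w, 0 < Lambda w,
        past_measurable W tau0 Lambda
      & {ae P, forall w,
          lil_limsup beta (fun lam => rotate u tau0 lam w) (Lambda w) = +oo%E}])
  /\
  (forall Lambda : Omega -> R,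
    (forall w, 0 < Lambda w) ->
    past_measurable W tau0 Lambda ->
    {ae P, forall w, forall tau : R, tau0 < tau ->
      (lil_limsup beta (fun lam => rotate u tau0 lam w) (Lambda w) = +oo%E <->
       lil_limsup beta (fun lam => rotate u tau lam w) (Lambda w) = +oo%E)}).
Proof.
split; first exact: (exists_lil_limsup P_complete beta01 tau0_gt0 W_noise u_sol).
move=> Lambda Lambda0 pLambda.
exact: (lil_limsup_rotate P_complete beta01 tau0_gt0 W_noise u_sol).
Qed.
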